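(* The Hardy space $\mathcal H=H^2(\mathbb B_n)$ on the unit ball $\mathbb B_n$ of $\mathbb C^n$ fails to have the Invertible Multiplier Property when $n>1$. The failure is spectacular in that for any $(\mathbf a,\theta)\in\mathbb B_n^M\times\Sigma_M$ with at least two of the $\theta_m$ positive, there is no normalized invertible multiplier $\psi\in M_{\mathcal H}=H^\infty(\mathbb B_n)$ satisfying $$\theta_0\langle f,g\rangle_{\mathcal H}+\sum_{m=1}^M\theta_m\langle\widetilde{k_{a_m}}f,\widetilde{k_{a_m}}g\rangle_{\mathcal H}=\langle\psi f,\psi g\rangle_{\mathcal H},\qquad f,g\in\mathcal H.$$
   Context: $\mathbf a=(a_1,\dots,a_M)$ and $\Sigma_M=\{\theta=(\theta_0,\dots,\theta_M)\in[0,1]^{M+1}:\sum_{m=0}^M\theta_m=1\}$, $M\ge1$. $H^2(\mathbb B_n)$ is the space of holomorphic functions on $\mathbb B_n$ normed by $\|f\|^2=\int_{\partial\mathbb B_n}|f|^2d\sigma$ (boundary values), $\sigma$ being surface measure normalized so that $\|1\|_{\mathcal H}=1$; its normalized reproducing kernels are $\widetilde{k_a}(z)=\left(\sqrt{1-|a|^2}/(1-\overline a\cdot z)\right)^n$, with $\overline a\cdot z=\sum_j\overline{a_j}z_j$. $M_{\mathcal H}$ is the algebra of pointwise multipliers of $\mathcal H$, which equals $H^\infty(\mathbb B_n)$, the bounded holomorphic functions. A normalized invertible multiplier is a nonvanishing $\psi$ with $\psi,1/\psi\in M_{\mathcal H}$ and $\|\psi\|_{\mathcal H}=1$. The Invertible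 Multiplier Property for $\mathcal H$ means: for every $M\ge1$ and every $(\mathbf a,\theta)\in\mathbb B_n^M\times\Sigma_M$, a normalized invertible multiplier $\psi$ satisfying the displayed identity exists.
   Formalization: ''At least two θ_m positive'' is read as two positive weights at distinct points, θ_0 being attached to the origin; literally the claim fails (M=1, a_1=0, θ=(1/2,1/2), ψ=1), and whenever all positively weighted points coincide ψ is that point's normalized kernel. *)

(* Defs.v *)
(* MathComp with MathComp-Analysis.  Scalars are C := R[i] for R : realType. *)
From HB Require Import structures.
From mathcomp Require Import all_boot all_order all_algebra.
From mathcomp Require Import complex.
From mathcomp Require Import all_classical all_reals all_analysis.
From mathcomp Require Import measurable_realfun.

Set Implicit Arguments.
Unset Strict Implicit.
Unset Printing Implicit Defensive.

Import Order.TTheory GRing.Theory Num.Theory.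
Import numFieldNormedType.Exports.

Local Open Scope classical_set_scope.
Local Open Scope complex_scope.
Local Open Scope ring_scope.

Section image_measure.
Context d d' (T : measurableType d) (T' : measurableType d') (R : realType).
Variables (mu : {measure set T -> \bar R}) (f : {mfun T >-> T'}).

Definition image_measure := pushforward mu f.

Let image0 : image_measure set0 = 0%E.
Proof. exact: measure0. Qed.

Let image_ge0 A : (0 <= image_measure A)%E.
Proof. exact: measure_ge0. Qed.

Let image_sigma_additive : semi_sigma_additive image_measure.
Proof. exact: measure_semi_sigma_additive. Qed.

HB.instance Definition _ := isMeasure.Build _ _ _ image_measure
  image0 image_ge0 image_sigma_additive.

End image_measure.

Section complex_space.
Variable R : realType.

Definition csq (z : R[i]) : R := complex.Re z ^+ 2 + complex.Im z ^+ 2.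

Definition cdot n (a z : 'rV[R[i]]_n) : R[i] :=
  \sum_(j < n) conjc (a ord0 j) * z ord0 j.

(* The squared Euclidean norm.  The library norm on row vectors is the sup
   norm: it has the same topology (hence the same differentiable functions) but
   not the same unit ball. *)
Definition nsq n (z : 'rV[R[i]]_n) : R := \sum_(j < n) csq (z ord0 j).

Definition cball n : set 'rV[R[i]]_n := [set z | nsq z < 1].

(* R[i] carries no sigma-algebra in the library, so measures on C^n are taken
   on n-tuples of pairs (real part, imaginary part), identified with row
   vectors through cvec. *)
Definition cpt n : Type := n.-tuple (measurableTypeR R * measurableTypeR R)%type.
HB.instance Definition _ n := Measurable.on (cpt n).

Definition cvec n (x : cpt n) : 'rV[R[i]]_n :=
  \row_j ((tnth x j).1 +i* (tnth x j).2).

Definition csphere n : set (cpt n) := [set x | nsq (cvec x) = 1].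

Definition ccons n (p : cpt n * measurableTypeR R * measurableTypeR R) :
  cpt n.+1 := [tuple of (p.1.2, p.2) :: p.1.1].

Lemma measurable_ccons n : measurable_fun [set: _] (@ccons n).
Proof.
apply: (measurable_cons (f := fun p => (p.1.2, p.2)) (g := fun p => p.1.1)).
  apply/measurable_fun_pair => //.
  exact: (measurableT_comp measurable_snd measurable_fst).
exact: (measurableT_comp measurable_fst measurable_fst).
Qed.
HB.instance Definition _ n :=
  isMeasurableFun.Build _ _ _ _ (@ccons n) (@measurable_ccons n).

(* Lebesgue measure on C^n = R^(2n), one complex coordinate at a time. *)
Fixpoint vol n : {measure set (cpt n) -> \bar R} :=
  if n is m.+1 then
    image_measure (vol m \x @lebesgue_measure R \x @lebesgue_measure R)%E
                  (@ccons m)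
  else dirac ([tuple] : cpt 0).

Lemma measurable_fun_nsq n : measurable_fun [set: cpt n] (@nsq n \o @cvec n).
Proof.
rewrite (_ : _ \o _ = fun x : cpt n =>
  \sum_(j < n) ((tnth x j).1 ^+ 2 + (tnth x j).2 ^+ 2)); last first.
  by apply/funext => x; apply: eq_bigr => j _; rewrite mxE.
apply: measurable_sum => j; apply: measurable_funD; apply: measurable_funX.
- by apply: (measurableT_comp measurable_fst); exact: measurable_tnth.
- by apply: (measurableT_comp measurable_snd); exact: measurable_tnth.
Qed.

Lemma measurable_cball n : measurable (@cvec n @^-1` @cball n).
Proof.
rewrite (_ : _ @^-1` _ = (@nsq n \o @cvec n) @^-1` `]-oo, 1[%classic); last first.
  by apply/seteqP; split => x /=; rewrite in_itv.
by rewrite -[X in measurable X]setTI; exact: measurable_fun_nsq.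
Qed.

(* x |-> x / |x| *)
Definition cdir n (x : cpt n) : cpt n :=
  [tuple ((tnth x j).1 / Num.sqrt (nsq (cvec x)),
          (tnth x j).2 / Num.sqrt (nsq (cvec x))) | j < n].

Lemma measurable_cdir n : measurable_fun [set: cpt n] (@cdir n).
Proof.
have nsq_ge0 (x : cpt n) : 0 <= nsq (cvec x).
  by apply: sumr_ge0 => j _; rewrite addr_ge0 ?sqr_ge0.
have mV : measurable_fun [set: cpt n] (fun x => (Num.sqrt (nsq (cvec x)))^-1).
  rewrite (_ : (fun _ => _) = (@powR R ^~ (- 2^-1)) \o (@nsq n \o @cvec n)).
    exact: (measurableT_comp (measurable_powR _) (@measurable_fun_nsq n)).
  by apply/funext => x /=; rewrite powRN powR12_sqrt.
apply/measurable_fun_tnthP => j.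
rewrite (_ : _ \o _ = fun x : cpt n =>
  ((tnth x j).1 / Num.sqrt (nsq (cvec x)),
   (tnth x j).2 / Num.sqrt (nsq (cvec x)))); last first.
  by apply/funext => x; rewrite /= tnth_mktuple.
apply/measurable_fun_pair; apply: measurable_funM => //.
- by apply: (measurableT_comp measurable_fst); exact: measurable_tnth.
- by apply: (measurableT_comp measurable_snd); exact: measurable_tnth.
Qed.
HB.instance Definition _ n :=
  isMeasurableFun.Build _ _ _ _ (@cdir n) (@measurable_cdir n).

(* The normalized surface measure of the unit sphere, by polar coordinates: the
   law of x / |x| when x is uniformly distributed in the unit ball.  The Dirac
   mass is the default that mnormalize requires for measures of total mass 0 or
   +oo; it is never used since the ball has finite positive volume. *)
Definition sigma n : probability (cpt n) R :=
  distribution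
    (mnormalize (mrestr (vol n) (@measurable_cball n))
                (dirac ([tuple (0, 0) | _ < n] : cpt n)))
    (@cdir n).

Definition cintegral n (F : cpt n -> R[i]) : R[i] :=
  (\int[sigma n]_(x in @csphere n) complex.Re (F x)) +i*
  (\int[sigma n]_(x in @csphere n) complex.Im (F x)).

(* Complex (Frechet) differentiability, the scalar field being R[i]. *)
Definition holomorphic n (f : 'rV[R[i]]_n -> R[i]^o) : Prop :=
  forall z : ('rV[R[i]]_n : normedModType R[i]), cball z -> differentiable f z.

Definition radial n (f : 'rV[R[i]]_n -> R[i]) (r : R) (x : cpt n) : R[i] :=
  f (r%:C *: cvec x).

(* Boundary values are radial limits. *)
Definition bval n (f : 'rV[R[i]]_n -> R[i]) (x : cpt n) : R[i] :=
  lim ((radial f r x : R[i]^o) @[r --> 1^'-]).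

(* f belongs to H^2: f is holomorphic in the ball and has boundary values in
   L^2(sigma), attained both sigma-almost everywhere and in the L^2 sense (as is
   the case exactly when its L^2 means over the spheres of radius r < 1 are
   bounded).  Functions are total on C^n; only their values in the ball matter,
   hence the restriction to csphere throughout. *)
Definition hardy n (f : 'rV[R[i]]_n -> R[i]) : Prop :=
  [/\ holomorphic f,
      {ae sigma n, forall x, csphere x ->
         cvg ((radial f r x : R[i]^o) @[r --> 1^'-])},
      measurable_fun (@csphere n) (fun x => complex.Re (bval f x)) /\
      measurable_fun (@csphere n) (fun x => complex.Im (bval f x)),
      (\int[sigma n]_(x in @csphere n) (csq (bval f x))%:E < +oo)%E &
      (\int[sigma n]_(x in @csphere n) (csq (radial f r x - bval f x))%:E)%E
        @[r --> 1^'-] --> 0%E].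

Definition hinner n (f g : 'rV[R[i]]_n -> R[i]) : R[i] :=
  cintegral (fun x : cpt n => bval f x * conjc (bval g x)).

Definition hnorm n (f : 'rV[R[i]]_n -> R[i]) : R :=
  Num.sqrt (\int[sigma n]_(x in @csphere n) csq (bval f x)).

Definition khat n (a z : 'rV[R[i]]_n) : R[i] :=
  ((Num.sqrt (1 - nsq a))%:C / (1 - cdot a z)) ^+ n.

Definition multiplier n (phi : 'rV[R[i]]_n -> R[i]) : Prop :=
  forall f, hardy f -> hardy (fun z => phi z * f z).

Definition normalized_invertible_multiplier n (psi : 'rV[R[i]]_n -> R[i]) :=
  [/\ forall z, cball z -> psi z != 0, multiplier psi,
      multiplier (fun z => (psi z)^-1) & hnorm psi = 1].

Definition in_simplex M (theta : 'I_M.+1 -> R) : Prop :=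
  (forall m, 0 <= theta m <= 1) /\ \sum_(m < M.+1) theta m = 1.

(* The index 0 of theta is the weight of the unperturbed inner product, and
   lift ord0 m is the index of the weight attached to the point a m. *)
Definition represents n M (a : 'I_M -> 'rV[R[i]]_n) (theta : 'I_M.+1 -> R)
    (psi : 'rV[R[i]]_n -> R[i]) : Prop :=
  forall f g, hardy f -> hardy g ->
    (theta ord0)%:C * hinner f g
    + \sum_(m < M) (theta (lift ord0 m))%:C *
        hinner (fun z => khat (a m) z * f z) (fun z => khat (a m) z * g z)
    = hinner (fun z => psi z * f z) (fun z => psi z * g z).

Definition invertible_multiplier_property n : Prop :=
  forall M (a : 'I_M -> 'rV[R[i]]_n) (theta : 'I_M.+1 -> R),
    (1 <= M)%N -> (forall m, cball (a m)) -> in_simplex theta ->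
    exists psi, normalized_invertible_multiplier psi /\ represents a theta psi.

(* The point attached to the index i of theta: a m for i = lift ord0 m, and the
   origin for i = 0, since khat 0 is the constant 1. *)
Definition node n M (a : 'I_M -> 'rV[R[i]]_n) (i : 'I_M.+1) : 'rV[R[i]]_n :=
  oapp a 0 (unlift ord0 i).

End complex_space.

(* Main.v *)
(* Since 1 and K_u / psi belong to H^2, the representation applied to them gives
   psi = sum_i c_i K_{b_i} in the ball, the b_i being the nodes with positive
   weight.  Applied to pairs of kernels K_{b_i}, it shows that
   |psi|^2 - sum_i theta_i |khat_{b_i}|^2 is orthogonal to all products
   K_{b_i} conj(K_{b_j}), hence to itself: on the sphere the two squares agree.
   Restricting this identity to the circles of the sphere cut out by complex lines
   and comparing poles gives
     psi(z) (1 - <z, b_k>)^n = psi(b_k) (1 - |b_k|^2)^n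
   at an explicit point z of each line.  For n > 1 the line may turn so that z
   tends to 0, so the right-hand side is psi(0) for every node.  On a generic line,
   the node b_k whose inner product with the direction has largest modulus then
   turns the sum for psi(z) into one in which every other node contributes
   strictly less than it does in the sum for psi(0), a contradiction.

   The reproducing formula on the sphere is reduced by unitary invariance to
   functions of the first coordinate, and then, by Taylor expansion, to the moments
   of |z_0|^2, which satisfy a recurrence coming from infinitesimal rotations. *)
Require Import Defs.
From HB Require Import structures.
From mathcomp Require Import all_boot all_order all_algebra.
From mathcomp Require Import complex ring lra zify.
From mathcomp Require Import all_classical all_reals all_analysis.
From mathcomp Require Import measurable_realfun.
Import Order.TTheory GRing.Theory Num.Theory.
Import numFieldNormedType.Exports.

Set Implicit Arguments.
Unset Strict Implicit.
Unset Printing Implicit Defensive.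
Local Open Scope classical_set_scope.
Local Open Scope complex_scope.
Local Open Scope ring_scope.

(** * Complex moduli and line integrals *)

(** The point z attached to a node b_k and a complex line through 0 is the orthogonal projection of
    b_k onto that line. For n = 1 there is a single line, z is b_k itself and the pole identity is a
    tautology; for n > 1 the line can be made almost orthogonal to b_k, which drives z to 0. The
    equality psi(b_k) (1 - |b_k|^2)^n = psi(0) then turns every coefficient c_k into a positive
    multiple of 1 / conj(psi(0)). Phases can no longer compensate each other, and comparing moduli
    in the two sums is enough. Orthogonality becomes a pointwise identity because the gap is real
    and is itself a combination of the products against which it was tested: its square has integral
    0, and nonempty open subsets of the sphere have positive measure. The integrals over the sphere
    rest on unitary invariance and on |z| = 1: circle means are replaced by finite averages over
    roots of unity, and derivatives along rotations by first-order expansions with uniform error. *)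

Section Modulus.
Variable R : realType.
Implicit Types (x y : R) (z w : R[i]).

(** The norm of [R[i]] is valued in [R[i]]; this modulus is valued in [R], where the order is total
    and [lra] applies. *)
Definition cabs z : R := Normc.normc z.
Arguments cabs : simpl never.

Lemma normC z : `|z| = (cabs z)%:C. Proof. by []. Qed.

Lemma realC_inj : injective (fun x => x%:C). Proof. by move=> x y []. Qed.

Lemma lecR x y : (x%:C <= y%:C) = (x <= y).
Proof. by rewrite lecE /= eqxx. Qed.

Lemma ltcR x y : (x%:C < y%:C) = (x < y).
Proof. by rewrite ltcE /= eqxx. Qed.

Lemma cabs_ge0 z : 0 <= cabs z.
Proof. by rewrite -lecR -normC normr_ge0. Qed.

Lemma cabs0 : cabs 0 = 0. Proof. exact: Normc.normc0. Qed.
Lemma cabs1 : cabs 1 = 1. Proof. exact: Normc.normc1. Qed.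

Lemma cabsM z w : cabs (z * w) = cabs z * cabs w.
Proof. exact: Normc.normcM. Qed.

Lemma cabsN z : cabs (- z) = cabs z.
Proof. by apply: realC_inj; rewrite -!normC normrN. Qed.

Lemma cabsB z w : cabs (z - w) = cabs (w - z).
Proof. by rewrite -cabsN opprB. Qed.

Lemma cabsV z : cabs z^-1 = (cabs z)^-1.
Proof. exact: Normc.normcV. Qed.

Lemma cabsX z n : cabs (z ^+ n) = cabs z ^+ n.
Proof. by elim: n => [|n IH]; rewrite ?expr0 ?cabs1 // !exprS cabsM IH. Qed.

Lemma cabs_eq0 z : (cabs z == 0) = (z == 0).
Proof. by rewrite -(inj_eq realC_inj) -normC normr_eq0. Qed.

Lemma cabs_gt0 z : (0 < cabs z) = (z != 0).
Proof. by rewrite lt_def cabs_ge0 cabs_eq0 andbT. Qed.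

Lemma cabsD z w : cabs (z + w) <= cabs z + cabs w.
Proof. by rewrite -lecR rmorphD /= -!normC ler_normD. Qed.

Lemma cabs_sum (I : Type) (r : seq I) (P : pred I) (F : I -> R[i]) :
  cabs (\sum_(i <- r | P i) F i) <= \sum_(i <- r | P i) cabs (F i).
Proof.
elim/big_ind2 : _ => [|a b c d h k|]; rewrite ?cabs0 //.
by rewrite (le_trans (cabsD _ _))// lerD.
Qed.

Lemma cabs_real x : cabs x%:C = `|x|.
Proof.
by rewrite /cabs /Normc.normc /= expr0n /= addr0 sqrtr_sqr.
Qed.

Lemma cabs_conj z : cabs (conjc z) = cabs z.
Proof. by case: z => a b; rewrite /cabs /Normc.normc /= sqrrN. Qed.

Lemma cabs_sqr z : cabs z ^+ 2 = csq z.
Proof.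
by case: z => a b; rewrite /cabs /Normc.normc /csq/= sqr_sqrtr// addr_ge0 ?sqr_ge0.
Qed.

Lemma csq_cabs z : (csq z)%:C = z * conjc z.
Proof.
case: z => a b; rewrite /csq; simpc => /=.
by congr (_ +i* _); ring.
Qed.

Lemma csq_ge0 z : 0 <= csq z.
Proof. by rewrite addr_ge0 ?sqr_ge0. Qed.

Lemma Re_le_cabs z : `|complex.Re z| <= cabs z.
Proof. by rewrite -lecR -normC normc_ge_Re. Qed.

Lemma Im_le_cabs z : `|complex.Im z| <= cabs z.
Proof.
have := Re_le_cabs ('i%C * z); rewrite cabsM.
suff -> : cabs 'i%C = 1.
  by rewrite mul1r; case: z => a b; simpc; rewrite /= normrN.
by rewrite /cabs /Normc.normc /= expr0n /= add0r expr1n sqrtr1.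
Qed.

Lemma cabs_le_ReIm z : cabs z <= `|complex.Re z| + `|complex.Im z|.
Proof.
case: z => a b /=.
have -> : a +i* b = a%:C + 'i%C * b%:C by simpc.
rewrite (le_trans (cabsD _ _))// cabsM !cabs_real.
by rewrite /cabs /Normc.normc /= expr0n /= add0r expr1n sqrtr1 mul1r.
Qed.

Lemma realC_ge0 z : 0 <= z -> z = (complex.Re z)%:C.
Proof. by case: z => a b; rewrite lecE /= => /andP[/eqP -> _]. Qed.

Lemma ReB z w : complex.Re (z - w) = complex.Re z - complex.Re w.
Proof. exact: raddfB. Qed.
Lemma ImB z w : complex.Im (z - w) = complex.Im z - complex.Im w.
Proof. exact: raddfB. Qed.
End Modulus.

Section RealNorm.
Variable R : realType.
Variable V : normedModType R[i].

(** A norm over [R[i]] is a nonnegative element of [R[i]], hence real; this is its value in [R]. *)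
Definition vabs (v : V) : R := complex.Re `|v|.

Lemma normV (v : V) : `|v| = (vabs v)%:C.
Proof. exact: realC_ge0. Qed.

Lemma vabs_ge0 (v : V) : 0 <= vabs v.
Proof. by rewrite -lecR -normV normr_ge0. Qed.
End RealNorm.

Lemma vabsC (R : realType) (z : R[i]^o) : vabs z = cabs z. Proof. by []. Qed.

Section EpsDelta.
Variable R : realType.
Variables V W : normedModType R[i].

Lemma near_eps (x : V) (P : set V) :
  (\forall y \near x, P y) <->
  exists2 d : R, 0 < d & forall y, vabs (y - x) < d -> P y.
Proof.
split.
  move/nbhs_normP => [e /= e0 eP].
  have ee : e = (complex.Re e)%:C by apply/realC_ge0/ltW.
  exists (complex.Re e); first by rewrite -ltcR -ee.
  by move=> y yd; apply: eP; rewrite /= distrC normV ee ltcR.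
move=> [d d0 dP]; apply/nbhs_normP; exists d%:C; first by rewrite /= ltcR.
by move=> y /=; rewrite distrC normV ltcR; exact: dP.
Qed.

Lemma cont_eps (F : V -> W) (x : V) :
  {for x, continuous F} <->
  forall e : R, 0 < e -> exists2 d : R, 0 < d &
    forall y, vabs (y - x) < d -> vabs (F y - F x) < e.
Proof.
split=> [/cvgrPdist_lt cF e e0|cF].
  have /cF : 0 < e%:C by rewrite ltcR.
  move=> /near_eps[d d0 dP]; exists d => // y /dP.
  by rewrite distrC normV ltcR.
apply/cvgrPdist_lt => e e0.
have ee : e = (complex.Re e)%:C by apply/realC_ge0/ltW.
have /cF[d d0 dP] : 0 < complex.Re e by rewrite -ltcR -ee.
by apply/near_eps; exists d => // y /dP; rewrite distrC normV ee ltcR.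
Qed.

Lemma diff_eps (F : V -> W) (x : V) : differentiable F x ->
  forall e : R, 0 < e -> exists2 d : R, 0 < d &
    forall h, vabs h < d -> vabs (F (x + h) - F x - 'd F x h) <= e * vabs h.
Proof.
move=> dF e e0.
have /eqaddoP := diff_locally dF.
move=> /(_ e%:C); rewrite ltcR => /(_ e0) /near_eps[d d0 dP].
exists d => // h hd; have := dP h; rewrite subr0 => /(_ hd).
by rewrite !fctE/= !normV -rmorphM lecR; congr (vabs _ <= _); rewrite [h + x]addrC opprD addrA.
Qed.
End EpsDelta.

(** * Integrals of continuous functions over segments *)

Section IntervalIntegral.
Variable R : realType.
Implicit Types (a b m x y t : R) (f g : R -> R).
Local Notation mu := (@lebesgue_measure R).

Definition rint a b f : R := \int[mu]_(x in `[a, b]) f x.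

Definition cont_on a b f := {within `[a, b], continuous f}.

Lemma cont_on_int a b f : cont_on a b f -> mu.-integrable `[a, b] (EFin \o f).
Proof. by move=> cf; apply: continuous_compact_integrable => //; exact: segment_compact. Qed.

Lemma cont_onW a b x y f : a <= x -> y <= b -> cont_on a b f -> cont_on x y f.
Proof.
move=> ax yb; apply: continuous_subspaceW => t /=; rewrite !in_itv /= => /andP[xt ty].
by rewrite (le_trans ax xt) (le_trans ty yb).
Qed.

Lemma cont_onP a b f :
  (forall x, a <= x <= b -> forall e, 0 < e -> exists2 d, 0 < d &
     forall y, `|y - x| < d -> `|f y - f x| < e) -> cont_on a b f.
Proof.
move=> cf; apply: continuous_in_subspaceT => x; rewrite inE/= in_itv/= => /cf{}cf.
apply/cvgrPdist_lt => e /cf[d d0 dP]; apply/nbhs_ballP; exists d => // y /=.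
by rewrite /ball/= distrC => /dP; rewrite distrC.
Qed.

Lemma rintD a b f g : cont_on a b f -> cont_on a b g ->
  rint a b (fun x => f x + g x) = rint a b f + rint a b g.
Proof. by move=> cf cg; rewrite /rint RintegralD//; exact: cont_on_int. Qed.

Lemma rintZ a b k f : cont_on a b f ->
  rint a b (fun x => k * f x) = k * rint a b f.
Proof. by move=> cf; rewrite /rint RintegralZl//; exact: cont_on_int. Qed.

Lemma rint_split a m b f : a <= m -> m <= b -> cont_on a b f ->
  rint a b f = rint a m f + rint m b f.
Proof.
move=> am mb cf; rewrite /rint -(@Rintegral_itv_obnd_cbnd _ m).
  rewrite -(@Rintegral_itvB _ f (BLeft a) (BRight b) m) ?bnd_simp//; first by rewrite addrC subrK.
  exact: cont_on_int.
apply: integrableS (cont_on_int (cont_onW am (lexx b) cf)) => //.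
by apply: subset_itvr; rewrite bnd_simp.
Qed.

Lemma rint_bound a b f M : a <= b -> cont_on a b f ->
  (forall x, a <= x <= b -> `|f x| <= M) -> `|rint a b f| <= M * (b - a).
Proof.
move=> ab cf fM; rewrite /rint.
have If := cont_on_int cf.
rewrite (le_trans (le_normr_Rintegral _ If))//.
have mI : mu (`[a, b]%classic : set R) = (b - a)%:E.
  rewrite lebesgue_measure_itv /= lte_fin.
  move: ab; rewrite le_eqVlt => /predU1P[->|ab]; first by rewrite ltxx subrr.
  by rewrite ab -EFinD.
have -> : M * (b - a) = \int[mu]_(x in `[a, b]) M.
  rewrite Rintegral_cst//; congr (_ * _).
  by have /= -> := congr1 fine mI.
apply: le_Rintegral => //.
- exact: integrable_norm.
- by apply: (@cont_on_int _ _ (fun=> M)); apply: continuous_subspaceT => ?; exact: cvg_cst.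
Qed.

Lemma rint_FTC a b f F : a <= b -> continuous f ->
  (forall x, is_derive x (1 : R) F (f x)) -> rint a b f = F b - F a.
Proof.
rewrite le_eqVlt => /predU1P[<-|ab] cf dF.
  by rewrite /rint set_itv1 Rintegral_set1 subrr.
rewrite /rint /Rintegral (@continuous_FTC2 _ f F)//.
- exact: continuous_subspaceT.
- have cF x : F y @[y --> x] --> F x.
    by apply/differentiable_continuous/derivable1_diffP; have [] := dF x.
  split; first by move=> x _; have [] := dF x.
  + by apply: cvg_at_right_filter; exact: cF.
  + by apply: cvg_at_left_filter; exact: cF.
- by move=> x _; rewrite derive1E; have [_ ->] := dF x.
Qed.

Lemma rint_cst a b k : a <= b -> rint a b (fun=> k) = k * (b - a).
Proof.
move=> ab; have dF (x : R) : is_derive x (1 : R) (fun x => k * x) k.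
  by apply: is_derive_eq; rewrite /GRing.scale/= ?mulr1 ?mulr0 ?addr0 ?scaler0.
by rewrite (rint_FTC ab _ dF) ?mulrBr// => ?; exact: cvg_cst.
Qed.

Lemma rint_id a b : a <= b -> rint a b id = (b ^+ 2 - a ^+ 2) / 2.
Proof.
move=> ab; have dF (x : R) : is_derive x (1 : R) (fun x => 2^-1 * (x * x)) x.
  have h := is_deriveM (is_derive_id x (1 : R)) (is_derive_id x (1 : R)).
  have h2 := is_deriveZ (2^-1 : R) h.
  apply: (@is_derive_eq _ _ _ _ _ _ _ _ h2).
  by rewrite /GRing.scale/= !mulr1; field.
rewrite (rint_FTC ab _ dF); first by field.
by move=> ?; exact: cvg_id.
Qed.

Lemma eq_rint a b f g : (forall x, a <= x <= b -> f x = g x) ->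
  rint a b f = rint a b g.
Proof.
move=> fg; apply: eq_Rintegral => x; rewrite inE/= in_itv/=; exact: fg.
Qed.
End IntervalIntegral.

Section ComplexIntegral.
Variable R : realType.
Implicit Types (a b m x y t : R) (f g : R -> R[i]).

Definition ccont_on a b f :=
  cont_on a b (@complex.Re R \o f) /\ cont_on a b (@complex.Im R \o f).

Definition cint a b f : R[i] :=
  rint a b (@complex.Re R \o f) +i* rint a b (@complex.Im R \o f).

Lemma ccont_onP a b f :
  (forall x, a <= x <= b -> forall e, 0 < e -> exists2 d, 0 < d &
     forall y, `|y - x| < d -> cabs (f y - f x) < e) -> ccont_on a b f.
Proof.
move=> cf; split; apply: cont_onP => x xab e e0; have [d d0 dP] := cf x xab e e0;
  exists d => // y /dP; apply: le_lt_trans; rewrite /= -?ReB -?ImB.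
- exact: Re_le_cabs.
- exact: Im_le_cabs.
Qed.

Lemma cont_onD a b (f g : R -> R) : cont_on a b f -> cont_on a b g ->
  cont_on a b (fun x => f x + g x).
Proof. by move=> cf cg x; apply: continuousD; [exact: cf|exact: cg]. Qed.

Lemma cont_onZ a b k (f : R -> R) : cont_on a b f -> cont_on a b (fun x => k * f x).
Proof. by move=> cf x; apply: continuousM; [exact: cvg_cst|exact: cf]. Qed.

Lemma ccont_onD a b f g : ccont_on a b f -> ccont_on a b g ->
  ccont_on a b (fun x => f x + g x).
Proof.
move=> [fr fi] [gr gi]; split; rewrite /comp.
  have -> : (fun x => complex.Re (f x + g x)) = fun x => complex.Re (f x) + complex.Re (g x).
    by apply/funext => x; rewrite raddfD.
  exact: cont_onD.
have -> : (fun x => complex.Im (f x + g x)) = fun x => complex.Im (f x) + complex.Im (g x).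
  by apply/funext => x; rewrite raddfD.
exact: cont_onD.
Qed.

Lemma ReM (z w : R[i]) : complex.Re (z * w) =
  complex.Re z * complex.Re w - complex.Im z * complex.Im w.
Proof. by case: z w => [? ?] [? ?]. Qed.
Lemma ImM (z w : R[i]) : complex.Im (z * w) =
  complex.Re z * complex.Im w + complex.Im z * complex.Re w.
Proof. by case: z w => [? ?] [? ?]. Qed.

Lemma ccont_onZ a b k f : ccont_on a b f -> ccont_on a b (fun x => k * f x).
Proof.
move=> [fr fi]; split; rewrite /comp.
  have -> : (fun x => complex.Re (k * f x)) = fun x =>
      complex.Re k * complex.Re (f x) + (- complex.Im k) * complex.Im (f x).
    by apply/funext => x; rewrite ReM mulNr.
  by apply: cont_onD; exact: cont_onZ.
have -> : (fun x => complex.Im (k * f x)) = fun x =>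
    complex.Re k * complex.Im (f x) + complex.Im k * complex.Re (f x).
  by apply/funext => x; rewrite ImM.
by apply: cont_onD; exact: cont_onZ.
Qed.

Lemma eq_cint a b f g : (forall x, a <= x <= b -> f x = g x) ->
  cint a b f = cint a b g.
Proof. by move=> fg; congr (_ +i* _); apply: eq_rint => x /fg /= ->. Qed.

Lemma cintD a b f g : ccont_on a b f -> ccont_on a b g ->
  cint a b (fun x => f x + g x) = cint a b f + cint a b g.
Proof.
move=> [fr fi] [gr gi]; rewrite /cint; simpc; rewrite -!rintD//.
by congr (_ +i* _); apply: eq_rint => x _; rewrite /= raddfD.
Qed.

Lemma cintZ a b k f : ccont_on a b f ->
  cint a b (fun x => k * f x) = k * cint a b f.
Proof.
move=> [fr fi]; case: k => k l; rewrite /cint; simpc; rewrite -mulNr.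
rewrite -!rintZ// -!rintD//; do ?exact: cont_onZ.
by congr (_ +i* _); apply: eq_rint => x _; rewrite /= (ReM, ImM)/= ?mulNr.
Qed.

Lemma cintN a b f : ccont_on a b f -> cint a b (fun x => - f x) = - cint a b f.
Proof.
move=> cf; rewrite -mulN1r -cintZ//; apply: eq_cint => x _; by rewrite mulN1r.
Qed.

Lemma cint_split a m b f : a <= m -> m <= b -> ccont_on a b f ->
  cint a b f = cint a m f + cint m b f.
Proof.
by move=> am mb [fr fi]; rewrite /cint (rint_split am mb fr) (rint_split am mb fi); simpc.
Qed.

(** Real and imaginary parts are bounded separately, hence the factor 2. It is harmless: the bound
    only serves to make errors tend to 0. *)
Lemma cint_bound a b f M : a <= b -> ccont_on a b f ->
  (forall x, a <= x <= b -> cabs (f x) <= M) -> cabs (cint a b f) <= 2 * M * (b - a).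
Proof.
move=> ab [fr fi] fM; rewrite (le_trans (cabs_le_ReIm _))//=.
rewrite (_ : 2 * M * (b - a) = M * (b - a) + M * (b - a)); last by ring.
by rewrite lerD// rint_bound// => x /fM; apply: le_trans; rewrite (Re_le_cabs, Im_le_cabs).
Qed.

Lemma cint_cst a b k : a <= b -> cint a b (fun=> k) = k * (b - a)%:C.
Proof.
by move=> ab; case: k => k l; rewrite /cint /comp /= !rint_cst//; simpc.
Qed.

Lemma cint_id a b : a <= b -> cint a b (fun x => x%:C) = ((b ^+ 2 - a ^+ 2) / 2)%:C.
Proof.
move=> ab; rewrite /cint /comp /= rint_cst// mul0r.
by have /= -> := rint_id ab.
Qed.
End ComplexIntegral.

(** * Cauchy's theorem and Taylor expansion *)

Section RectangleIntegral.
Variable R : realType.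
Implicit Types (a b c d m x y t : R) (F : R[i] -> R[i]) (z p : R[i]).

Lemma subCE x y a b : (x +i* y) - (a +i* b) = (x - a) +i* (y - b) :> R[i].
Proof. by []. Qed.

Definition ccont F z := forall e : R, 0 < e -> exists2 r : R, 0 < r &
  forall w, cabs (w - z) < r -> cabs (F w - F z) < e.

(** Complex differentiability in increment form, the one that Goursat's argument consumes; [cdiffP]
    relates it to [derivable]. *)
Definition cdiff F z := exists D : R[i], forall e : R, 0 < e ->
  exists2 r : R, 0 < r &
    forall h, cabs h < r -> cabs (F (z + h) - F z - D * h) <= e * cabs h.

Lemma cdiff_ccont F z : cdiff F z -> ccont F z.
Proof.
move=> [D /(_ 1 ltr01)[r r0 rP]] e e0.
have K0 : 0 < 1 + cabs D by rewrite ltr_pwDl ?cabs_ge0.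
exists (Num.min r (e / (1 + cabs D))); first by rewrite lt_min r0 divr_gt0.
move=> w; rewrite lt_min => /andP[/rP]; rewrite [z + _]addrC subrK mul1r => h.
rewrite ltr_pdivlMr// mulrDr mulr1 => h2.
rewrite -(subrK (D * (w - z)) (F w - F z)) (le_lt_trans (cabsD _ _))//.
by rewrite (le_lt_trans _ h2)// lerD// cabsM mulrC.
Qed.

(** The contour integral along the boundary of the rectangle, counterclockwise; ['i] is the tangent
    of the vertical sides. *)
Definition rectint F a b c d : R[i] :=
  cint a b (fun x => F (x +i* c)) - cint a b (fun x => F (x +i* d))
  + 'i * (cint c d (fun y => F (b +i* y)) - cint c d (fun y => F (a +i* y))).

Definition inrect a b c d z :=
  (a <= complex.Re z <= b) /\ (c <= complex.Im z <= d).

Definition crect F a b c d := forall z, inrect a b c d z -> ccont F z.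

Lemma hor_cont F a b c d y : crect F a b c d -> c <= y <= d ->
  ccont_on a b (fun x => F (x +i* y)).
Proof.
move=> cF yP; apply: ccont_onP => x xab e e0.
have [r r0 rP] := cF (x +i* y) (conj xab yP) e e0.
exists r => // x' xr; apply: rP; rewrite subCE subrr.
by rewrite -[_ +i* 0]/((x' - x)%:C) cabs_real.
Qed.

Lemma ver_cont F a b c d x : crect F a b c d -> a <= x <= b ->
  ccont_on c d (fun y => F (x +i* y)).
Proof.
move=> cF xP; apply: ccont_onP => y ycd e e0.
have [r r0 rP] := cF (x +i* y) (conj xP ycd) e e0.
exists r => // y' yr; apply: rP; rewrite subCE subrr.
apply: le_lt_trans yr; rewrite (le_trans (cabs_le_ReIm _))//= normr0 add0r//.
Qed.

Lemma crectW F a b c d a' b' c' d' : a <= a' -> b' <= b -> c <= c' -> d' <= d ->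
  crect F a b c d -> crect F a' b' c' d'.
Proof.
move=> aa bb cc dd cF z [/andP[az zb] /andP[cz zd]]; apply: cF; split.
  by rewrite (le_trans aa az) (le_trans zb bb).
by rewrite (le_trans cc cz) (le_trans zd dd).
Qed.

Lemma rectint_splitx F a m b c d : a <= m -> m <= b -> c <= d ->
  crect F a b c d -> rectint F a b c d = rectint F a m c d + rectint F m b c d.
Proof.
move=> am mb cd cF; rewrite /rectint.
rewrite (cint_split am mb (hor_cont cF _)) ?lexx//.
rewrite (cint_split am mb (hor_cont cF _)) ?lexx ?andbT//.
by ring.
Qed.

Lemma rectint_splity F a b c m d : a <= b -> c <= m -> m <= d ->
  crect F a b c d -> rectint F a b c d = rectint F a b c m + rectint F a b m d.
Proof.
move=> ab cm md cF; rewrite /rectint.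
rewrite (cint_split cm md (ver_cont cF _)) ?lexx ?andbT//.
rewrite (cint_split cm md (ver_cont cF _)) ?lexx//.
by ring.
Qed.

Lemma rectintD F G a b c d : a <= b -> c <= d ->
  crect F a b c d -> crect G a b c d ->
  rectint (fun z => F z + G z) a b c d = rectint F a b c d + rectint G a b c d.
Proof.
move=> ab cd cF cG; rewrite /rectint.
have Hc : c <= c <= d by rewrite lexx.
have Hd : c <= d <= d by rewrite lexx andbT.
have Ha : a <= a <= b by rewrite lexx.
have Hb : a <= b <= b by rewrite lexx andbT.
rewrite (cintD (hor_cont cF Hc) (hor_cont cG Hc)) (cintD (hor_cont cF Hd) (hor_cont cG Hd)).
rewrite (cintD (ver_cont cF Ha) (ver_cont cG Ha)) (cintD (ver_cont cF Hb) (ver_cont cG Hb)).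
by ring.
Qed.

Lemma rectint_bound F a b c d M : a <= b -> c <= d -> crect F a b c d ->
  (forall z, inrect a b c d z -> cabs (F z) <= M) ->
  cabs (rectint F a b c d) <= 4 * M * ((b - a) + (d - c)).
Proof.
move=> ab cd cF FM.
have i1 : cabs ('i : R[i]) = 1.
  have : cabs ('i : R[i]) ^+ 2 = 1 by rewrite -cabsX sqrCi cabsN cabs1.
  by move=> /eqP; rewrite sqrp_eq1 ?cabs_ge0// => /eqP.
rewrite /rectint (le_trans (cabsD _ _))// cabsM i1 mul1r.
rewrite (_ : 4 * M * _ = (2 * M * (b - a) + 2 * M * (b - a))
  + (2 * M * (d - c) + 2 * M * (d - c))); last by ring.
apply: lerD; rewrite (le_trans (cabsD _ _))// cabsN lerD// cint_bound//.
- by apply: hor_cont cF _; rewrite lexx.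
- by move=> x xab; apply: FM; split => //=; rewrite lexx.
- by apply: hor_cont cF _; rewrite lexx andbT.
- by move=> x xab; apply: FM; split => //=; rewrite lexx andbT.
- by apply: ver_cont cF _; rewrite lexx andbT.
- by move=> x xab; apply: FM; split => //=; rewrite lexx andbT.
- by apply: ver_cont cF _; rewrite lexx.
- by move=> x xab; apply: FM; split => //=; rewrite lexx.
Qed.

Lemma ccont_affine (k l : R[i]) z : ccont (fun z => k + l * z) z.
Proof.
move=> e e0; have K0 : 0 < 1 + cabs l by rewrite ltr_pwDl ?cabs_ge0.
exists (e / (1 + cabs l)); first by rewrite divr_gt0.
move=> w; rewrite ltr_pdivlMr// => h.
rewrite (_ : _ - _ = l * (w - z)); last by ring.
rewrite cabsM mulrC (le_lt_trans _ h)// ler_wpM2l ?cabs_ge0//.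
by rewrite lerDr.
Qed.

Lemma ReImE (x y : R) : x +i* y = x%:C + 'i%C * y%:C.
Proof. by simpc. Qed.

(** Cauchy's theorem for tangent maps, by explicit integration: it leaves Goursat's argument with
    the remainder of the linear approximation only. *)
Lemma rectint_affine (k l : R[i]) a b c d : a <= b -> c <= d ->
  rectint (fun z => k + l * z) a b c d = 0.
Proof.
move=> ab cd.
have h (x y : R[i]) (u v : R) : u <= v ->
  cint u v (fun t => k + l * (x + y * t%:C)) =
    (k + l * x) * (v - u)%:C + l * y * ((v ^+ 2 - u ^+ 2) / 2)%:C.
  move=> uv; rewrite -cint_cst// -(cint_id uv) -cintZ.
    rewrite -cintD.
    - by apply: eq_cint => t _; ring.
    - by apply: (@hor_cont (fun=> _) u v 0 0 0); rewrite ?lexx// => z _ e e0;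
        exists 1 => // w _; rewrite subrr cabs0.
    - apply: ccont_onZ; apply: ccont_onP => s _ e e0; exists e => // t.
      by rewrite -rmorphB cabs_real.
  apply: ccont_onP => s _ e e0; exists e => // t.
  by rewrite -rmorphB cabs_real.
have hh y : cint a b (fun x => k + l * (x +i* y)) =
    (k + l * ('i%C * y%:C)) * (b - a)%:C + l * 1 * ((b ^+ 2 - a ^+ 2) / 2)%:C.
  by rewrite -h//; apply: eq_cint => t _; rewrite ReImE; ring.
have hv x : cint c d (fun y => k + l * (x +i* y)) =
    (k + l * x%:C) * (d - c)%:C + l * 'i%C * ((d ^+ 2 - c ^+ 2) / 2)%:C.
  by rewrite -h//; apply: eq_cint => t _; rewrite ReImE.
rewrite /rectint !hh !hv !rmorphM !rmorphB !rmorphXn /=.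
have -> : ('i : R[i]) = 'i%C by [].
by ring.
Qed.
End RectangleIntegral.

(** * Goursat's theorem *)

Section GoursatBisection.
Variable R : realType.
Implicit Types (a b c d m x y t : R) (F : R[i] -> R[i]) (z p : R[i]).

Lemma nested_point (x : nat -> R) (w : R) : 0 <= w ->
  (forall n, x n <= x n.+1 /\ x n.+1 + w / 2 ^+ n.+1 <= x n + w / 2 ^+ n) ->
  exists p : R, forall n, x n <= p <= x n + w / 2 ^+ n.
Proof.
move=> w0 hx.
have wn n : 0 <= w / 2 ^+ n by rewrite divr_ge0// exprn_ge0.
have mono n k : x n <= x (n + k)%N /\ x (n + k)%N + w / 2 ^+ (n + k) <= x n + w / 2 ^+ n.
  elim: k => [|k [h1 h2]]; first by rewrite addn0.
  have [h3 h4] := hx (n + k)%N; rewrite addnS.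
  by split; [exact: le_trans h1 h3|exact: le_trans h4 h2].
have ub n k : x k <= x n + w / 2 ^+ n.
  have [nk|/ltnW kn] := leqP n k.
    have [_] := mono n (k - n)%N; rewrite subnKC//; apply: le_trans.
    by rewrite lerDl.
  have [h _] := mono k (n - k)%N; rewrite subnKC// in h.
  by rewrite (le_trans h)// lerDl.
have hs : has_sup (range x).
  split; first by exists (x 0%N); exists 0%N.
  by exists (x 0%N + w / 2 ^+ 0) => _ [k _ <-].
exists (sup (range x)) => n; apply/andP; split.
  by apply: ub_le_sup; [exact: hs.2|exists n].
by apply: ge_sup; [exact: hs.1|move=> _ [k _ <-]].
Qed.

(** [P x y n] speaks of the rectangle with lower left corner [(x, y)] and sides [w / 2 ^ n],
    [h / 2 ^ n]. If [P] failed for the whole rectangle, it would fail for one quarter at each scale;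
    these nested quarters shrink to a point, where the local hypothesis is contradicted. *)
Lemma bisection (w h : R) (P : R -> R -> nat -> Prop) (a c : R) :
  0 <= w -> 0 <= h ->
  (forall x y n,
    (forall i j : bool, P (x + i%:R * (w / 2 ^+ n.+1)) (y + j%:R * (h / 2 ^+ n.+1)) n.+1) ->
    P x y n) ->
  (forall p q : R, a <= p <= a + w -> c <= q <= c + h -> exists n, forall x y,
     x <= p <= x + w / 2 ^+ n -> y <= q <= y + h / 2 ^+ n ->
     a <= x -> x + w / 2 ^+ n <= a + w -> c <= y -> y + h / 2 ^+ n <= c + h ->
     P x y n) ->
  P a c 0%N.
Proof.
move=> w0 h0 step local; apply: contrapT => nP.
(* With the implication under the existential, a quarter is assigned to every state, and a bad one
   to every bad state, so that [choice] applies. *)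
have nx (s : R * R * nat) : exists ij : bool * bool, ~ P s.1.1 s.1.2 s.2 ->
    ~ P (s.1.1 + ij.1%:R * (w / 2 ^+ s.2.+1)) (s.1.2 + ij.2%:R * (h / 2 ^+ s.2.+1)) s.2.+1.
  apply: contrapT => H; have hP : ~ P s.1.1 s.1.2 s.2.
    by move=> hP; apply: H; exists (true, true) => /(_ hP).
  apply: (hP); apply: step => i j; apply: contrapT => nPij.
  by apply: H; exists (i, j).
have [f hf] := choice nx.
pose nxt (s : R * R * nat) : R * R * nat :=
  (s.1.1 + (f s).1%:R * (w / 2 ^+ s.2.+1), s.1.2 + (f s).2%:R * (h / 2 ^+ s.2.+1), s.2.+1).
pose s n := iter n nxt (a, c, 0%N).
have s2 n : (s n).2 = n by elim: n => //= n ->.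
have nPs n : ~ P (s n).1.1 (s n).1.2 n.
  elim: n => // n IH; have H := hf (s n); rewrite s2 in H.
  by rewrite [s n.+1]/(nxt (s n)) /nxt /= s2; exact: H.
have half u n : u / 2 ^+ n = u / 2 ^+ n.+1 + u / 2 ^+ n.+1 :> R.
  by rewrite exprS; field; rewrite expf_neq0.
have nest (u : R) (i : bool) (z : R) n : 0 <= u -> z <= z + i%:R * (u / 2 ^+ n.+1) /\
    z + i%:R * (u / 2 ^+ n.+1) + u / 2 ^+ n.+1 <= z + u / 2 ^+ n.
  move=> u0; have un : 0 <= u / 2 ^+ n.+1 by rewrite divr_ge0// exprn_ge0.
  rewrite (half u n); case: i; rewrite ?mul1r ?mul0r; split; lra.
have hx n : (s n).1.1 <= (s n.+1).1.1 /\
    (s n.+1).1.1 + w / 2 ^+ n.+1 <= (s n).1.1 + w / 2 ^+ n.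
  by rewrite /= s2; exact: nest.
have hy n : (s n).1.2 <= (s n.+1).1.2 /\
    (s n.+1).1.2 + h / 2 ^+ n.+1 <= (s n).1.2 + h / 2 ^+ n.
  by rewrite /= s2; exact: nest.
have [p hp] := nested_point w0 hx.
have [q hq] := nested_point h0 hy.
have [|| n Pn] := local p q.
- by have := hp 0%N; rewrite expr0 divr1.
- by have := hq 0%N; rewrite expr0 divr1.
apply: (nPs n); apply: Pn => //.
- by elim: n => //= n IH; apply: le_trans IH (hx n).1.
- elim: n => [|n IH]; first by rewrite expr0 divr1.
  by apply: le_trans (hx n).2 IH.
- by elim: n => //= n IH; apply: le_trans IH (hy n).1.
- elim: n => [|n IH]; first by rewrite expr0 divr1.
  by apply: le_trans (hy n).2 IH.
Qed.

(** Subtracting the tangent map at [p] does not change the contour integral and leaves an integrand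
    of size at most [e * l] on a contour of length [2 * l], where [l] is the half-perimeter. *)
Lemma goursat_local F p e : cdiff F p -> 0 < e -> exists2 r, 0 < r &
  forall a b c d, a <= b -> c <= d -> crect F a b c d -> inrect a b c d p ->
    (b - a) + (d - c) < r ->
    cabs (rectint F a b c d) <= 4 * e * ((b - a) + (d - c)) ^+ 2.
Proof.
move=> [D hD] e0; have [r r0 rP] := hD e e0.
exists r => // a b c d ab cd cF pin lr.
set l := (b - a) + (d - c) in lr *.
have cA : crect (fun z => (F p - D * p) + D * z) a b c d.
  by move=> z _; exact: ccont_affine.
pose G z := F z + ((- (F p - D * p)) + (- D) * z).
have cG : crect G a b c d.
  move=> z /cF cFz; rewrite /G.
  move=> e' e'0; have e'2 : 0 < e' / 2 by rewrite divr_gt0.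
  have [r1 r10 r1P] := cFz _ e'2.
  have [r2 r20 r2P] := @ccont_affine R (- (F p - D * p)) (- D) z _ e'2.
  exists (Num.min r1 r2); first by rewrite lt_min r10.
  move=> u; rewrite lt_min => /andP[/r1P h1 /r2P h2].
  rewrite -subr_gt0 in h1 h2; rewrite -subr_gt0.
  set k := - (F p - _) in h2 *; set l' := - D in h2 *.
  rewrite (_ : _ + _ - _ = (F u - F z) + (k + l' * u - (k + l' * z))); last by ring.
  rewrite subr_gt0 (le_lt_trans (cabsD _ _))// [ltRHS]splitr ltrD// -subr_gt0//.
have -> : F = fun z => G z + ((F p - D * p) + D * z).
  by apply/funext => z; rewrite /G; ring.
rewrite rectintD// rectint_affine// addr0.
rewrite (_ : 4 * e * _ = 4 * (e * l) * l); last by ring.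
apply: rectint_bound => // z [/andP[z1 z2] /andP[z3 z4]].
case: pin => /andP[p1 p2] /andP[p3 p4].
have zp : cabs (z - p) <= l.
  rewrite (le_trans (cabs_le_ReIm _))// lerD// ?ReB ?ImB ler_norml; apply/andP; split; lra.
have := rP (z - p) (le_lt_trans zp lr); rewrite [p + _]addrC subrK.
rewrite (_ : F z - F p - D * (z - p) = G z); last by rewrite /G; ring.
by move/le_trans; apply; rewrite ler_wpM2l// ltW.
Qed.

(** The bound [4 * e * (w + h) ^ 2 / 4 ^ n] at scale [n] is reproduced when four quarters are added
    up, and it is what [goursat_local] gives for sides divided by [2 ^ n]. Then [e] tends to 0. *)
Lemma goursat F a b c d : a <= b -> c <= d ->
  (forall z, inrect a b c d z -> cdiff F z) -> rectint F a b c d = 0.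
Proof.
move=> ab cd dF.
have cF : crect F a b c d by move=> z /dF; exact: cdiff_ccont.
apply/eqP; rewrite -cabs_eq0 eq_le cabs_ge0 andbT.
set w := b - a; set h := d - c.
have w0 : 0 <= w by rewrite subr_ge0.
have h0 : 0 <= h by rewrite subr_ge0.
suff main e : 0 < e -> cabs (rectint F a b c d) <= 4 * e * (w + h) ^+ 2.
  apply/ler_addgt0Pr => e e0; rewrite add0r.
  have K0 : 0 < 4 * (w + h) ^+ 2 + 1 by rewrite ltr_wpDl// mulr_ge0// sqr_ge0.
  rewrite (le_trans (main (e / (4 * (w + h) ^+ 2 + 1)) _)) ?divr_gt0//.
  set S := (w + h) ^+ 2 in K0 *; rewrite (_ : 4 * _ * S = e * (4 * S) / (4 * S + 1)); last by ring.
  by rewrite ler_pdivrMr// ler_pM2l// lerDl.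
move=> e0.
pose P x y n := a <= x -> x + w / 2 ^+ n <= b -> c <= y -> y + h / 2 ^+ n <= d ->
  cabs (rectint F x (x + w / 2 ^+ n) y (y + h / 2 ^+ n)) <= 4 * e * (w + h) ^+ 2 / 4 ^+ n.
have aw : a + w = b by rewrite /w addrC subrK.
have ch : c + h = d by rewrite /h addrC subrK.
suff: P a c 0%N.
  by rewrite /P expr0 !divr1 aw ch; exact.
have half u n : u / 2 ^+ n = u / 2 ^+ n.+1 + u / 2 ^+ n.+1 :> R.
  by rewrite exprS; field; rewrite expf_neq0.
apply: (@bisection w h) => //.
- move=> x y n Pn ax xb cy yd.
  have w1 : 0 <= w / 2 ^+ n.+1 by rewrite divr_ge0// exprn_ge0.
  have h1 : 0 <= h / 2 ^+ n.+1 by rewrite divr_ge0// exprn_ge0.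
  rewrite (half w) (half h) in xb yd *; set w' := w / _ in w1 xb Pn *.
  set h' := h / _ in h1 yd Pn *.
  have cF' : crect F x (x + (w' + w')) y (y + (h' + h')) by exact: crectW cF.
  rewrite (@rectint_splitx _ _ _ (x + w')) ?lerD2l ?lerDl ?addr_ge0//.
  have xw : x + w' <= x + (w' + w') by rewrite lerD2l lerDl.
  have yh : y + h' <= y + (h' + h') by rewrite lerD2l lerDl.
  have xw1 : x <= x + w' by rewrite lerDl.
  have yh1 : y <= y + h' by rewrite lerDl.
  rewrite (@rectint_splity R F x (x + w') y (y + h'))//; last exact: crectW cF'.
  rewrite (@rectint_splity R F (x + w') _ y (y + h'))//; last exact: crectW cF'.
  have xw2 := le_trans xw xb; have yh2 := le_trans yh yd.
  have xw3 := le_trans ax xw1; have yh3 := le_trans cy yh1.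
  have P00 := Pn false false; have P01 := Pn false true.
  have P10 := Pn true false; have P11 := Pn true true.
  rewrite /P ?mul0r ?mul1r ?addr0 -/w' -/h' in P00 P01 P10 P11.
  rewrite [x + (w' + w')]addrA [y + (h' + h')]addrA in xb yd *.
  set B := 4 * e * _ in P00 P01 P10 P11 *.
  have -> : B / 4 ^+ n = (B / 4 ^+ n.+1 + B / 4 ^+ n.+1) + (B / 4 ^+ n.+1 + B / 4 ^+ n.+1).
    by rewrite exprS; field; rewrite expf_neq0.
  rewrite (le_trans (cabsD _ _))// lerD//.
    by rewrite (le_trans (cabsD _ _))// lerD//; [apply: P00|apply: P01].
  by rewrite (le_trans (cabsD _ _))// lerD//; [apply: P10|apply: P11].
- move=> p q; rewrite aw ch => pab qcd.
  have [r r0 rP] := goursat_local (dF (p +i* q) (conj pab qcd)) e0.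
  have [n nP] : exists n, (w + h) / 2 ^+ n < r.
    have [n hn] : exists n : nat, (w + h) / r < n%:R.
      exists (Num.truncn ((w + h) / r)).+1; exact: truncnS_gt.
    exists n; rewrite ltr_pdivrMr ?exprn_gt0// -ltr_pdivrMl// mulrC (lt_trans hn)//.
    by rewrite -natrX ltr_nat ltn_expl.
  exists n => x y xp yq ax xb cy yd _ _ _ _.
  have w1 : 0 <= w / 2 ^+ n by rewrite divr_ge0// exprn_ge0.
  have h1 : 0 <= h / 2 ^+ n by rewrite divr_ge0// exprn_ge0.
  have := rP x (x + w / 2 ^+ n) y (y + h / 2 ^+ n).
  have ee u v : u + v - u = v :> R by ring.
  rewrite !ee -mulrDl !lerDl.
  move=> /(_ w1 h1 (crectW ax xb cy yd cF) (conj xp yq) nP).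
  have e4 : (2 : R) ^+ 2 = 4 by rewrite -natrX.
  by rewrite exprMn exprVn -exprM mulnC exprM e4 mulrA.
Qed.
End GoursatBisection.

Section GoursatPuncture.
Variable R : realType.
Implicit Types (a b c d m x y t : R) (F : R[i] -> R[i]) (z p : R[i]).

(** Cutting around [p], [goursat] disposes of everything but a square of half-side [e]; there [F] is
    bounded by continuity, so the contribution is of order [e]. *)
Lemma goursat_except F a b c d p : a < complex.Re p < b -> c < complex.Im p < d ->
  (forall z, inrect a b c d z -> z != p -> cdiff F z) -> ccont F p ->
  rectint F a b c d = 0.
Proof.
case: p => px py /= /andP[ap pb] /andP[cp pd] dF cFp.
have cF : crect F a b c d.
  by move=> z zin; have [->//|/(dF z zin)] := eqVneq z (px +i* py); exact: cdiff_ccont.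
have [r r0 rP] := cFp 1 ltr01.
pose M := cabs (F (px +i* py)) + 1.
(* A half-side below [r1] keeps the square inside the rectangle and, since its points are at
   distance at most twice the half-side from [p], inside the disc of radius [r]. *)
pose r1 := Num.min (r / 2) (Num.min (Num.min (px - a) (b - px)) (Num.min (py - c) (d - py))).
have r10 : 0 < r1 by rewrite /r1 !lt_min divr_gt0// !subr_gt0 ap pb cp pd.
have M0 : 0 < M by rewrite ltr_wpDl ?cabs_ge0.
suff main e : 0 < e -> e < r1 -> cabs (rectint F a b c d) <= 16 * M * e.
  apply/eqP; rewrite -cabs_eq0 eq_le cabs_ge0 andbT.
  apply/ler_addgt0Pr => e e0; rewrite add0r.
  have e'0 : 0 < Num.min (r1 / 2) (e / (16 * M)).
    by rewrite lt_min !divr_gt0// mulr_gt0.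
  rewrite (le_trans (main _ e'0 _))//.
    rewrite gt_min; apply/orP; left; lra.
  by rewrite -ler_pdivlMl ?mulr_gt0// ge_min [X in _ || (_ <= X)]mulrC lexx orbT.
move=> e0; rewrite /r1 !lt_min => /and3P[er /andP[ea eb] /andP[ec ed]].
have nz z : complex.Re z != px -> z != px +i* py by apply: contra_neq => ->.
have nz2 z : complex.Im z != py -> z != px +i* py by apply: contra_neq => ->.
rewrite (@rectint_splitx _ _ _ (px - e)); [|lra|lra|lra|done].
rewrite (@goursat _ _ a (px - e)); [|lra|lra|]; last first.
  move=> z [/andP[z1 z2] z3]; apply: dF.
    by split=> //; apply/andP; split=> //; lra.
  by apply: nz; rewrite lt_eqF//; lra.
rewrite add0r (@rectint_splitx _ _ _ (px + e)); [|lra|lra|lra|apply: crectW cF; lra].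
rewrite (@goursat _ _ (px + e) b); [|lra|lra|]; last first.
  move=> z [/andP[z1 z2] z3]; apply: dF.
    by split=> //; apply/andP; split=> //; lra.
  by apply: nz; rewrite gt_eqF//; lra.
rewrite addr0 (@rectint_splity _ _ _ _ _ (py - e)); [|lra|lra|lra|apply: crectW cF; lra].
rewrite (@goursat _ _ _ _ c (py - e)); [|lra|lra|]; last first.
  move=> z [/andP[z3 z4] /andP[z1 z2]]; apply: dF.
    by split; apply/andP; split=> //; lra.
  by apply: nz2; rewrite lt_eqF//; lra.
rewrite add0r (@rectint_splity _ _ _ _ _ (py + e)); [|lra|lra|lra|apply: crectW cF; lra].
rewrite (@goursat _ _ _ _ (py + e) d); [|lra|lra|]; last first.
  move=> z [/andP[z3 z4] /andP[z1 z2]]; apply: dF.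
    by split; apply/andP; split=> //; lra.
  by apply: nz2; rewrite gt_eqF//; lra.
rewrite addr0 (_ : 16 * M * e = 4 * M * ((px + e - (px - e)) + (py + e - (py - e)))); last by ring.
apply: rectint_bound; [lra|lra|apply: crectW cF; lra|].
move=> z [/andP[z1 z2] /andP[z3 z4]].
have := rP z; rewrite [X in cabs X < _ -> _](_ : _ = (complex.Re z - px) +i* (complex.Im z - py)).
  move=> h; have {}h : cabs (F z - F (px +i* py)) < 1.
    apply: h; rewrite (le_lt_trans (cabs_le_ReIm _))//=.
    apply: (@le_lt_trans _ _ (e + e)); last by lra.
    by apply: lerD; rewrite ler_norml; apply/andP; split; lra.
  rewrite -(subrK (F (px +i* py)) (F z)) (le_trans (cabsD _ _))// /M addrC lerD2l ltW//.
by case: (z).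
Qed.

End GoursatPuncture.

Section ComplexDerivative.
Variable R : realType.
Implicit Types (a b c d m x y t : R) (F : R[i] -> R[i]) (z p : R[i]).

Lemma cdiffP F z : cdiff F z <-> derivable (F : R[i]^o -> R[i]^o) z 1.
Proof.
split=> [[D hD]|/derivable1_diffP /diff_eps h]; last first.
  have lin (k : R[i]^o) : 'd (F : R[i]^o -> R[i]^o) (z : R[i]^o) k =
      'd (F : R[i]^o -> R[i]^o) (z : R[i]^o) (1 : R[i]^o) * k.
    by rewrite -[k in LHS]mulr1 -[k * 1]/(k *: (1 : R[i]^o)) linearZ /= mulrC.
  exists ('d (F : R[i]^o -> R[i]^o) (z : R[i]^o) (1 : R[i]^o)) => e /h[r r0 rP].
  by exists r => // k kr; have := rP k kr; rewrite !vabsC (lin k).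
rewrite /derivable; apply/cvg_ex; exists (D : R[i]^o).
apply/cvgrPdist_lt => e e0.
have ee : e = (complex.Re e)%:C by apply/realC_ge0/ltW.
have e1 : 0 < complex.Re e by rewrite -ltcR -ee.
have e2 : 0 < complex.Re e / 2 by rewrite divr_gt0.
have [r r0 rP] := hD _ e2.
apply/nbhs_normP; exists r%:C => [|k]; first by rewrite /= ltcR.
rewrite /= sub0r normrN [`|k|](normC k) ltcR => kr k0.
have kp : 0 < cabs k by rewrite cabs_gt0.
have := rP k kr => hk.
rewrite [`|_ - _|]normC ee ltcR cabsB -(ltr_pM2l kp) -cabsM.
rewrite [X in cabs X](_ : _ = F (z + k) - F z - D * k); last first.
  rewrite /GRing.scale/= mulr1 [k + z]addrC mulrBr mulrA divff// mul1r.
  by rewrite [k * D]mulrC.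
rewrite (le_lt_trans hk)// mulrC ltr_pM2l//; lra.
Qed.

Lemma cdiff_comp F G z : cdiff G z -> cdiff F (G z) -> cdiff (F \o G) z.
Proof.
move=> [D1 h1] [D2 h2]; exists (D2 * D1) => e e0.
have K1 : 0 < cabs D1 + 1 by rewrite ltr_wpDl ?cabs_ge0.
have K2 : 0 < cabs D2 + 1 by rewrite ltr_wpDl ?cabs_ge0.
have e1 : 0 < e / 2 / (cabs D1 + 1) by rewrite !divr_gt0.
have e2 : 0 < Num.min 1 (e / 2 / (cabs D2 + 1)) by rewrite lt_min ltr01 !divr_gt0.
have [r1 r10 r1P] := h2 _ e1; have [r2 r20 r2P] := h1 _ e2.
exists (Num.min r2 (r1 / (cabs D1 + 1))); first by rewrite lt_min r20 divr_gt0.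
move=> h; rewrite lt_min => /andP[/r2P hr2]; rewrite ltr_pdivlMr// => hr1.
have h0 := cabs_ge0 h.
set k := G (z + h) - G z.
have kD : cabs (k - D1 * h) <= e / 2 / (cabs D2 + 1) * cabs h.
  by rewrite (le_trans hr2)// ler_wpM2r// ge_min lexx orbT.
have kh : cabs k <= (cabs D1 + 1) * cabs h.
  rewrite -(subrK (D1 * h) k) (le_trans (cabsD _ _))// cabsM mulrDl mul1r addrC lerD2l.
  by rewrite (le_trans hr2)// -[leRHS]mul1r ler_wpM2r// ge_min lexx.
have kr : cabs k < r1 by rewrite (le_lt_trans kh)// mulrC.
have := r1P k kr; rewrite {1}/k [G z + _]addrC subrK => hF.
rewrite /= (_ : _ - _ = (F (G (z + h)) - F (G z) - D2 * k) + D2 * (k - D1 * h)); last by ring.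
rewrite (le_trans (cabsD _ _))// [e]splitr mulrDl lerD//.
  rewrite (le_trans hF)// (le_trans (ler_wpM2l _ kh)) ?(ltW e1)//.
  by rewrite mulrA divfK ?gt_eqF.
rewrite cabsM (le_trans (ler_wpM2l _ kD)) ?cabs_ge0// mulrA ler_wpM2r//.
rewrite mulrA ler_pdivrMr// mulrC ler_wpM2l ?lerDl// ltW// divr_gt0//.
Qed.

Lemma ccont_comp F G z : ccont G z -> ccont F (G z) -> ccont (F \o G) z.
Proof.
move=> cG cF e /cF[r r0 rP]; have [r' r'0 r'P] := cG r r0.
by exists r' => // w /r'P; exact: rP.
Qed.

Lemma real_diff (f : R -> R) (f' x : R) : is_derive x 1 f f' ->
  forall e, 0 < e -> exists2 r, 0 < r &
    forall h, `|h| < r -> `|f (x + h) - f x - f' * h| <= e * `|h|.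
Proof.
move=> [df <-] e e0; have /cvgrPdist_lt /(_ e e0) := df.
move=> /nbhs_ballP[r r0 rP]; exists r => // h hr.
have [->|h0] := eqVneq h 0; first by rewrite addr0 subrr mulr0 subrr !normr0 mulr0.
have := rP h; rewrite /ball /= sub0r normrN => /(_ hr h0).
move=> hh; have hp : 0 < `|h| by rewrite normr_gt0.
rewrite (_ : _ - _ = - (h * ('D_1 f x - h^-1 *: (f (h *: 1 + x) - f x)))); last first.
  rewrite /GRing.scale/= mulr1 [h + x]addrC mulrBr mulrA divff// mul1r; ring.
by rewrite normrN normrM mulrC ler_pM2r// ltW.
Qed.
End ComplexDerivative.

Arguments cabs : simpl never.

(** * The complex exponential and means over circles *)

Section ComplexExp.
Variable R : realType.
Implicit Types (s t x y : R) (F : R[i] -> R[i]) (z p w : R[i]).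

Definition cexp z : R[i] :=
  (expR (complex.Re z))%:C * (cos (complex.Im z) +i* sin (complex.Im z)).

Lemma cexpD z w : cexp (z + w) = cexp z * cexp w.
Proof.
case: z w => [a b] [c d]; rewrite /cexp /= expRD cosD sinD.
by simpc; congr (_ +i* _); ring.
Qed.

Lemma cabs_cexp z : cabs (cexp z) = expR (complex.Re z).
Proof.
rewrite /cexp cabsM cabs_real gtr0_norm ?expR_gt0//.
by rewrite /cabs /Normc.normc cos2Dsin2 sqrtr1 mulr1.
Qed.

Lemma cexp_small (e : R) : 0 < e -> exists2 r : R, 0 < r &
  forall h, cabs h < r -> cabs (cexp h - 1 - h) <= e * cabs h.
Proof.
(* The terms [a1] to [a4] below contribute at most 1, 2, 4 and 1 times [e' * c], whence 8. *)
move=> e0; have [e' [e'0 e'1 e'6]] : exists e' : R, [/\ 0 < e', e' <= 1 & 8 * e' <= e].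
  exists (Num.min 1 (e / 8)); split; first by rewrite lt_min ltr01 divr_gt0.
    by rewrite ge_min lexx.
  by rewrite mulrC -ler_pdivlMr// ge_min lexx orbT.
have d1 : is_derive (0 : R) 1 expR 1 by have := is_derive_expR (0 : R); rewrite expR0.
have d2 : is_derive (0 : R) 1 sin 1 by have := is_derive_sin (0 : R); rewrite cos0.
have d3 : is_derive (0 : R) 1 cos 0 by have := is_derive_cos (0 : R); rewrite sin0 oppr0.
have [r1 r10 h1] := real_diff d1 e'0.
have [r2 r20 h2] := real_diff d2 e'0.
have [r3 r30 h3] := real_diff d3 e'0.
exists (Num.min (Num.min r1 r2) (Num.min r3 e')); first by rewrite !lt_min r10 r20 r30 e'0.
move=> [s t]; rewrite !lt_min => /andP[/andP[l1 l2] /andP[l3 l4]].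
have := le_lt_trans (Re_le_cabs _) l1; have := le_lt_trans (Im_le_cabs _) l2.
have := le_lt_trans (Im_le_cabs _) l3 => /=.
move=> /h3 {h3}; rewrite !add0r cos0 mul0r subr0 => h3.
move=> /h2 {h2}; rewrite !add0r sin0 mul1r subr0 => h2.
move=> /h1 {h1}; rewrite !add0r expR0 mul1r => h1.
have hs := Re_le_cabs (s +i* t); have ht := Im_le_cabs (s +i* t).
set c := cabs (s +i* t) in hs ht l4 *; rewrite /= in hs ht.
have c0 : 0 <= c := cabs_ge0 _.
have sc : e' * `|s| <= e' * c by rewrite ler_wpM2l// ltW.
have tc : e' * `|t| <= e' * c by rewrite ler_wpM2l// ltW.
have s1 : `|expR s - 1| <= 2 * c.
  rewrite -(subrK s (expR s - 1)) (le_trans (ler_normD _ _))//.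
  rewrite (_ : 2 * c = c + c); last by ring.
  by rewrite lerD// (le_trans h1)// (le_trans sc)// -[leRHS]mul1r ler_wpM2r.
rewrite (le_trans (cabs_le_ReIm _))//.
have -> : complex.Re (cexp (s +i* t) - 1 - (s +i* t)) =
    (expR s - 1 - s) * cos t + (1 + s) * (cos t - 1).
  by rewrite /cexp !ReB ReM /=; ring.
have -> : complex.Im (cexp (s +i* t) - 1 - (s +i* t)) =
    (expR s - 1) * sin t + (sin t - t).
  by rewrite /cexp !ImB ImM /=; ring.
have ct : `|cos t| <= 1 by rewrite ler_norml cos_geN1 cos_le1.
have st : `|sin t| <= c + e' * c.
  rewrite -(subrK t (sin t)) (le_trans (ler_normD _ _))// addrC lerD//.
  exact: le_trans h2 tc.
have a1 : `|(expR s - 1 - s) * cos t| <= e' * c.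
  by rewrite normrM -[leRHS]mulr1 ler_pM// (le_trans h1).
have a2 : `|(1 + s) * (cos t - 1)| <= 2 * (e' * c).
  rewrite normrM ler_pM// ?(le_trans h3)//.
  rewrite (le_trans (ler_normD _ _))// normr1; lra.
have a3 : `|(expR s - 1) * sin t| <= (2 * c) * (c + c).
  rewrite normrM ler_pM// (le_trans st)// lerD2l -[leRHS]mul1r ler_wpM2r//.
have a4 : `|sin t - t| <= e' * c by rewrite (le_trans h2).
have cc : c * c <= e' * c by rewrite ler_wpM2r// ltW.
have key : 8 * (e' * c) <= e * c by rewrite mulrA ler_wpM2r.
rewrite (le_trans (lerD (ler_normD _ _) (ler_normD _ _)))//.
rewrite (le_trans (lerD (lerD a1 a2) (lerD a3 a4)))// (le_trans _ key)//.
rewrite -subr_ge0 in cc; rewrite -subr_ge0.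
rewrite (_ : _ - _ = 4 * (e' * c - c * c)); last by ring.
by rewrite mulr_ge0.
Qed.

End ComplexExp.

Section CircleMean.
Variable R : realType.
Implicit Types (s t x y : R) (F G : R[i] -> R[i]) (z p w : R[i]).

Lemma cdiff_cexp z : cdiff (@cexp R) z.
Proof.
exists (cexp z) => e e0; have c0 : 0 < cabs (cexp z) by rewrite cabs_cexp expR_gt0.
have [r r0 rP] := @cexp_small R (e / cabs (cexp z)) (divr_gt0 e0 c0).
exists r => // h /rP hh; rewrite cexpD.
rewrite (_ : _ - _ = cexp z * (cexp h - 1 - h)); last by ring.
rewrite cabsM (le_trans (ler_wpM2l _ hh)) ?cabs_ge0//.
by rewrite mulrA [cabs _ * _]mulrC divfK ?gt_eqF.
Qed.

Lemma cexp_piN x : cexp (x +i* (- pi)) = cexp (x +i* pi).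
Proof. by rewrite /cexp /= cosN sinN sinpi oppr0. Qed.

(** Moduli give the real parts. The cosine of the difference of the imaginary parts is then 1, so
    half that difference has sine 0 while its absolute value is below [pi]. *)
Lemma cexp_inj z p : `|complex.Im z - complex.Im p| < 2 * pi ->
  cexp z = cexp p -> z = p.
Proof.
case: z p => [a b] [c d] /= bd h.
have ac : a = c.
  by apply: expR_inj; have := congr1 (@cabs R) h; rewrite !cabs_cexp.
subst c; move: h; rewrite /cexp /= => h.
have e0 : (expR a)%:C != 0 by rewrite (inj_eq (@realC_inj R)) gt_eqF// expR_gt0.
have [hc hs] : cos b = cos d /\ sin b = sin d.
  by have /(mulfI e0)[-> ->] := h.
have : cos (b - d) = 1 by rewrite cosB hc hs -!expr2 cos2Dsin2.
rewrite -cos_norm; set u := `|b - d| in bd *.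
have u0 : 0 <= u := normr_ge0 _.
rewrite (splitr u) -mulr2n cos_mulr2n => hu.
have hu2 : cos (u / 2) ^+ 2 = 1 by move: hu; rewrite -mulr_natr; lra.
have hs2 : sin (u / 2) = 0.
  by apply/eqP; rewrite -sqrf_eq0 sin2cos2 hu2 subrr.
have : u = 0.
  apply/eqP/negPn/negP => un.
  have : 0 < sin (u / 2) by apply: sin_gt0_pi; rewrite divr_gt0 ?lt_def ?un//; lra.
  by rewrite hs2 ltxx.
by move/eqP; rewrite normr_eq0 subr_eq0 => /eqP ->.
Qed.

Lemma circ_cont F s a b : (forall w, cabs w = expR s -> ccont F w) ->
  ccont_on a b (fun t => F (cexp (s +i* t))).
Proof.
move=> cF; apply: ccont_onP => t _ e e0.
have := @ccont_comp R F (@cexp R) (s +i* t) (cdiff_ccont (cdiff_cexp _)) (cF _ (cabs_cexp (s +i* t))) e e0.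
move=> [r r0 rP]; exists r => // t' tr; apply: rP.
by rewrite subCE subrr (le_lt_trans (cabs_le_ReIm _))//= normr0 add0r.
Qed.

(* Cauchy's theorem on a rectangle for k o exp; the two horizontal sides cancel
   by periodicity. *)
Lemma circle_mean k (R0 : R) p s :
  - pi < complex.Im p < pi -> complex.Re p < s -> expR s < R0 ->
  (forall w, cabs w < R0 -> ccont k w) ->
  (forall w, cabs w < R0 -> w != cexp p -> cdiff k w) ->
  cint (- pi) pi (fun t => k (cexp (s +i* t))) = (2 * pi)%:C * k 0.
Proof.
move=> pip ps sR ck dk.
have pi0 : 0 < pi :> R := pi_gt0 R.
have piN : - pi <= pi :> R by lra.
(* The puncture lies between the two circles, and [goursat_except] equates their means; the inner
   circle is then shrunk to 0. *)
have eqC s0 : s0 < complex.Re p ->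
    cint (- pi) pi (fun t => k (cexp (s +i* t))) = cint (- pi) pi (fun t => k (cexp (s0 +i* t))).
  move=> s0p.
  have inR z : inrect s0 s (- pi) pi z -> cabs (cexp z) < R0.
    by move=> [/andP[_ zs] _]; rewrite cabs_cexp (le_lt_trans _ sR)// ler_expR.
  have : rectint (k \o @cexp R) s0 s (- pi) pi = 0.
    apply: (@goursat_except _ _ _ _ _ _ p) => //.
    - by rewrite s0p.
    - move=> z zin zp; apply: cdiff_comp; first exact: cdiff_cexp.
      apply: dk; first exact: inR.
      apply: contra_neq zp; apply: cexp_inj.
      case: zin => _ /andP[z1 z2]; case/andP: pip => p1 p2.
      by rewrite ltr_norml; apply/andP; split; lra.
    - apply: ccont_comp; first exact/cdiff_ccont/cdiff_cexp.
      by apply: ck; rewrite cabs_cexp (lt_trans _ sR)// ltr_expR.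
  rewrite /rectint /=.
  rewrite (@eq_cint _ _ _ _ (fun x => k (cexp (x +i* pi)))); last first.
    by move=> x _; rewrite cexp_piN.
  by rewrite subrr add0r => /eqP; rewrite mulf_eq0 (negPf (@neq0Ci _)) /= subr_eq0 => /eqP.
apply/eqP; rewrite -subr_eq0 -cabs_eq0 eq_le cabs_ge0 andbT.
apply/ler_addgt0Pr => e e0; rewrite add0r.
(* [cint_bound] on [[- pi, pi]] multiplies by twice the length, that is by [4 * pi]. *)
have e4 : 0 < e / (4 * pi) by rewrite divr_gt0// mulr_gt0.
have R00 : 0 < R0 by rewrite (lt_trans _ sR)// expR_gt0.
have [r r0 rP] := ck 0 (eq_ind_r (fun x => x < R0) R00 (@cabs0 R)) _ e4.
pose s0 := Num.min (complex.Re p - 1) (ln (r / 2)).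
have s0p : s0 < complex.Re p by rewrite /s0 gt_min; apply/orP; left; lra.
have s0r : expR s0 < r.
  rewrite (@le_lt_trans _ _ (r / 2))//; last by lra.
  by rewrite -[leRHS]lnK ?posrE ?divr_gt0// ler_expR ge_min lexx orbT.
rewrite (eqC s0 s0p).
have s0R w : cabs w = expR s0 -> ccont k w.
  move=> hw; apply: ck; rewrite hw (lt_trans _ sR)// ltr_expR (lt_trans s0p)//.
have -> : (2 * pi)%:C * k 0 = cint (- pi) pi (fun=> k 0).
  by rewrite cint_cst// mulrC opprK; congr (_ * _%:C); ring.
have cc : ccont_on (- pi) pi (fun=> k 0 : R[i]).
  by apply: ccont_onP => t _ e' e'0; exists 1 => // t' _; rewrite subrr cabs0.
have cN : ccont_on (- pi) pi (fun=> - k 0 : R[i]).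
  by apply: ccont_onP => t _ e' e'0; exists 1 => // t' _; rewrite subrr cabs0.
have cG : ccont_on (- pi) pi (fun t => k (cexp (s0 +i* t))) by exact: circ_cont.
rewrite -cintN// -cintD//.
rewrite (le_trans (@cint_bound _ _ _ _ (e / (4 * pi)) _ _ _))//.
- exact: ccont_onD.
- move=> t _; apply/ltW/rP; rewrite subr0 cabs_cexp//.
- rewrite le_eqVlt; apply/orP; left; apply/eqP; rewrite opprK.
  have : (pi : R) != 0 by rewrite gt_eqF.
  by move: (pi : R) => q q0; field.
Qed.

Lemma cdiff_cst k z : cdiff (fun=> k) z.
Proof. by exists 0 => e e0; exists 1 => // h _; rewrite subrr mul0r subrr cabs0 mulr_ge0 ?cabs_ge0// ltW. Qed.

Lemma cdiff_id z : cdiff id z.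
Proof.
exists 1 => e e0; exists 1 => // h _.
rewrite /= (_ : _ - _ = 0); last by ring.
by rewrite cabs0 mulr_ge0 ?cabs_ge0// ltW.
Qed.

Lemma cdiffD F G z : cdiff F z -> cdiff G z -> cdiff (fun w => F w + G w) z.
Proof.
move=> /cdiffP dF /cdiffP dG.
have h := derivableD dF dG.
apply/cdiffP.
have <- : ((F : R[i]^o -> R[i]^o) + (G : R[i]^o -> R[i]^o))%R = (fun w => F w + G w) by apply/funext => w; rewrite fctE.
exact: h.
Qed.
Lemma cdiffN F z : cdiff F z -> cdiff (fun w => - F w) z.
Proof.
move=> /cdiffP dF; have h := derivableN dF.
by apply/cdiffP; exact: h.
Qed.

Lemma cdiffM F G z : cdiff F z -> cdiff G z -> cdiff (fun w => F w * G w) z.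
Proof.
move=> /cdiffP dF /cdiffP dG.
have h := derivableM dF dG.
apply/cdiffP.
have <- : ((F : R[i]^o -> R[i]^o) * (G : R[i]^o -> R[i]^o))%R = (fun w => F w * G w) by apply/funext => w; rewrite fctE.
exact: h.
Qed.

Lemma cdiffV F z : F z != 0 -> cdiff F z -> cdiff (fun w => (F w)^-1) z.
Proof.
move=> F0 /cdiffP dF.
have h := derivableV F0 dF.
apply/cdiffP.
exact: h.
Qed.

Lemma cdiffX F n z : cdiff F z -> cdiff (fun w => F w ^+ n) z.
Proof.
move=> dF; elim: n => [|n IH]; first exact: cdiff_cst.
have := cdiffM dF IH; congr (cdiff _ z); apply/funext => w; by rewrite exprS.
Qed.

Lemma cdiff_near F G z (r : R) : 0 < r -> (forall w, cabs (w - z) < r -> F w = G w) ->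
  cdiff F z -> cdiff G z.
Proof.
move=> r0 FG [D hD]; exists D => e /hD[r1 r10 r1P].
exists (Num.min r r1); first by rewrite lt_min r0.
move=> h; rewrite lt_min => /andP[hr /r1P].
by rewrite -!FG ?subrr ?cabs0// addrAC subrr add0r.
Qed.

Lemma conj_cont a b (f : R -> R[i]) : ccont_on a b f -> ccont_on a b (fun t => conjc (f t)).
Proof.
move=> [fr fi]; split.
  by move: fr; congr (cont_on _ _ _); apply/funext => t /=; case: (f t).
have := @cont_onZ R a b (-1) _ fi.
by congr (cont_on _ _ _); apply/funext => t /=; case: (f t) => x y; rewrite /= mulN1r.
Qed.

Lemma cint_conj a b (f : R -> R[i]) : ccont_on a b f ->
  cint a b (fun t => conjc (f t)) = conjc (cint a b f).
Proof.
move=> [fr fi]; rewrite /cint /=; congr (_ +i* _).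
  by apply: eq_rint => t _ /=; case: (f t).
rewrite -mulN1r -rintZ//; apply: eq_rint => t _ /=; case: (f t) => x y.
by rewrite /= mulN1r.
Qed.

Lemma cint_sum a b n (f : nat -> R -> R[i]) : a <= b -> (forall i, ccont_on a b (f i)) ->
  ccont_on a b (fun t => \sum_(i < n) f i t) /\
  cint a b (fun t => \sum_(i < n) f i t) = \sum_(i < n) cint a b (f i).
Proof.
move=> ab cf; elim: n => [|n [IH1 IH2]].
  split; last first.
    rewrite big_ord0 (@eq_cint _ _ _ _ (fun=> 0)) ?cint_cst ?mul0r// => t _.
    by rewrite big_ord0.
  by apply: ccont_onP => t _ e e0; exists 1 => // t' _; rewrite !big_ord0 subrr cabs0.
have -> : (fun t => \sum_(i < n.+1) f i t) = fun t => \sum_(i < n) f i t + f n t.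
  by apply/funext => t; rewrite big_ord_recr.
split; first exact: ccont_onD.
by rewrite cintD// IH2 big_ord_recr.
Qed.

Lemma polar z : z != 0 -> exists t, - pi <= t <= pi /\ z = cexp (ln (cabs z) +i* t).
Proof.
move=> z0; have c0 : 0 < cabs z by rewrite cabs_gt0.
case: z z0 c0 => x y z0 c0; set c := cabs _ in c0 *.
have c2 : x ^+ 2 + y ^+ 2 = c ^+ 2 by rewrite cabs_sqr.
have hx : x <= c /\ - c <= x.
  by have := Re_le_cabs (x +i* y); rewrite ler_norml /= -/c => /andP[].
have xc : -1 <= x / c <= 1 by rewrite ler_pdivlMr// ler_pdivrMr// mulN1r mul1r hx.1 hx.2.
have h2 : Num.sqrt (1 - (x / c) ^+ 2) = `|y| / c.
  rewrite (_ : 1 - _ = (y / c) ^+ 2); last first.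
    rewrite !expr_div_n -[1](@divff _ (c ^+ 2)) ?sqrf_eq0 ?gt_eqF// -c2 -mulrBl; congr (_ / _); ring.
  by rewrite sqrtr_sqr normrM normfV (gtr0_norm c0).
have a0 := acos_ge0 xc; have api := acos_lepi xc; have pi0 := pi_ge0 R.
have cx : c * (x / c) = x by rewrite mulrC divfK ?gt_eqF.
have cy : c * (`|y| / c) = `|y| by rewrite mulrC divfK ?gt_eqF.
have [y0|y0] := leP 0 y.
  exists (acos (x / c)); split; first by rewrite api andbT (le_trans _ a0)// oppr_le0.
  rewrite /cexp /= lnK ?posrE// acosK ?in_itv//= sin_acos// h2.
  by simpc; rewrite cx cy ger0_norm.
exists (- acos (x / c)); split.
  by rewrite lerN2 api /= (le_trans _ pi0)// oppr_le0.
rewrite /cexp /= lnK ?posrE// cosN sinN acosK ?in_itv//= sin_acos// h2.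
by simpc; rewrite cx ?mulrN cy ltr0_norm// opprK.
Qed.
End CircleMean.

Arguments cexp : simpl never.

(** * Cauchy's formula and Taylor polynomials *)

Section CauchyFormula.
Variable R : realType.
Implicit Types (s t x y : R) (F G : R[i] -> R[i]) (z p w rho : R[i]).

Lemma conjcX z n : conjc (z ^+ n) = conjc z ^+ n.
Proof. exact: (rmorphXn (@conjc R)). Qed.

Lemma realCX x n : (x ^+ n)%:C = x%:C ^+ n.
Proof. exact: rmorphXn. Qed.

(** On a circle about 0 the inverse of w is a positive multiple of its conjugate, so negative powers
    reduce to positive ones, whose mean is their value at 0. *)
Lemma circle_power s d : cint (- pi) pi (fun t => (cexp (s +i* t))^-1 ^+ d) =
  if d is 0%N then (2 * pi)%:C else 0.
Proof.
have pi0 : 0 < pi :> R := pi_gt0 R.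
have piN : - pi <= pi :> R by lra.
case: d => [|d].
  rewrite (@eq_cint _ _ _ _ (fun=> 1)); last by move=> t _; rewrite expr0.
  by rewrite cint_cst// mul1r opprK; congr (_%:C); ring.
have cX w : cdiff (fun w => w ^+ d.+1) w by apply: cdiffX; exact: cdiff_id.
have h0 : cint (- pi) pi (fun t => (cexp (s +i* t)) ^+ d.+1) = 0.
  rewrite (@circle_mean _ (fun w => w ^+ d.+1) (expR s + 1) ((s - 1) +i* 0) s) /=.
  - by rewrite expr0n mulr0.
  - by rewrite oppr_lt0 pi0.
  - lra.
  - by rewrite ltrDl.
  - by move=> w _; exact/cdiff_ccont.
  - by [].
have cc : ccont_on (- pi) pi (fun t => (cexp (s +i* t)) ^+ d.+1).
  by apply: (@circ_cont _ (fun w => w ^+ d.+1)) => w _; exact/cdiff_ccont.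
rewrite (@eq_cint _ _ _ _ (fun t => ((expR s ^+ 2)^-1 ^+ d.+1)%:C * conjc ((cexp (s +i* t)) ^+ d.+1))).
  by rewrite cintZ ?cint_conj// ?h0 ?conjc0 ?mulr0//; exact: conj_cont.
move=> t _; rewrite conjcX realCX -exprMn; congr (_ ^+ _).
have c0 : cexp (s +i* t) != 0 by rewrite -cabs_gt0 cabs_cexp expR_gt0.
apply: (mulIf c0); rewrite mulVf// -mulrA [conjc _ * _]mulrC -csq_cabs -cabs_sqr cabs_cexp.
by rewrite -rmorphM /= mulVf// sqrf_eq0 gt_eqF// expR_gt0.
Qed.

(** Cauchy's formula is the mean value property of [w (f w - f rho) / (w - rho)], which vanishes at
    0; expanding [w / (w - rho)] as a geometric series cut at [N] gives Taylor polynomial and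
    remainder. The form [rho = cexp p] with [Im p] in the open interval puts the singular point in
    the interior of the rectangle used by [circle_mean]. *)
Lemma cauchy_taylor (f : R[i] -> R[i]) (R0 r M : R) (N : nat) rho p :
  1 < r -> r < R0 -> (forall w, cabs w < R0 -> cdiff f w) ->
  (forall w, cabs w <= r -> cabs (f w) <= M) -> (0 < N)%N ->
  rho = cexp p -> - pi < complex.Im p < pi -> complex.Re p <= 0 ->
  cabs (f rho - \sum_(d < N) rho ^+ d * ((2 * pi)%:C^-1 *
     cint (- pi) pi (fun t => f (cexp (ln r +i* t)) * (cexp (ln r +i* t))^-1 ^+ d)))
    <= 4 * M * (r / (r - 1)) / r ^+ N.
Proof.
move=> r1 rR df fM N0 rhoE pip p0.
have pi0 : 0 < pi :> R := pi_gt0 R.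
have piN : - pi <= pi :> R by lra.
have r0 : 0 < r by rewrite (lt_trans _ r1).
have rho1 : cabs rho <= 1 by rewrite rhoE cabs_cexp -expR0 ler_expR.
have rho0 : rho != 0 by rewrite rhoE -cabs_gt0 cabs_cexp expR_gt0.
have M0 : 0 <= M.
  by apply: le_trans (fM 0 _); rewrite ?cabs_ge0// cabs0 ltW.
have er : expR (ln r) = r by rewrite lnK.
have lnr : 0 < ln r by exact: ln_gt0.
have dfr : cdiff f rho by apply: df; rewrite (le_lt_trans rho1)// (lt_trans r1).
have [D hD] := dfr.
(* The factor [w] is the one of [dw = i w dt] on the circle. *)
pose k0 w := w * (f w - f rho) * (w - rho)^-1.
pose k w := if w == rho then rho * D else k0 w.
have dk0 w : cabs w < R0 -> w != rho -> cdiff k0 w.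
  move=> wR wr; apply: cdiffM; last first.
    apply: cdiffV; first by rewrite subr_eq0.
    by apply: cdiffD; [exact: cdiff_id|exact: cdiff_cst].
  apply: cdiffM; first exact: cdiff_id.
  by apply: cdiffD; [exact: df|exact: cdiff_cst].
have dk w : cabs w < R0 -> w != rho -> cdiff k w.
  move=> wR wr; have wr0 : 0 < cabs (w - rho) by rewrite cabs_gt0 subr_eq0.
  apply: (cdiff_near wr0 _ (dk0 w wR wr)) => u hu.
  rewrite /k; case: eqP => // ur; move: hu; rewrite ur cabsB ltxx//.
have ck : ccont k rho.
  move=> e e0; have K0 : 0 < cabs D + 1 + 1 by rewrite !ltr_wpDl ?addr_ge0 ?cabs_ge0.
  pose e1 := Num.min 1 (e / (cabs D + 1 + 1)).
  have e10 : 0 < e1 by rewrite lt_min ltr01 divr_gt0.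
  have [q q0 qP] := hD (e1 / 2) (divr_gt0 e10 (ltr0n _ 2)).
  exists (Num.min q (e1 / 2)); first by rewrite lt_min q0 divr_gt0.
  move=> w; rewrite lt_min => /andP[wq we].
  rewrite /k eqxx; case: eqP => [_|/eqP wr]; first by rewrite subrr cabs0.
  have wr0 : w - rho != 0 by rewrite subr_eq0.
  have wr00 : 0 < cabs (w - rho) by rewrite cabs_gt0.
  have := qP _ wq; rewrite [rho + _]addrC subrK => hq.
  pose Q := (f w - f rho) / (w - rho) - D.
  have hQ : cabs Q <= e1 / 2.
    rewrite -(ler_pM2r wr00) -cabsM /Q mulrBl divfK//.
  have -> : k0 w - rho * D = w * Q + (w - rho) * D by rewrite /k0 /Q; ring.
  rewrite (le_lt_trans (cabsD _ _))// !cabsM.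
  have w2 : cabs w <= 1 + 1.
    rewrite -(subrK rho w) (le_trans (cabsD _ _))// lerD// ltW// (lt_le_trans we)//.
    rewrite ler_pdivrMr// (@le_trans _ _ 1) ?mul1r ?ler1n//; by rewrite ge_min lexx.
  apply: (@le_lt_trans _ _ (e1 + e1 / 2 * cabs D)).
    rewrite lerD//; last by rewrite ler_wpM2r ?cabs_ge0// ltW.
    rewrite [leRHS](_ : _ = (1 + 1) * (e1 / 2)); last by field.
    by rewrite ler_pM ?cabs_ge0.
  have e1e : e1 * (cabs D + 1 + 1) <= e by rewrite -ler_pdivlMr// ge_min lexx orbT.
  apply: lt_le_trans e1e; rewrite !mulrDr mulr1.
  have := cabs_ge0 D => D0.
  have : 0 <= e1 * cabs D by rewrite mulr_ge0// ltW.
  by move: (e1 * cabs D) e10 (mulrAC e1 2^-1 (cabs D)) => u e10 ->; lra.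
have ckall w : cabs w < R0 -> ccont k w.
  by move=> wR; have [->//|/(dk w wR)] := eqVneq w rho; exact: cdiff_ccont.
have mean0 : cint (- pi) pi (fun t => k (cexp (ln r +i* t))) = 0.
  rewrite (@circle_mean _ k R0 p)//.
  - by rewrite /k eq_sym (negPf rho0) /k0 !mul0r mulr0.
  - by rewrite (le_lt_trans p0).
  - by rewrite er.
  - by move=> w wR; rewrite -rhoE; exact: dk.
pose g t := cexp (ln r +i* t).
have gr t : cabs (g t) = r by rewrite cabs_cexp.
have g0 t : g t != 0 by rewrite -cabs_gt0 gr.
have grho t : g t - rho != 0.
  by rewrite subr_eq0; apply: contraTneq rho1 => <-; rewrite gr -ltNge.
pose h d t := f (g t) * (g t)^-1 ^+ d.
pose u d t : R[i] := (g t)^-1 ^+ d.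
(* The second factor is what remains of [w / (w - rho)] after the first [N] terms of its geometric
   series. *)
pose G w := (f w - f rho) * ((rho / w) ^+ N * (w / (w - rho))).
have wn0 w : cabs w = expR (ln r) -> w != 0 by move=> hw; rewrite -cabs_gt0 hw expR_gt0.
have wR0 w : cabs w = expR (ln r) -> cabs w < R0 by move=> ->; rewrite er.
have ch d : ccont_on (- pi) pi (h d).
  apply: (@circ_cont _ (fun w => f w * w^-1 ^+ d)) => w hw; apply: cdiff_ccont.
  apply: cdiffM; first exact/df/wR0.
  by apply: cdiffX; apply: cdiffV; [exact: wn0|exact: cdiff_id].
have cu d : ccont_on (- pi) pi (u d).
  apply: (@circ_cont _ (fun w => w^-1 ^+ d)) => w hw; apply: cdiff_ccont.
  by apply: cdiffX; apply: cdiffV; [exact: wn0|exact: cdiff_id].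
have cG : ccont_on (- pi) pi (fun t => G (g t)).
  apply: circ_cont => w hw; apply: cdiff_ccont.
  have wrho : w - rho != 0.
    by rewrite subr_eq0; apply: contraTneq rho1 => <-; rewrite hw er -ltNge.
  apply: cdiffM; first by apply: cdiffD; [exact/df/wR0|exact: cdiff_cst].
  apply: cdiffM.
    apply: cdiffX; apply: cdiffM; first exact: cdiff_cst.
    by apply: cdiffV; [exact: wn0|exact: cdiff_id].
  apply: cdiffM; first exact: cdiff_id.
  by apply: cdiffV => //; apply: cdiffD; [exact: cdiff_id|exact: cdiff_cst].
have kE t : k (g t) = (\sum_(d < N) rho ^+ d * h d t + (- f rho) * \sum_(d < N) rho ^+ d * u d t) + G (g t).
  rewrite /k -subr_eq0 (negPf (grho t)) /k0 /h /u /G.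
  have -> : \sum_(d < N) rho ^+ d * (f (g t) * (g t)^-1 ^+ d) = f (g t) * \sum_(d < N) (rho / g t) ^+ d.
    by rewrite mulr_sumr; apply: eq_bigr => d _; rewrite exprMn; ring.
  have -> : \sum_(d < N) rho ^+ d * (g t)^-1 ^+ d = \sum_(d < N) (rho / g t) ^+ d.
    by apply: eq_bigr => d _; rewrite exprMn.
  set S := \sum_(d < N) _.
  have V1 : g t / (g t - rho) * (1 - rho / g t) = 1 by field; rewrite g0 grho.
  have S1 : S = g t / (g t - rho) * (1 - (rho / g t) ^+ N).
    have hS : 1 - (rho / g t) ^+ N = (1 - rho / g t) * S.
      by rewrite -opprB subrX1 -/S -mulNr opprB.
    by rewrite hS mulrA V1 mul1r.
  by rewrite S1; ring.
have e1 : cint (- pi) pi (fun t => k (g t)) =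
  (\sum_(d < N) rho ^+ d * cint (- pi) pi (h d) + (- f rho) * (2 * pi)%:C)
  + cint (- pi) pi (fun t => G (g t)).
  have [c1 s1] := @cint_sum R _ _ N (fun d t => rho ^+ d * h d t) piN (fun d => ccont_onZ _ (ch d)).
  have [c2 s2] := @cint_sum R _ _ N (fun d t => rho ^+ d * u d t) piN (fun d => ccont_onZ _ (cu d)).
  rewrite (eq_cint (fun t _ => kE t)) cintD//; last first.
    by apply: ccont_onD => //; exact: ccont_onZ.
  rewrite cintD//; last exact: ccont_onZ.
  rewrite cintZ// s1 s2; congr (_ + _ * _ + _).
    by apply: eq_bigr => d _; rewrite cintZ.
  have [N' ->] : exists N', N = N'.+1 by exists N.-1; rewrite prednK.
  rewrite big_ord_recl cintZ// circle_power expr0 mul1r big1 ?addr0// => d _.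
  by rewrite cintZ// circle_power mulr0.
rewrite mean0 in e1.
have pi20 : (2 * pi)%:C != 0 :> R[i].
  by rewrite (inj_eq (@realC_inj R)) mulf_neq0// gt_eqF.
have e2 : f rho - \sum_(d < N) rho ^+ d * ((2 * pi)%:C^-1 * cint (- pi) pi (h d))
   = (2 * pi)%:C^-1 * cint (- pi) pi (fun t => G (g t)).
  apply: (mulfI pi20); rewrite mulrA divff// mul1r mulrBr mulr_sumr.
  rewrite (eq_bigr (fun d : 'I_N => rho ^+ d * cint (- pi) pi (h d))); last first.
    by move=> d _; rewrite mulrCA mulVKf.
  move/eqP: e1; rewrite eq_sym addr_eq0 => /eqP/(congr1 -%R); rewrite opprK => <-; ring.
rewrite [X in cabs X]e2 cabsM cabsV cabs_real gtr0_norm ?mulr_gt0//.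
rewrite ler_pdivrMl ?mulr_gt0//.
pose B := 2 * M * (r / (r - 1)) / r ^+ N.
rewrite (le_trans (@cint_bound _ _ _ _ B _ _ _))//; last first.
  by rewrite le_eqVlt; apply/orP; left; apply/eqP; rewrite opprK /B; ring.
move=> t _; rewrite /G /B.
have rr1 : r - 1 <= cabs (g t - rho).
  rewrite lerBlDr -(gr t) -{1}(subrK rho (g t)) (le_trans (cabsD _ _))// lerD2l//.
have r10 : 0 < r - 1 by rewrite subr_gt0.
rewrite cabsM [cabs (_ ^+ N * _)]cabsM cabsX [cabs (rho / _)]cabsM [cabs (g t / _)]cabsM !cabsV gr.
rewrite [leRHS](_ : _ = (M + M) * ((1 / r) ^+ N * (r / (r - 1)))); last first.
  by rewrite expr_div_n expr1n; ring.
have rq0 : 0 <= cabs rho / r by rewrite divr_ge0 ?cabs_ge0// ltW.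
have iq0 : 0 <= r / cabs (g t - rho) by rewrite divr_ge0 ?cabs_ge0// ltW.
apply: ler_pM; first exact: cabs_ge0.
- by apply: mulr_ge0 => //; exact: exprn_ge0.
- rewrite (le_trans (cabsD _ _))// cabsN lerD// fM ?gr// (le_trans rho1)// ltW//.
apply: ler_pM => //; first exact: exprn_ge0.
  rewrite lerXn2r ?nnegrE//; first by rewrite divr_ge0// ltW.
  by rewrite ler_wpM2r// invr_ge0 ltW.
by rewrite ler_wpM2l ?(ltW r0)// lef_pV2 ?posrE ?(lt_le_trans r10).
Qed.
End CauchyFormula.

Section TaylorExpansion.
Variable R : realType.
Implicit Types (s t x y : R) (F G : R[i] -> R[i]) (z p w rho : R[i]).

(** The argument has to stay off the cut: an argument [t] is shrunk to [t * (1 - u)], and 0 is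
    approached by small positive reals. *)
Lemma cexp_dense rho (e : R) : cabs rho <= 1 -> 0 < e -> exists p,
  [/\ cabs (cexp p - rho) < e, - pi < complex.Im p < pi & complex.Re p <= 0].
Proof.
move=> rho1 e0; have pi0 : 0 < pi :> R := pi_gt0 R.
have [->|rho0] := eqVneq rho 0.
  exists ((Num.min 0 (ln (e / 2))) +i* 0); split; rewrite /= ?oppr_lt0 ?pi0 ?ge_min ?lexx//.
  rewrite subr0 cabs_cexp /= (@le_lt_trans _ _ (e / 2))//; last by rewrite ltr_pdivrMr// ltr_pMr// ltr1n.
  by rewrite -[leRHS]lnK ?posrE ?divr_gt0// ler_expR ge_min lexx orbT.
have [t [/andP[t1 t2] rhoE]] := polar rho0.
set l := ln _ in rhoE.
have l0 : l <= 0 by rewrite ln_le0.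
have [q q0 qP] := cdiff_ccont (cdiff_cexp (l +i* t)) e0.
pose u := Num.min (1 / 2) (q / (2 * pi)).
have u0 : 0 < u by rewrite lt_min !divr_gt0// mulr_gt0.
have u1 : u < 1 by rewrite gt_min; apply/orP; left; lra.
have uq : pi * u < q.
  rewrite (@le_lt_trans _ _ (pi * (q / (2 * pi))))//; first by rewrite ler_pM2l// ge_min lexx orbT.
  rewrite (_ : pi * _ = q / 2); first by rewrite ltr_pdivrMr// ltr_pMr// ltr1n.
  have : (pi : R) != 0 by rewrite gt_eqF.
  by move: (pi : R) => v v0; field.
have tpi : `|t| <= pi by rewrite ler_norml t1 t2.
exists (l +i* (t * (1 - u))); split => //=.
- rewrite rhoE; apply: qP; rewrite subCE subrr (le_lt_trans (cabs_le_ReIm _))//= normr0 add0r.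
  rewrite (_ : _ - t = - (t * u)); last by ring.
  by rewrite normrN normrM (gtr0_norm u0) (le_lt_trans _ uq)// ler_wpM2r// ltW.
- rewrite -ltr_norml normrM (@gtr0_norm _ (1 - u)) ?subr_gt0//.
  rewrite (@le_lt_trans _ _ (pi * (1 - u)))//; first by rewrite ler_wpM2r// subr_ge0 ltW.
  by rewrite mulrBr mulr1 ltrBlDr ltrDl mulr_gt0.
Qed.

(** By density and continuity the estimate of [cauchy_taylor] extends to the closed unit disc. The
    coefficients are fixed before [M], [N] and [rho], so one sequence serves everywhere, with a
    geometric error since [r > 1]. *)
Lemma taylor (f : R[i] -> R[i]) (R0 r : R) :
  1 < r -> r < R0 -> (forall w, cabs w < R0 -> cdiff f w) ->
  exists c : nat -> R[i], forall M, (forall w, cabs w <= r -> cabs (f w) <= M) ->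
    forall N, (0 < N)%N -> forall rho, cabs rho <= 1 ->
      cabs (f rho - \sum_(d < N) rho ^+ d * c d) <= 4 * M * (r / (r - 1)) / r ^+ N.
Proof.
move=> r1 rR df.
pose c d := (2 * pi)%:C^-1 *
     cint (- pi) pi (fun t => f (cexp (ln r +i* t)) * (cexp (ln r +i* t))^-1 ^+ d).
exists c => M fM N N0 rho rho1; pose g w := f w - \sum_(d < N) w ^+ d * c d.
have cg : cdiff g rho.
  apply: cdiffD; first by apply: df; rewrite (le_lt_trans rho1)// (lt_trans r1).
  apply: cdiffN; elim: (N) => [|n IH].
    have := @cdiff_cst R 0 rho; congr (cdiff _ _); apply/funext => w; by rewrite big_ord0.
  have := cdiffD IH (cdiffM (cdiffX n (cdiff_id rho)) (cdiff_cst (c n) rho)).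
  by congr (cdiff _ _); apply/funext => w; rewrite big_ord_recr.
apply/ler_addgt0Pr => e e0.
have [q q0 qP] := cdiff_ccont cg e0.
have [p [pq pip p0]] := cexp_dense rho1 q0.
rewrite -/(g rho) -(subrK (g (cexp p)) (g rho)) (le_trans (cabsD _ _))// addrC.
rewrite lerD//; last by rewrite cabsB ltW// qP.
exact: (@cauchy_taylor R f R0 r M N (cexp p) p).
Qed.
End TaylorExpansion.

(** * Unitary invariance of the surface measure *)

Section Preserving.
Context d1 d2 (T1 : measurableType d1) (T2 : measurableType d2) (R : realType).
Variables (m1 : {measure set T1 -> \bar R}) (m2 : {sigma_finite_measure set T2 -> \bar R}).
Variables (f1 : T1 -> T1) (f2 : T2 -> T2).
Hypothesis mf1 : measurable_fun setT f1.
Hypothesis h1 : forall A, measurable A -> m1 (f1 @^-1` A) = m1 A.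
Hypothesis h2 : forall A, measurable A -> m2 (f2 @^-1` A) = m2 A.

Lemma product_preserving (A : set (T1 * T2)) : measurable A ->
  (m1 \x m2)%E ((fun p => (f1 p.1, f2 p.2)) @^-1` A) = (m1 \x m2)%E A.
Proof.
move=> mA; rewrite /product_measure1.
transitivity (\int[m1]_x ((m2 \o xsection A) \o f1) x)%E.
  apply: eq_integral => x _ /=; rewrite -[RHS]h2; last exact: measurable_xsection.
  by congr (m2 _); apply/seteqP; split => y; rewrite /xsection /= !inE.
rewrite -(@ge0_integral_pushforward _ _ _ _ _ f1 mf1 m1 setT (m2 \o xsection A))//; last exact: measurable_fun_xsection.
by apply: eq_measure_integral => B mB _; exact: h1.
Qed.
End Preserving.

(** * Lebesgue volume: translations and boxes *)

Section Translation.
Variable R : realType.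
Local Notation mR := (measurableTypeR R).

Definition shiftR (c : R) : mR -> mR := fun x => x + c.

Lemma measurable_shiftR c : measurable_fun setT (shiftR c).
Proof. by apply: measurable_funD. Qed.
HB.instance Definition _ c := isMeasurableFun.Build _ _ _ _ (shiftR c) (measurable_shiftR c).

Lemma lebesgue_shift (c : R) (A : set mR) : measurable A ->
  lebesgue_measure (shiftR c @^-1` A) = lebesgue_measure A.
Proof.
move=> mA; apply/esym.
apply: (lebesgue_measure_unique (mu := image_measure (@lebesgue_measure R) (shiftR c))) => // X.
move=> [[a b] _ <-] /=; rewrite /image_measure /pushforward.
have -> : shiftR c @^-1` `]a, b]%classic = `]a - c, b - c]%classic.
  by apply/seteqP; split => x /=; rewrite /shiftR !in_itv /= ltrBlDr lerBrDr.
rewrite !lebesgue_measure_itv /= !lte_fin ltrD2r; case: ifP => // _.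
by rewrite -!EFinD; congr (_%:E); ring.
Qed.

Definition cadd n (c x : cpt R n) : cpt R n :=
  [tuple ((tnth x j).1 + (tnth c j).1, (tnth x j).2 + (tnth c j).2) | j < n].

Lemma measurable_cadd n (c : cpt R n) : measurable_fun setT (cadd c).
Proof.
apply/measurable_fun_tnthP => j.
rewrite (_ : _ \o _ = fun x : cpt R n => (shiftR (tnth c j).1 (tnth x j).1, shiftR (tnth c j).2 (tnth x j).2)); last first.
  by apply/funext => x; rewrite /= tnth_mktuple.
apply/measurable_fun_pair => /=.
- apply: (measurableT_comp (measurable_shiftR _)).
  by apply: (measurableT_comp measurable_fst); exact: measurable_tnth.
- apply: (measurableT_comp (measurable_shiftR _)).
  by apply: (measurableT_comp measurable_snd); exact: measurable_tnth.
Qed.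
HB.instance Definition _ n c := isMeasurableFun.Build _ _ _ _ (@cadd n c) (@measurable_cadd n c).

Lemma cadd_ccons n (c0 : mR * mR) (c : cpt R n) (p : cpt R n * mR * mR) :
  cadd (cons_tuple c0 c) (ccons p) =
  ccons (cadd c p.1.1, shiftR c0.1 p.1.2, shiftR c0.2 p.2).
Proof.
apply/eq_from_tnth => j; rewrite tnth_mktuple.
case: (unliftP ord0 j) => [k ->|->]; last by rewrite !tnth0.
by rewrite !tnthS tnth_mktuple.
Qed.

Lemma vol_shift n (c : cpt R n) (A : set (cpt R n)) : measurable A ->
  vol R n (cadd c @^-1` A) = vol R n A.
Proof.
elim: n c A => [|n IH] c A mA; last case/tupleP: c => c0 c'.
  congr (vol R 0 _); apply/seteqP; split => x /=; by rewrite (tuple0 (cadd c x)) (tuple0 x).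
rewrite /= /image_measure /pushforward.
have mA' : measurable (@ccons R n @^-1` A).
  by rewrite -[X in measurable X]setTI; exact: measurable_ccons.
have h0 B : measurable B -> (vol R n \x @lebesgue_measure R)%E
    ((fun p => (cadd c' p.1, shiftR c0.1 p.2)) @^-1` B) = (vol R n \x @lebesgue_measure R)%E B.
  apply: product_preserving; first exact: measurable_cadd.
    exact: IH.
  exact: lebesgue_shift.
have mf : measurable_fun setT (fun p : cpt R n * mR => (cadd c' p.1, shiftR c0.1 p.2)).
  apply/measurable_fun_pair.
    by apply: (measurableT_comp (measurable_cadd _)); exact: measurable_fst.
  by apply: (measurableT_comp (measurable_shiftR _)); exact: measurable_snd.
rewrite -[RHS](@product_preserving _ _ _ _ R (vol R n \x @lebesgue_measure R)%E (@lebesgue_measure R)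
  _ (shiftR c0.2) mf h0)//; last exact: lebesgue_shift.
by congr (_ _); apply/seteqP; split => -[[p x] y]; rewrite /preimage /= cadd_ccons.
Qed.

Definition cbox n (c : cpt R n) (e : R) : set (cpt R n) :=
  [set x | forall j, `|(tnth x j).1 - (tnth c j).1| < e /\ `|(tnth x j).2 - (tnth c j).2| < e].

Lemma vol_cbox n (c : cpt R n) (e : R) : 0 < e ->
  measurable (cbox c e) /\ vol R n (cbox c e) = ((2 * e) ^+ (2 * n))%:E.
Proof.
move=> e0; elim: n c => [|n IH] c; last case/tupleP: c => c0 c'.
  have -> : cbox c e = setT by apply/seteqP; split => // x _ [].
  split; first exact: measurableT.
  by rewrite /= diracT expr0.
have [mB vB] := IH c'.
have mI (a : R) : measurable (`]a - e, a + e[%classic : set mR) by exact: measurable_itv.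
have vI (a : R) : lebesgue_measure (`]a - e, a + e[%classic : set mR) = (2 * e)%:E.
  rewrite lebesgue_measure_itv /= lte_fin ltrD2l gtrN// -EFinD; congr (_%:E); ring.
have E : @ccons R n @^-1` (cbox (cons_tuple c0 c') e) =
   (cbox c' e `*` `]c0.1 - e, c0.1 + e[) `*` `]c0.2 - e, c0.2 + e[.
  apply/seteqP; split => -[[p x] y] /=; rewrite /cbox /= !in_itv /=.
    move=> H; have := H ord0; rewrite !tnth0 /= !ltr_norml => -[/andP[h1 h2] /andP[h3 h4]].
    do 2?split; try (apply/andP; split; lra).
    by move=> j; have := H (lift ord0 j); rewrite !tnthS.
  move=> [[H /andP[h1 h2]] /andP[h3 h4]] j.
  case: (unliftP ord0 j) => [k ->|->]; first by rewrite !tnthS.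
  by rewrite !tnth0 /= !ltr_norml; split; apply/andP; split; lra.
split; last first.
  rewrite [LHS]/= /image_measure /pushforward E product_measure1E//; last exact: measurableX.
  have H2 := product_measure1E (vol R n) (@lebesgue_measure R) mB (mI c0.1).
  rewrite [X in (X * _)%E]H2 [X in (X * _ * _)%E]vB [X in (_ * X * _)%E]vI [X in (_ * X)%E]vI -!EFinM; congr (_%:E).
  by rewrite mulnS !exprS; ring.
have -> : cbox (cons_tuple c0 c') e = \bigcap_(j in [set: 'I_n.+1])
   ((fun x : cpt R n.+1 => (tnth x j).1) @^-1` `](tnth (cons_tuple c0 c') j).1 - e, (tnth (cons_tuple c0 c') j).1 + e[%classic `&`
    (fun x : cpt R n.+1 => (tnth x j).2) @^-1` `](tnth (cons_tuple c0 c') j).2 - e, (tnth (cons_tuple c0 c') j).2 + e[%classic).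
  have eqv (x a : R) : (`|x - a| < e) = (x \in `]a - e, a + e[).
    by rewrite in_itv /= ltr_norml ltrBrDr ltrBlDr addrC [e + _]addrC; congr (_ && _); rewrite addrC.
  apply/seteqP; split => x /= H j; first by move=> _; have := H j; rewrite !eqv => -[].
  by have := H j I; rewrite !eqv => -[].
apply: fin_bigcap_measurable => // j _; apply: measurableI.
  rewrite -[X in measurable X]setTI; apply: (measurableT_comp measurable_fst (measurable_tnth j)) => //.
rewrite -[X in measurable X]setTI; apply: (measurableT_comp measurable_snd (measurable_tnth j)) => //.
Qed.
End Translation.

Section SectionFubini.
Context d1 d2 (T1 : measurableType d1) (T2 : measurableType d2) (R : realType).
Variable m1 : {sigma_finite_measure set T1 -> \bar R}.
Variable m2 : {sigma_finite_measure set T2 -> \bar R}.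

Lemma section_fubini (A : set (T1 * T2)) : measurable A ->
  (\int[m1]_x (m2 \o xsection A) x = \int[m2]_y (m1 \o ysection A) y)%E.
Proof.
move=> mA; rewrite -(indic_fubini_tonelli_FE m2 mA) -(indic_fubini_tonelli_GE m1 mA).
exact: indic_fubini_tonelli.
Qed.
End SectionFubini.

(** * Linear isometries preserve the volume *)

Section GroupIsometry.
Context d (X : measurableType d) (R : realType).
Variable m : {sigma_finite_measure set X -> \bar R}.
Variables (add : X -> X -> X) (opp : X -> X) (T T' : X -> X) (B : set X).
Hypothesis madd : forall d' (S : measurableType d') (f g : S -> X),
  measurable_fun setT f -> measurable_fun setT g -> measurable_fun setT (fun s => add (f s) (g s)).
Hypothesis mopp : measurable_fun setT opp.
Hypothesis mT : measurable_fun setT T.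
Hypothesis shift : forall c A, measurable A -> m (add c @^-1` A) = m A.
Hypothesis addC : forall x y, add x y = add y x.
Hypothesis addNK : forall x y, add (opp x) (add x y) = y.
Hypothesis oppD : forall x y, opp (add x y) = add (opp x) (opp y).
Hypothesis oppK : forall x, opp (opp x) = x.
Hypothesis TD : forall x y, T (add x y) = add (T x) (T y).
Hypothesis TN : forall x, T (opp x) = opp (T x).
Hypothesis TK : forall y, T (T' y) = y.
Hypothesis mB : measurable B.
Hypothesis BT : forall x, B (T x) <-> B x.
Hypothesis BN : forall x, B (opp x) <-> B x.
Hypothesis B_gt0 : (0 < m B)%E.
Hypothesis B_fin : (m B < +oo)%E.

(* Both sides, multiplied by m(B), are the double integral of
   1_A(T x + y) 1_B(y): integrate first in x, respectively first in y after
   the substitution y -> y - T x. *)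
Lemma measure_isometry (A : set X) : measurable A -> m (T @^-1` A) = m A.
Proof.
move=> mA.
have mTA : measurable (T @^-1` A) by rewrite -[X in measurable X]setTI; exact: mT.
pose S := [set p : X * X | A (add (T p.1) p.2) /\ B p.2].
(* [S'] is [S] after the substitution [y -> y - T x], which preserves the measure of the sections at
   fixed [x]. *)
pose S' := [set p : X * X | A p.2 /\ B (add (opp (T p.1)) p.2)].
have mT1 : measurable_fun setT (fun p : X * X => T p.1) by exact: measurableT_comp.
have mS : measurable S.
  have -> : S = (fun p => add (T p.1) p.2) @^-1` A `&` snd @^-1` B by [].
  apply: measurableI; rewrite -[X in measurable X]setTI; first exact: madd.
  exact: measurable_snd.
have mS' : measurable S'.
  have -> : S' = snd @^-1` A `&` (fun p => add (opp (T p.1)) p.2) @^-1` B by [].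
  apply: measurableI; rewrite -[X in measurable X]setTI; first exact: measurable_snd.
  by apply: madd => //; apply: measurableT_comp.
have h1 := section_fubini m m mS.
have h2 := section_fubini m m mS'.
have e1 : m \o xsection S = m \o xsection S'.
  apply/funext => x /=; rewrite -[RHS](shift (T x)); last exact: measurable_xsection.
  congr (m _); apply/seteqP; split => y; rewrite /xsection /= !inE /= /S /S' /=.
    by rewrite addNK; case.
  by rewrite addNK; case.
have e2 : (\int[m]_y (m \o ysection S) y = m (T @^-1` A) * m B)%E.
  rewrite -integral_cst// [RHS]integral_mkcond; apply: eq_integral => y _ /=.
  rewrite patchE; case: ifPn; rewrite ?inE ?notin_setE => yB.
    rewrite -[RHS](shift (T' y) mTA); congr (m _).
    apply/seteqP; split => x; rewrite /ysection /= inE /= /S /= TD TK (addC (T x) y); first by case.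
    by move=> ?; split.
  rewrite (_ : ysection S y = set0) ?measure0//.
  by apply/seteqP; split => x //; rewrite /ysection /= inE => -[].
have e3 : (\int[m]_y (m \o ysection S') y = m B * m A)%E.
  rewrite -integral_cst// [RHS]integral_mkcond; apply: eq_integral => y _ /=.
  rewrite patchE; case: ifPn; rewrite ?inE ?notin_setE => yA.
    rewrite -[RHS](shift (opp (T' y)) mB); congr (m _).
    (* [T] maps [x - T' y] to the opposite of [y - T x], and [B] is invariant under [T] and under
       opposites. *)
    have Bx x : B (add (opp (T x)) y) <-> B (add (opp (T' y)) x).
      by rewrite -(BT (add _ x)) -(BN (add _ y)) TD TN TK oppD oppK addC.
    apply/seteqP; split => x; rewrite /ysection /= inE /= /S' /= -Bx; first by case.
    by move=> ?; split.
  rewrite (_ : ysection S' y = set0) ?measure0//.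
  by apply/seteqP; split => x //; rewrite /ysection /= inE => -[].
have h : (m (T @^-1` A) * m B = m A * m B)%E by rewrite -e2 -h1 e1 h2 e3 muleC.
have Bf : m B \is a fin_num by rewrite ge0_fin_numE.
apply/eqP; rewrite eq_le -(lee_pmul2r Bf B_gt0) h lexx /=.
by rewrite -(lee_pmul2r Bf B_gt0) h lexx.
Qed.
End GroupIsometry.

Section SigmaFiniteVolume.
Variable R : realType.

Lemma nsq_cvec n (x : cpt R n) :
  nsq (cvec x) = \sum_(j < n) ((tnth x j).1 ^+ 2 + (tnth x j).2 ^+ 2).
Proof. by apply: eq_bigr => j _; rewrite mxE. Qed.

Lemma nsq_ge0 n (z : 'rV[R[i]]_n) : 0 <= nsq z.
Proof. by apply: sumr_ge0 => j _; exact: csq_ge0. Qed.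

Lemma tnth_sq_le n (x : cpt R n) j :
  (tnth x j).1 ^+ 2 + (tnth x j).2 ^+ 2 <= nsq (cvec x).
Proof.
rewrite nsq_cvec (bigD1 j) //= lerDl sumr_ge0// => k _.
by rewrite addr_ge0 ?sqr_ge0.
Qed.

Definition czero n : cpt R n := [tuple (0, 0) | _ < n].

Lemma sqr_lt1 (u : R) : u ^+ 2 < 1 -> `|u| < 1.
Proof. by rewrite -[X in X < _ -> _]real_normK ?num_real// expr_lt1. Qed.

Lemma vol_cball_gt0 n : (0 < vol R n (@cvec R n @^-1` @cball R n))%E.
Proof.
have n0 : (0 : R) < (2 * n.+1)%:R by rewrite ltr0n.
(* A box of this radius lies in the ball: each of the [2 * n] squared real coordinates is at most
   [e], and [2 * n * e < 1]. *)
pose e : R := (2 * n.+1)%:R^-1.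
have e0 : 0 < e by rewrite invr_gt0.
have [mB vB] := vol_cbox (czero n) e0.
apply: (@lt_le_trans _ _ (vol R n (cbox (czero n) e))).
  by rewrite vB lte_fin exprn_gt0// mulr_gt0.
rewrite le_measure ?inE//; first exact: measurable_cball.
move=> x Bx; rewrite /cball /= nsq_cvec.
have e1 : e <= 1 by rewrite invf_le1// ler1n.
have sqe (u : R) : `|u| < e -> u ^+ 2 <= e.
  move=> ue; rewrite -real_normK ?num_real// expr2 (@le_trans _ _ (e * 1))//; last by rewrite mulr1.
  by rewrite ler_pM// ?(ltW ue)// (le_trans (ltW ue)).
apply: (@le_lt_trans _ _ (\sum_(j < n) (e + e))).
  apply: ler_sum => j _; have := Bx j; rewrite !tnth_mktuple /= !subr0 => -[h1 h2].
  by rewrite lerD// sqe.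
rewrite sumr_const card_ord -mulr_natl.
rewrite (_ : _ * _ = (2 * n)%:R * e); last by rewrite natrM; ring.
by rewrite /e ltr_pdivrMr// mul1r ltr_nat ltn_pmul2l.
Qed.

Lemma vol_cball_fin n : (vol R n (@cvec R n @^-1` @cball R n) < +oo)%E.
Proof.
have [mB vB] := vol_cbox (czero n) (@ltr01 R).
apply: (@le_lt_trans _ _ (vol R n (cbox (czero n) 1))); last by rewrite vB ltry.
rewrite le_measure ?inE//; first exact: measurable_cball.
move=> x; rewrite /cball /= => xB j; rewrite !tnth_mktuple /= !subr0.
have h := le_lt_trans (tnth_sq_le x j) xB.
by split; apply: sqr_lt1; apply: le_lt_trans h; rewrite ?lerDl ?lerDr sqr_ge0.
Qed.

Lemma vol_sigma_finite n : sigma_finite setT (vol R n).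
Proof.
exists (fun k => cbox (czero n) k.+1%:R).
  apply/seteqP; split => // x _ /=.
  pose m := \sum_(j < n) (`|(tnth x j).1| + `|(tnth x j).2|).
  exists (Num.truncn m) => // j; rewrite !tnth_mktuple /= !subr0.
  have h : `|(tnth x j).1| + `|(tnth x j).2| <= m.
    by rewrite /m (bigD1 j)//= lerDl sumr_ge0// => k _; rewrite addr_ge0.
  have h2 := le_lt_trans h (truncnS_gt m).
  by split; apply: le_lt_trans h2; rewrite ?lerDl ?lerDr.
move=> k; have k0 : 0 < k.+1%:R :> R by rewrite ltr0n.
by have [mB vB] := vol_cbox (czero n) k0; split => //; rewrite vB ltry.
Qed.

(** A second name for the volume, to carry the sigma-finite structure that Fubini's theorem asks
    for. *)
Definition volS n : set (cpt R n) -> \bar R := vol R n.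
HB.instance Definition _ n := Measure.on (@volS n).
HB.instance Definition _ n := Measure_isSigmaFinite.Build _ _ _ (@volS n) (vol_sigma_finite n).

Section Isometry.
Variable n : nat.

Definition copp (x : cpt R n) : cpt R n := [tuple (- (tnth x j).1, - (tnth x j).2) | j < n].

Variables T T' : cpt R n -> cpt R n.
Hypothesis mT : measurable_fun setT T.
Hypothesis TD : forall x y, T (cadd y x) = cadd (T y) (T x).
Hypothesis TN : forall x, T (copp x) = copp (T x).
Hypothesis TK : forall y, T (T' y) = y.
Hypothesis Tn : forall x, nsq (cvec (T x)) = nsq (cvec x).

Lemma nsq_copp x : nsq (cvec (copp x)) = nsq (cvec x).
Proof. by rewrite !nsq_cvec; apply: eq_bigr => j _; rewrite tnth_mktuple !sqrrN. Qed.

Lemma caddC (x y : cpt R n) : cadd x y = cadd y x.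
Proof. by apply/eq_from_tnth => j; rewrite !tnth_mktuple; congr (_, _); rewrite addrC. Qed.

Lemma caddN (x y : cpt R n) : cadd (copp x) (cadd x y) = y.
Proof.
apply/eq_from_tnth => j; rewrite !tnth_mktuple /=; case: (tnth y j) => a b /=; congr (_, _); ring.
Qed.

Lemma coppD (x y : cpt R n) : copp (cadd x y) = cadd (copp x) (copp y).
Proof. by apply/eq_from_tnth => j; rewrite !tnth_mktuple /= !opprD. Qed.

Lemma coppK x : copp (copp x) = x.
Proof. by apply/eq_from_tnth => j; rewrite !tnth_mktuple /= !opprK; case: (tnth x j). Qed.

Lemma measurable_caddf (d : measure_display) (S : measurableType d) (f g : S -> cpt R n) :
  measurable_fun setT f -> measurable_fun setT g -> measurable_fun setT (fun s => cadd (f s) (g s)).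
Proof.
move=> mf mg; apply/measurable_fun_tnthP => j.
have m1 (h : S -> cpt R n) : measurable_fun setT h -> measurable_fun setT (fun s => (tnth (h s) j).1).
  by move=> mh; apply: (measurableT_comp measurable_fst (measurableT_comp (measurable_tnth j) mh)).
have m2 (h : S -> cpt R n) : measurable_fun setT h -> measurable_fun setT (fun s => (tnth (h s) j).2).
  by move=> mh; apply: (measurableT_comp measurable_snd (measurableT_comp (measurable_tnth j) mh)).
rewrite (_ : _ \o _ = fun s => ((tnth (g s) j).1 + (tnth (f s) j).1, (tnth (g s) j).2 + (tnth (f s) j).2)); last first.
  by apply/funext => x; rewrite /= tnth_mktuple.
apply/measurable_fun_pair.
  exact: (measurable_funD (m1 _ mg) (m1 _ mf)).
exact: (measurable_funD (m2 _ mg) (m2 _ mf)).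
Qed.

Lemma measurable_copp : measurable_fun setT copp.
Proof.
apply/measurable_fun_tnthP => j.
rewrite (_ : _ \o _ = fun x : cpt R n => (- (tnth x j).1, - (tnth x j).2)); last first.
  by apply/funext => x; rewrite /= tnth_mktuple.
apply/measurable_fun_pair; apply: measurableT_comp => //.
  exact: (measurableT_comp measurable_fst (measurable_tnth j)).
exact: (measurableT_comp measurable_snd (measurable_tnth j)).
Qed.

Lemma vol_isometry (A : set (cpt R n)) : measurable A ->
  vol R n (T @^-1` A) = vol R n A.
Proof.
apply: (@measure_isometry _ _ R (@volS n) (@cadd R n) copp T T' (@cvec R n @^-1` @cball R n)) => //.
- by move=> d' S f g; exact: measurable_caddf.
- exact: measurable_copp.
- by move=> c B mB; exact: vol_shift.
- exact: caddC.
- exact: caddN.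
- exact: coppD.
- exact: coppK.
- exact: measurable_cball.
- by move=> x; rewrite /cball /= Tn.
- by move=> x; rewrite /cball /= nsq_copp.
- exact: vol_cball_gt0.
- exact: vol_cball_fin.
Qed.
End Isometry.
End SigmaFiniteVolume.

Section RealContinuity.
Variable R : realType.
Variable V : normedModType R[i].

Lemma contR_eps (f : V -> R) (z : V) :
  (forall e : R, 0 < e -> exists2 d : R, 0 < d &
    forall w : V, vabs (w - z) < d -> `|f w - f z| < e) -> {for z, continuous f}.
Proof.
move=> h; apply/cvgrPdist_lt => e /h[d d0 dP].
by apply/near_eps; exists d => // w /dP; rewrite distrC.
Qed.

Lemma contC_eps (F : V -> R[i]) (z : V) : {for z, continuous (F : V -> R[i]^o)} ->
  forall e : R, 0 < e -> exists2 d : R, 0 < d &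
    forall w : V, vabs (w - z) < d -> cabs (F w - F z) < e.
Proof. by move/cont_eps. Qed.

Lemma Re_cont (F : V -> R[i]) (z : V) : {for z, continuous (F : V -> R[i]^o)} ->
  {for z, continuous (fun w => complex.Re (F w))}.
Proof.
move=> /contC_eps cF; apply: contR_eps => e /cF[d d0 dP]; exists d => // w /dP.
by apply: le_lt_trans; rewrite -ReB Re_le_cabs.
Qed.

Lemma Im_cont (F : V -> R[i]) (z : V) : {for z, continuous (F : V -> R[i]^o)} ->
  {for z, continuous (fun w => complex.Im (F w))}.
Proof.
move=> /contC_eps cF; apply: contR_eps => e /cF[d d0 dP]; exists d => // w /dP.
by apply: le_lt_trans; rewrite -ImB Im_le_cabs.
Qed.

Lemma cabs_cont (F : V -> R[i]) (z : V) : {for z, continuous (F : V -> R[i]^o)} ->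
  {for z, continuous (fun w => cabs (F w))}.
Proof.
move=> /contC_eps cF; apply: contR_eps => e /cF[d d0 dP]; exists d => // w /dP.
apply: le_lt_trans.
have h (u v : R[i]) : cabs u - cabs v <= cabs (u - v).
  by rewrite lerBlDr -{1}(subrK v u) cabsD.
by rewrite ler_norml h andbT lerNl opprB cabsB h.
Qed.

End RealContinuity.

(** * Topology of C^n and measurability of continuous functions *)

Section RowTopology.
Variable R : realType.
Variable n : nat.
Local Notation V := ('rV[R[i]]_n : normedModType R[i]).
Implicit Types z w : V.

Lemma coord_le_vabs z j : cabs (z ord0 j) <= vabs z.
Proof.
rewrite -lecR -normV -normC {2}/Num.norm /= mx_normE.
by rewrite -[leLHS]nngE num_le; exact: (le_bigmax _ (fun i : 'I_1 * 'I_n => `|z i.1 i.2|%:nng) (ord0, j)).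
Qed.

Lemma vabs_lt z (d : R) : 0 < d -> (forall j, cabs (z ord0 j) < d) -> vabs z < d.
Proof.
move=> d0 zd; rewrite -ltcR -normV {1}/Num.norm /=.
have [->|/mx_norm_neq0[[i j] ->]] := eqVneq (mx_norm z) 0; first by rewrite ltcR.
by rewrite /= (ord1 i) normC ltcR.
Qed.

Definition cptv z : cpt R n := [tuple (complex.Re (z ord0 j), complex.Im (z ord0 j)) | j < n].

Lemma cptvK z : cvec (cptv z) = z.
Proof. by apply/rowP => j; rewrite mxE tnth_mktuple /=; case: (z ord0 j). Qed.

Lemma cvecK (x : cpt R n) : cptv (cvec x) = x.
Proof. by apply/eq_from_tnth => j; rewrite tnth_mktuple mxE /=; case: (tnth x j). Qed.

Lemma near_box z (P : set V) : (\forall w \near z, P w) ->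
  exists2 e : R, 0 < e & forall x, cbox (cptv z) e x -> P (cvec x).
Proof.
move=> /near_eps[d d0 dP]; exists (d / 2); first by rewrite divr_gt0.
move=> x xb; apply: dP; apply: vabs_lt => // j; rewrite !mxE.
have := xb j; rewrite tnth_mktuple /= => -[h1 h2].
rewrite (le_lt_trans (cabs_le_ReIm _))// [ltRHS]splitr ReB ImB ltrD//.
Qed.

(** An open set is the union of the countably many boxes of rational centre and radius [1 / (k + 1)]
    that it contains. A point with an [e]-box inside the set is reached by a box of radius below
    [e / 2]. *)
Lemma open_measurable_cvec (U : set V) : open U -> measurable (@cvec R n @^-1` U).
Proof.
move=> oU.
pose ctr (p : n.-tuple (rat * rat) * nat) : cpt R n :=
  [tuple (ratr (tnth p.1 j).1, ratr (tnth p.1 j).2) | j < n].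
pose rad (p : n.-tuple (rat * rat) * nat) : R := p.2.+1%:R^-1.
pose F p := if `[< cbox (ctr p) (rad p) `<=` @cvec R n @^-1` U >] then cbox (ctr p) (rad p) else set0.
suff -> : @cvec R n @^-1` U = \bigcup_p F p.
  apply: countable_bigcupT_measurable; first exact: countableP.
  move=> p; rewrite /F; case: asboolP => // _.
  have r0 : 0 < rad p by rewrite invr_gt0 ltr0n.
  by have [] := vol_cbox (ctr p) r0.
apply/seteqP; split => x; last first.
  by move=> [p _]; rewrite /F; case: asboolP => // h; exact: h.
move=> Ux; have : \forall w \near (cvec x : V), U w by exact: open_nbhs_nbhs.
move=> /near_box[e e0]; rewrite cvecK => eP.
have [k hk] : exists k : nat, k.+1%:R^-1 < e / 2.
  exists (Num.truncn (e / 2)^-1); rewrite invf_plt ?posrE ?ltr0n ?divr_gt0//.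
  exact: truncnS_gt.
have k0 : 0 < k.+1%:R^-1 :> R by rewrite invr_gt0 ltr0n.
have ap (u : R) : exists q : rat, `|u - ratr q| < k.+1%:R^-1.
  have uu : u - k.+1%:R^-1 < u + k.+1%:R^-1 by rewrite ltrBlDr -addrA ltrDl addr_gt0.
  have [q] := rat_in_itvoo uu; rewrite in_itv /= => qq.
  by exists q; rewrite ltr_distlC.
pose f1 j := cid (ap (tnth x j).1); pose f2 j := cid (ap (tnth x j).2).
pose p : n.-tuple (rat * rat) * nat := ([tuple (sval (f1 j), sval (f2 j)) | j < n], k).
have px : cbox (ctr p) (rad p) x.
  move=> j; rewrite !tnth_mktuple /=; split; [exact: (svalP (f1 j))|exact: (svalP (f2 j))].
exists p => //; rewrite /F; case: asboolP => // -[] y py; apply: eP => j.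
have [a1 a2] := px j; have [b1 b2] := py j.
have tri (u v w : R) : `|u - w| < k.+1%:R^-1 -> `|v - w| < k.+1%:R^-1 -> `|v - u| < e.
  rewrite distrC => h1 h2; rewrite -(subrK w v) -addrA (le_lt_trans (ler_normD _ _))//.
  by rewrite [ltRHS]splitr ltrD//; [exact: lt_trans h2 hk|exact: lt_trans h1 hk].
by split; [exact: tri a1 b1|exact: tri a2 b2].
Qed.

Lemma cont_measurable (O : set V) (f : V -> R) (D : set (cpt R n)) :
  open O -> (forall z, O z -> {for z, continuous f}) -> measurable D ->
  (forall x, D x -> O (cvec x)) -> measurable_fun D (fun x => f (cvec x)).
Proof.
move=> oO cf mD DO; apply: (measurability (@RGenOInfty.G R)).
  exact: RGenOInfty.measurableE.
move=> _ [_ [t ->] <-].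
have -> : D `&` (fun x => f (cvec x)) @^-1` `]t, +oo[ =
   D `&` (@cvec R n @^-1` [set z | O z /\ t < f z]).
  apply/seteqP; split => x /=; rewrite in_itv /= andbT; last by move=> [? []].
  by move=> [Dx tx]; split => //; split => //; exact: DO.
apply: measurableI => //; apply: open_measurable_cvec.
rewrite openE => z [Oz tz] /=; apply: filterI; first exact: open_nbhs_nbhs.
have oo : open_nbhs (f z) [set y | t < y] by split => //; exact: open_gt.
exact: (cf z Oz _ (open_nbhs_nbhs oo)).
Qed.

Lemma coord_contC (j : 'I_n) (z : V) : {for z, continuous (fun w : V => (w ord0 j : R[i]^o))}.
Proof.
apply/cont_eps => e e0; exists e => // w; apply: le_lt_trans.
by have := coord_le_vabs (w - z) j; rewrite !mxE.
Qed.

Lemma nsq_cont (z : V) : {for z, continuous (@nsq R n : V -> R)}.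
Proof.
rewrite (_ : (@nsq R n : V -> R) = \sum_(j < n) (fun w : V => csq (w ord0 j))); last first.
  by apply/funext => w; rewrite fct_sumE.
elim/big_ind : _ => [|f g cf cg|j _]; first by apply: contR_eps => e e0; exists 1 => // w _; rewrite subrr normr0.
  exact: continuousD.
have h1 := Re_cont (@coord_contC j z); have h2 := Im_cont (@coord_contC j z).
rewrite (_ : (fun _ => _) = (fun w : V => complex.Re (w ord0 j)) * (fun w : V => complex.Re (w ord0 j))
   + (fun w : V => complex.Im (w ord0 j)) * (fun w : V => complex.Im (w ord0 j))).
  exact: (continuousD (continuousM h1 h1) (continuousM h2 h2)).
by apply/funext => w; rewrite !fctE /csq !expr2.
Qed.

Lemma open_nsq (r : R) : open ([set z | nsq z < r] : set V).
Proof.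
rewrite openE => z /= zr.
have oo : open_nbhs (nsq z) [set y | y < r] by split => //; exact: open_lt.
exact: (@nsq_cont z _ (open_nbhs_nbhs oo)).
Qed.

Lemma compact_nsq (r : R) : compact ([set z | nsq z <= r] : set V).
Proof.
(* Half-side [r + 1], because a square at most [r] forces a modulus at most [r + 1], whether [r] is
   below or above 1. *)
pose A : set (R[i]^o) := (fun p : R * R => (p.1 +i* p.2 : R[i]^o)) @` (`[- (r + 1), r + 1] `*` `[- (r + 1), r + 1]).
have cA : compact A.
  apply: continuous_compact; last by apply: compact_setX; exact: segment_compact.
  apply: continuous_subspaceT => p.
  apply/cvgrPdist_lt => e e0.
  have ee : e = (complex.Re e)%:C by apply/realC_ge0/ltW.
  have e1 : 0 < complex.Re e / 2 by rewrite divr_gt0// -ltcR -ee.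
  exists (ball p.1 (complex.Re e / 2), ball p.2 (complex.Re e / 2)).
    by split; exact: nbhsx_ballx.
  move=> q [] /=; rewrite /ball /= => h1 h2.
  rewrite ee normC ltcR (le_lt_trans (cabs_le_ReIm _))//= [ltRHS]splitr ltrD//.
have cK : compact [set v : 'rV[R[i]^o]_n | forall i, A (v ord0 i)].
  by apply: (@rV_compact R[i]^o n (fun=> A)) => i.
apply: (subclosed_compact _ cK).
  rewrite (_ : [set z | nsq z <= r] = (@nsq R n : V -> R) @^-1` [set y | y <= r])//.
  apply: preimage_closed; last exact: closed_le.
  by move=> z _; exact: nsq_cont.
move=> z /= zr j; exists (complex.Re (z ord0 j), complex.Im (z ord0 j)); last by case: (z ord0 j).
have h : csq (z ord0 j) <= r.
  by apply: le_trans zr; rewrite /nsq (bigD1 j)//= lerDl sumr_ge0// => k _; exact: csq_ge0.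
have r0 : 0 <= r := le_trans (csq_ge0 _) h.
have sq (u : R) : u ^+ 2 <= r -> - (r + 1) <= u <= r + 1.
  move=> ur; rewrite -ler_norml -(@ler_sqr _ `|u|) ?nnegrE ?addr_ge0// real_normK ?num_real//.
  rewrite (le_trans ur)// sqrrD1; have := sqr_ge0 r; move: (r ^+ 2) => r2 r20.
  by rewrite mulr2n; lra.
by split => /=; rewrite in_itv /=; apply: sq; apply: le_trans h; rewrite ?lerDl ?lerDr sqr_ge0.
Qed.
End RowTopology.

Section InvScale.
Variable R : realType.
Variable V : normedModType R[i].

Lemma inv_scale_cont (g : V -> R) (z : V) : {for z, continuous g} -> g z != 0 ->
  {for z, continuous (fun w => (g w)^-1%:C *: w)}.
Proof.
move=> cg g0.
have h1 : {for z, continuous (fun w : V => (g w)^-1)} by apply: cvgV.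
apply: (@continuousZ _ _ _ (fun w : V => ((g w)^-1%:C : R[i]^o)) id z); last exact: cvg_id.
apply/cont_eps => e e0.
have /cvgrPdist_lt /(_ e e0) /near_eps[d d0 dP] := h1.
by exists d => // w /dP; rewrite vabsC -rmorphB /= cabs_real distrC.
Qed.

Lemma sqrt_cont (g : V -> R) (z : V) : {for z, continuous g} ->
  {for z, continuous (fun w => Num.sqrt (g w))}.
Proof. by move=> cg; apply: continuous_comp => //; exact: sqrt_continuous. Qed.
End InvScale.

(** * Unitary matrices and the surface measure *)

Section Unitary.
Variable R : realType.
Variable n : nat.
Local Notation V := ('rV[R[i]]_n : normedModType R[i]).

Definition adjmx m k (U : 'M[R[i]]_(m, k)) : 'M[R[i]]_(k, m) := map_mx conjc U^T.

Definition unitary (U : 'M[R[i]]_n) := U *m adjmx U = 1%:M.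

Lemma adjmxM m k l (U : 'M[R[i]]_(m, k)) (W : 'M[R[i]]_(k, l)) :
  adjmx (U *m W) = adjmx W *m adjmx U.
Proof. by rewrite /adjmx trmx_mul map_mxM. Qed.

Lemma adjmxK m k (U : 'M[R[i]]_(m, k)) : adjmx (adjmx U) = U.
Proof. by apply/matrixP => i j; rewrite !mxE conjcK. Qed.

Lemma unitary_adj U : unitary U -> unitary (adjmx U).
Proof. by rewrite /unitary adjmxK => /mulmx1C. Qed.

Lemma nsqE (z : 'rV[R[i]]_n) : (nsq z)%:C = (z *m adjmx z) ord0 ord0.
Proof.
rewrite /nsq rmorph_sum /= mxE; apply: eq_bigr => j _.
by rewrite !mxE csq_cabs.
Qed.

Lemma nsq_unitary U (z : 'rV[R[i]]_n) : unitary U -> nsq (z *m U) = nsq z.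
Proof.
move=> uU; apply: realC_inj; rewrite /= !nsqE adjmxM -mulmxA (mulmxA U) uU mul1mx//.
Qed.

Lemma cvec_add (x y : cpt R n) : cvec (cadd x y) = cvec x + cvec y.
Proof. by apply/rowP => j; rewrite !mxE tnth_mktuple /=; simpc; rewrite addrC [X in _ +i* X]addrC. Qed.

Lemma cvec_opp (x : cpt R n) : cvec (copp x) = - cvec x.
Proof. by apply/rowP => j; rewrite !mxE tnth_mktuple /=; simpc. Qed.

Lemma cvec_inj : injective (@cvec R n).
Proof. by move=> z w /(congr1 (@cptv R n)); rewrite !cvecK. Qed.

Definition umap (U : 'M[R[i]]_n) (x : cpt R n) : cpt R n := cptv (cvec x *m U).

Lemma cvec_umap U x : cvec (umap U x) = cvec x *m U.
Proof. exact: cptvK. Qed.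

Lemma lin_cont (c : 'I_n -> R[i]) (z : V) :
  {for z, continuous (fun w : V => (\sum_k w ord0 k * c k : R[i]^o))}.
Proof.
apply/cont_eps => e e0.
pose K := \sum_k cabs (c k) + 1.
have K0 : 0 < K by rewrite ltr_wpDl ?sumr_ge0// => k _; exact: cabs_ge0.
exists (e / K); first by rewrite divr_gt0.
move=> w; rewrite ltr_pdivlMr// => we; apply: le_lt_trans we.
rewrite vabsC -sumrB (le_trans (cabs_sum _ _ _))// mulrDr mulr1.
rewrite ler_wpDr ?vabs_ge0// mulr_sumr; apply: ler_sum => k _.
rewrite -mulrBl cabsM ler_wpM2r ?cabs_ge0//.
by have := coord_le_vabs (w - z) k; rewrite !mxE.
Qed.

Lemma measurable_umap U : measurable_fun setT (umap U).
Proof.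
apply/measurable_fun_tnthP => j.
rewrite (_ : _ \o _ = fun x : cpt R n =>
   (complex.Re (\sum_k cvec x ord0 k * U k j), complex.Im (\sum_k cvec x ord0 k * U k j))); last first.
  by apply/funext => x; rewrite /= tnth_mktuple mxE.
apply/measurable_fun_pair.
  apply: (@cont_measurable R n setT (fun z => complex.Re (\sum_k z ord0 k * U k j))) => //.
  - exact: openT.
  - by move=> z _; apply: Re_cont; exact: lin_cont.
apply: (@cont_measurable R n setT (fun z => complex.Im (\sum_k z ord0 k * U k j))) => //.
- exact: openT.
- by move=> z _; apply: Im_cont; exact: lin_cont.
Qed.

Lemma vol_umap U (A : set (cpt R n)) : unitary U -> measurable A ->
  vol R n (umap U @^-1` A) = vol R n A.
Proof.
move=> uU mA; apply: (@vol_isometry R n (umap U) (umap (adjmx U))) => //.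
- exact: measurable_umap.
- by move=> x y; apply: cvec_inj; rewrite cvec_umap !cvec_add !cvec_umap mulmxDl.
- by move=> x; apply: cvec_inj; rewrite cvec_umap !cvec_opp cvec_umap mulNmx.
- move=> y; apply: cvec_inj; rewrite !cvec_umap -mulmxA.
  by have := unitary_adj uU; rewrite /unitary adjmxK => ->; rewrite mulmx1.
- by move=> x; rewrite cvec_umap nsq_unitary.
Qed.

Lemma cvec_cdir (x : cpt R n) : cvec (cdir x) = (Num.sqrt (nsq (cvec x)))^-1%:C *: cvec x.
Proof.
apply/rowP => j; rewrite !mxE tnth_mktuple /=; simpc.
by congr (_ +i* _); rewrite mulrC.
Qed.

Lemma umap_cdir U x : unitary U -> umap U (cdir x) = cdir (umap U x).
Proof.
move=> uU; apply: cvec_inj; rewrite cvec_umap !cvec_cdir cvec_umap nsq_unitary//.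
by rewrite scalemxAl.
Qed.

(** The ball has positive finite volume, so the Dirac default of [mnormalize] is discarded and
    [sigma] is the normalized volume of a cone. *)
Lemma sigmaE (A : set (cpt R n)) : measurable A ->
  sigma R n A = (vol R n (@cdir R n @^-1` A `&` @cvec R n @^-1` @cball R n)
     * ((fine (vol R n (@cvec R n @^-1` @cball R n)))^-1)%:E)%E.
Proof.
move=> mA; rewrite /sigma /distribution /pushforward /=.
rewrite /mnormalize /= /mrestr setTI.
have := vol_cball_gt0 R n; have := vol_cball_fin R n.
by case: ifPn => // /orP[/eqP ->|/eqP ->]; rewrite ltxx.
Qed.

Lemma sigma_umap U (A : set (cpt R n)) : unitary U -> measurable A ->
  sigma R n (umap U @^-1` A) = sigma R n A.
Proof.
move=> uU mA.
have mUA : measurable (umap U @^-1` A).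
  by rewrite -[X in measurable X]setTI; exact: measurable_umap.
have mcA : measurable (@cdir R n @^-1` A).
  by rewrite -[X in measurable X]setTI; exact: measurable_cdir.
rewrite !sigmaE//; congr (_ * _)%E.
rewrite -[RHS](vol_umap uU); last by apply: measurableI => //; exact: measurable_cball.
congr (vol R n _); apply/seteqP; split => x /=; rewrite umap_cdir// /cball /= cvec_umap nsq_unitary//.
Qed.

Lemma csqM (a b : R[i]) : csq (a * b) = csq a * csq b.
Proof. by rewrite -!cabs_sqr cabsM exprMn. Qed.

Lemma csq_real (k : R) : csq k%:C = k ^+ 2.
Proof. by rewrite -cabs_sqr cabs_real real_normK ?num_real. Qed.

Lemma nsqZ (c : R[i]) (z : 'rV[R[i]]_n) : nsq (c *: z) = csq c * nsq z.
Proof. by rewrite /nsq mulr_sumr; apply: eq_bigr => j _; rewrite mxE csqM. Qed.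

Lemma cdir_sphere (x : cpt R n) : nsq (cvec x) != 0 -> csphere (cdir x).
Proof.
move=> x0; have xp : 0 < nsq (cvec x) by rewrite lt_def x0 nsq_ge0.
by rewrite /csphere /= cvec_cdir nsqZ csq_real exprVn sqr_sqrtr ?ltW// mulVf.
Qed.

Lemma nsq_eq0 (z : 'rV[R[i]]_n) : nsq z = 0 -> z = 0.
Proof.
move=> z0; apply/rowP => j; rewrite mxE; apply/eqP.
rewrite -cabs_eq0 -sqrf_eq0 cabs_sqr; apply/eqP/le_anti.
rewrite csq_ge0 andbT -z0 /nsq (bigD1 j)//= lerDl sumr_ge0// => k _; exact: csq_ge0.
Qed.

Definition dirv (z : V) : V := (Num.sqrt (nsq z))^-1%:C *: z.

Lemma dirv_cont (z : V) : nsq z != 0 -> {for z, continuous dirv}.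
Proof.
move=> z0; have zp : 0 < nsq z by rewrite lt_def z0 nsq_ge0.
apply: (@inv_scale_cont R V (fun w => Num.sqrt (nsq w))).
  by apply: sqrt_cont; exact: nsq_cont.
by rewrite gt_eqF// sqrtr_gt0.
Qed.
End Unitary.

Lemma near_comp (R : realType) (V : normedModType R[i]) (g : V -> V) (z : V) (P Q : set V) :
  {for z, continuous g} -> (\forall w \near g z, P w) -> (\forall w \near z, Q w) ->
  \forall w \near z, P (g w) /\ Q w.
Proof. by move=> cg hP hQ; apply: filterI => //; exact: cg. Qed.

Lemma nbhs_sub (R : realType) (V : normedModType R[i]) (z : V) (A B : set V) :
  A `<=` B -> nbhs z A -> nbhs z B.
Proof. exact: filterS. Qed.

Section Sphere.
Variable R : realType.
Variable n : nat.
Hypothesis n0 : (0 < n)%N.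
Local Notation V := ('rV[R[i]]_n : normedModType R[i]).
Local Notation mu := (sigma R n).
Local Notation S := (@csphere R n).

Lemma measurable_csphere : measurable S.
Proof.
rewrite (_ : S = (@nsq R n \o @cvec R n) @^-1` [set 1])//.
by rewrite -[X in measurable X]setTI; apply: measurable_fun_nsq.
Qed.

(** Only the origin has its direction off the sphere, division by 0 giving 0, and the origin lies in
    boxes of arbitrarily small volume. *)
Lemma sigma_csphere : mu S = 1%E.
Proof.
have mS := measurable_csphere.
suff h : mu (~` S) = 0%E.
  have := @probability_setT _ _ _ mu; rewrite -(setUv S) measureU//; last first.
  - by rewrite setICr.
  - exact: measurableC.
  by move=> <-; rewrite [X in _ = (_ + X)%E]h adde0.
have mN : measurable (@cdir R n @^-1` (~` S) `&` @cvec R n @^-1` @cball R n).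
  apply: measurableI; last exact: measurable_cball.
  by rewrite -[X in measurable X]setTI; apply: measurable_cdir => //; exact: measurableC.
rewrite sigmaE; last exact: measurableC.
suff -> : vol R n (@cdir R n @^-1` (~` S) `&` @cvec R n @^-1` @cball R n) = 0%E by rewrite mul0e.
apply/eqP; rewrite eq_le measure_ge0 andbT.
apply/lee_addgt0Pr => e e0; rewrite add0e.
(* With [2 * e1] at most 1 and at most [e], its power [2 * n] is at most [e] as well. *)
pose e1 := Num.min (1 / 2) (e / 2).
have e10 : 0 < e1 by rewrite lt_min !divr_gt0.
have [mB vB] := vol_cbox (czero R n) e10.
apply: (@le_trans _ _ (vol R n (cbox (czero R n) e1))).
  rewrite le_measure ?inE// => x [/= xS _] j.
  have x0 : nsq (cvec x) = 0 by apply/eqP; apply: contraPT xS => /cdir_sphere xS; exact.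
  have /rowP/(_ j) := nsq_eq0 x0; rewrite !mxE tnth_mktuple /= !subr0 => -[-> ->].
  by rewrite normr0.
rewrite vB lee_fin.
have h1 : 2 * e1 <= 1 by rewrite -ler_pdivlMl// mulrC ge_min lexx.
have h2 : 2 * e1 <= e by rewrite -ler_pdivlMl// mulrC ge_min lexx orbT.
rewrite (le_trans _ h2)// -(prednK (n := 2 * n)%N) ?muln_gt0// exprS -[leRHS]mulr1.
by rewrite ler_wpM2l ?exprn_ile1// mulr_ge0// ltW.
Qed.

(** The cone over a neighbourhood of [z] contains a box around [z / 2], a point inside the ball with
    direction [z]. The set [N] is any measurable set containing the trace of the neighbourhood on
    the sphere. *)
Lemma sigma_pos (P : set V) (z : V) (N : set (cpt R n)) : nsq z = 1 ->
  (\forall w \near z, P w) -> measurable N ->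
  (forall x, S x -> P (cvec x) -> N x) -> (0 < mu N)%E.
Proof.
move=> z1 zP mN PN.
have z0 : nsq ((2^-1)%:C *: z) = 4^-1.
  by rewrite nsqZ csq_real z1 mulr1 exprVn -natrX.
have dz : dirv ((2^-1)%:C *: z) = z.
  rewrite /dirv z0 scalerA -rmorphM /=.
  rewrite (_ : 4^-1 = 2^-1 ^+ 2 :> R); last by rewrite exprVn -natrX.
  by rewrite sqrtr_sqr gtr0_norm// invrK divff// scale1r.
have zn0 : nsq ((2^-1)%:C *: z) != 0 by rewrite z0 invr_eq0.
have near1 : \forall w \near ((2^-1)%:C *: z : V), 0 < nsq w < 1.
  have oo : open_nbhs (nsq ((2^-1)%:C *: z)) (`]0, 1[%classic : set R).
    split; first exact: interval_open.
    by rewrite /= in_itv /= z0 invr_gt0 ltr0n invf_lt1// ltr1n.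
  have := @nsq_cont R n ((2^-1)%:C *: z) _ (open_nbhs_nbhs oo).
  by apply: (@nbhs_sub R V) => w; rewrite /= in_itv.
have near2 := near_comp (dirv_cont zn0) (eq_ind_r (fun u : V => \forall w \near u, P w) zP dz) near1.
have [e e0 eP] := near_box near2.
have mcN : measurable (@cdir R n @^-1` N `&` @cvec R n @^-1` @cball R n).
  apply: measurableI; last exact: measurable_cball.
  by rewrite -[X in measurable X]setTI; exact: measurable_cdir.
rewrite sigmaE// mule_gt0//; last first.
  rewrite lte_fin invr_gt0 fine_gt0// vol_cball_gt0 vol_cball_fin//.
have [mB vB] := vol_cbox (cptv ((2^-1)%:C *: z)) e0.
apply: (@lt_le_trans _ _ (vol R n (cbox (cptv ((2^-1)%:C *: z)) e))).
  by rewrite vB lte_fin exprn_gt0// mulr_gt0.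
rewrite le_measure ?inE// => x /eP[Px /andP[x0 x1]]; split => //=.
apply: PN; first by apply: cdir_sphere; rewrite gt_eqF.
by rewrite cvec_cdir.
Qed.
End Sphere.

(** * Integration over the sphere *)

Section SphereIntegral.
Variable R : realType.
Variable n : nat.
Hypothesis n0 : (0 < n)%N.
Local Notation mu := (sigma R n).
Local Notation S := (@csphere R n).
Implicit Types (F G : cpt R n -> R[i]).

Definition cmeas F := measurable_fun S (fun x => complex.Re (F x)) /\
  measurable_fun S (fun x => complex.Im (F x)).

Definition bdd F := exists M : R, forall x, S x -> cabs (F x) <= M.

Definition cintegrable F := mu.-integrable S (EFin \o (fun x => complex.Re (F x))) /\
  mu.-integrable S (EFin \o (fun x => complex.Im (F x))).

Let mS : measurable S := @measurable_csphere R n.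

Lemma bdd_integrable (f : cpt R n -> R) (M : R) : measurable_fun S f ->
  (forall x, S x -> `|f x| <= M) -> mu.-integrable S (EFin \o f).
Proof.
move=> mf fM; apply: (@le_integrable _ _ _ mu S mS _ (EFin \o (fun=> M))).
- exact/measurable_EFinP.
- by move=> x Sx /=; rewrite lee_fin (le_trans (fM x Sx))// ler_norm.
- apply: finite_measure_integrable_cst => //.
Qed.

Lemma cmeas_bdd F : cmeas F -> bdd F -> cintegrable F.
Proof.
move=> [mr mi] [M FM]; split; apply: (@bdd_integrable _ M) => // x Sx.
  exact: le_trans (Re_le_cabs _) (FM x Sx).
exact: le_trans (Im_le_cabs _) (FM x Sx).
Qed.

Lemma cmeas_cst k : cmeas (fun=> k).
Proof. by split; exact: measurable_cst. Qed.

Lemma cmeasD F G : cmeas F -> cmeas G -> cmeas (fun x => F x + G x).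
Proof.
move=> [Fr Fi] [Gr Gi]; split.
  rewrite (_ : (fun x => _) = fun x => complex.Re (F x) + complex.Re (G x)).
    exact: measurable_funD.
  by apply/funext => x; rewrite raddfD.
rewrite (_ : (fun x => _) = fun x => complex.Im (F x) + complex.Im (G x)).
  exact: measurable_funD.
by apply/funext => x; rewrite raddfD.
Qed.

Lemma cmeasM F G : cmeas F -> cmeas G -> cmeas (fun x => F x * G x).
Proof.
move=> [Fr Fi] [Gr Gi]; split.
  rewrite (_ : (fun x => _) = fun x => complex.Re (F x) * complex.Re (G x) - complex.Im (F x) * complex.Im (G x)).
    by apply: measurable_funB; apply: measurable_funM.
  by apply/funext => x; rewrite ReM.
rewrite (_ : (fun x => _) = fun x => complex.Re (F x) * complex.Im (G x) + complex.Im (F x) * complex.Re (G x)).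
  by apply: measurable_funD; apply: measurable_funM.
by apply/funext => x; rewrite ImM.
Qed.

Lemma cmeas_conj F : cmeas F -> cmeas (fun x => conjc (F x)).
Proof.
move=> [Fr Fi]; split.
  by rewrite (_ : (fun x => _) = fun x => complex.Re (F x))//; apply/funext => x; case: (F x).
rewrite (_ : (fun x => _) = fun x => - complex.Im (F x)); last by apply/funext => x; case: (F x).
exact: measurableT_comp.
Qed.

Lemma cmeas_sum (I : Type) (r : seq I) (F : I -> cpt R n -> R[i]) :
  (forall i, cmeas (F i)) -> cmeas (fun x => \sum_(i <- r) F i x).
Proof.
move=> mF; elim: r => [|i r IH].
  rewrite (_ : (fun x => _) = fun=> 0); first exact: cmeas_cst.
  by apply/funext => x; rewrite big_nil.
rewrite (_ : (fun x => _) = fun x => F i x + \sum_(i <- r) F i x); first exact: cmeasD.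
by apply/funext => x; rewrite big_cons.
Qed.

Lemma cmeasX F k : cmeas F -> cmeas (fun x => F x ^+ k).
Proof.
move=> mF; elim: k => [|k IH]; first exact: cmeas_cst.
rewrite (_ : (fun x => _) = fun x => F x * F x ^+ k); first exact: cmeasM.
by apply/funext => x; rewrite exprS.
Qed.

Lemma bdd_cst k : bdd (fun=> k). Proof. by exists (cabs k). Qed.

Lemma bddD F G : bdd F -> bdd G -> bdd (fun x => F x + G x).
Proof.
move=> [M hM] [N hN]; exists (M + N) => x Sx.
by rewrite (le_trans (cabsD _ _))// lerD ?hM ?hN.
Qed.

Lemma bddM F G : bdd F -> bdd G -> bdd (fun x => F x * G x).
Proof.
move=> [M hM] [N hN]; exists (M * N) => x Sx.
by rewrite cabsM ler_pM ?cabs_ge0 ?hM ?hN.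
Qed.

Lemma bdd_conj F : bdd F -> bdd (fun x => conjc (F x)).
Proof. by move=> [M hM]; exists M => x Sx; rewrite cabs_conj hM. Qed.

Lemma bddX F k : bdd F -> bdd (fun x => F x ^+ k).
Proof. by move=> [M hM]; exists (M ^+ k) => x Sx; rewrite cabsX lerXn2r ?nnegrE ?cabs_ge0 ?hM// (le_trans (cabs_ge0 _) (hM x Sx)). Qed.

Lemma bdd_sum (I : Type) (r : seq I) (F : I -> cpt R n -> R[i]) :
  (forall i, bdd (F i)) -> bdd (fun x => \sum_(i <- r) F i x).
Proof.
move=> bF; elim: r => [|i r IH].
  by exists 0 => x _; rewrite big_nil cabs0.
have [M hM] := bddD (bF i) IH; exists M => x Sx; rewrite big_cons; exact: hM.
Qed.

Lemma eq_cintegral F G : (forall x, S x -> F x = G x) -> cintegral F = cintegral G.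
Proof.
by move=> FG; congr (_ +i* _); apply: eq_Rintegral => x; rewrite inE => /FG ->.
Qed.

Lemma cintegrableD F G : cintegrable F -> cintegrable G -> cintegrable (fun x => F x + G x).
Proof.
move=> [Fr Fi] [Gr Gi]; split.
  have := integrableD mS Fr Gr; apply: eq_integrable => // x _ /=.
  by rewrite raddfD.
have := integrableD mS Fi Gi; apply: eq_integrable => // x _ /=.
by rewrite raddfD.
Qed.

Lemma cintegralD F G : cintegrable F -> cintegrable G ->
  cintegral (fun x => F x + G x) = cintegral F + cintegral G.
Proof.
move=> [Fr Fi] [Gr Gi]; rewrite /cintegral; simpc; rewrite -!RintegralD//.
by congr (_ +i* _); apply: eq_Rintegral => x _; rewrite raddfD.
Qed.

Lemma cintegrableZ k F : cintegrable F -> cintegrable (fun x => k * F x).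
Proof.
move=> [Fr Fi]; split.
  have := integrableD mS (integrableZl mS (complex.Re k) Fr) (integrableZl mS (- complex.Im k) Fi).
  by apply: eq_integrable => // x _ /=; rewrite ReM -EFinM -EFinM -EFinD mulNr.
have := integrableD mS (integrableZl mS (complex.Re k) Fi) (integrableZl mS (complex.Im k) Fr).
by apply: eq_integrable => // x _ /=; rewrite ImM -EFinM -EFinM -EFinD.
Qed.

Lemma cintegralZ k F : cintegrable F -> cintegral (fun x => k * F x) = k * cintegral F.
Proof.
move=> [Fr Fi]; case: k => k l; rewrite /cintegral; simpc; rewrite -mulNr -!RintegralZl//.
rewrite -!RintegralD//; try (by have := integrableZl mS k Fr); try (by have := integrableZl mS k Fi);
  try (by have := integrableZl mS l Fr); try (by have := integrableZl mS (- l) Fi).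
by congr (_ +i* _); apply: eq_Rintegral => x _; rewrite (ReM, ImM) ?mulNr.
Qed.

Lemma cintegral_conj F : cintegrable F -> cintegral (fun x => conjc (F x)) = conjc (cintegral F).
Proof.
move=> [Fr Fi]; rewrite /cintegral /=; congr (_ +i* _).
  by apply: eq_Rintegral => x _; case: (F x).
rewrite -mulN1r -RintegralZl//; apply: eq_Rintegral => x _; case: (F x) => a b /=.
by rewrite mulN1r.
Qed.

Lemma cintegral_cst k : @cintegral R n (fun=> k) = k.
Proof.
case: k => k l; rewrite /cintegral /= !Rintegral_cst//.
by have := sigma_csphere R n0 => /= ->; rewrite !mulr1.
Qed.

Lemma cintegral_le F (g : cpt R n -> R) : cintegrable F -> mu.-integrable S (EFin \o g) ->
  (forall x, S x -> cabs (F x) <= g x) ->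
  cabs (cintegral F) <= 2 * \int[mu]_(x in S) g x.
Proof.
move=> [Fr Fi] gi Fg; rewrite (le_trans (cabs_le_ReIm _))//= mulrDl mul1r.
by rewrite lerD// (le_trans (le_normr_Rintegral mS _))//;
  apply: le_Rintegral => //; try exact: integrable_norm; move=> x /Fg; apply: le_trans;
  rewrite (Re_le_cabs, Im_le_cabs).
Qed.

Lemma cintegral_bound F (M : R) : cmeas F -> (forall x, S x -> cabs (F x) <= M) ->
  cabs (cintegral F) <= 2 * M.
Proof.
move=> mF FM; have FI : cintegrable F by apply: cmeas_bdd => //; exists M.
rewrite (le_trans (cintegral_le FI _ FM))//.
  exact: finite_measure_integrable_cst.
rewrite Rintegral_cst//; have /= -> := sigma_csphere R n0.
by rewrite mulr1.
Qed.

Lemma csphere_umap U x : unitary U -> S (umap U x) <-> S x.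
Proof. by move=> uU; rewrite /csphere /= cvec_umap nsq_unitary. Qed.

Lemma Rintegral_umap U (f : cpt R n -> R) : unitary U -> measurable_fun S f ->
  (exists M : R, forall x, S x -> `|f x| <= M) ->
  \int[mu]_(x in S) f (umap U x) = \int[mu]_(x in S) f x.
Proof.
move=> uU mf [M fM]; have mU := @measurable_umap R n U.
have mf' : measurable_fun setT (f \_ S) by apply/(measurable_restrictT f mS).
rewrite (Rintegral_mkcond mu S (fun x => f (umap U x))) (Rintegral_mkcond mu S f) /Rintegral; congr fine.
rewrite (_ : (fun x => (((fun x => f (umap U x)) \_ S) x)%:E) = (EFin \o (f \_ S)) \o umap U); last first.
  apply/funext => x /=; rewrite !patchE; congr (_%:E).
  by rewrite (_ : (x \in S) = (umap U x \in S))//; apply/idP/idP; rewrite !inE => /(csphere_umap x uU).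
rewrite -(@integral_pushforward _ _ _ _ R (umap U) (mU) mu setT (EFin \o (f \_ S)))//.
- by apply: eq_measure_integral => A mA _; exact: sigma_umap.
- exact/measurable_EFinP.
- apply: (@le_integrable _ _ _ mu setT measurableT _ (EFin \o (fun=> `|M|))).
  + by apply/measurable_EFinP; apply: measurableT_comp.
  + move=> x _ /=; rewrite lee_fin patchE; case: ifPn => [|_]; last by rewrite normr0.
    rewrite inE => Sx; rewrite (le_trans (fM _ Sx))// normr_id ler_norm//.
  + exact: finite_measure_integrable_cst.
Qed.

Lemma cintegral_umap U F : unitary U -> cmeas F -> bdd F ->
  cintegral (fun x => F (umap U x)) = cintegral F.
Proof.
move=> uU [Fr Fi] [M FM]; rewrite /cintegral; congr (_ +i* _).
  apply: (@Rintegral_umap U (fun x => complex.Re (F x))) => //.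
  by exists M => x /FM; apply: le_trans; exact: Re_le_cabs.
apply: (@Rintegral_umap U (fun x => complex.Im (F x))) => //.
by exists M => x /FM; apply: le_trans; exact: Im_le_cabs.
Qed.

Lemma cintegral_sum (I : Type) (r : seq I) (F : I -> cpt R n -> R[i]) :
  (forall i, cintegrable (F i)) ->
  cintegrable (fun x => \sum_(i <- r) F i x) /\
  cintegral (fun x => \sum_(i <- r) F i x) = \sum_(i <- r) cintegral (F i).
Proof.
move=> mF; elim: r => [|i r [IH1 IH2]].
  rewrite big_nil (_ : (fun x => _) = fun=> 0); last by apply/funext => x; rewrite big_nil.
  split; last exact: cintegral_cst.
  by apply: cmeas_bdd; [exact: cmeas_cst|exact: bdd_cst].
rewrite (_ : (fun x => _) = fun x => F i x + \sum_(i <- r) F i x); last first.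
  by apply/funext => x; rewrite big_cons.
by split; [exact: cintegrableD|rewrite cintegralD// IH2 big_cons].
Qed.
End SphereIntegral.

(** * The reproducing formula *)

Section CompactBound.
Variable R : realType.
Variable V : normedModType R[i].

Lemma compact_bound (F : V -> R[i]) (K : set V) : compact K ->
  (forall z, K z -> {for z, continuous (F : V -> R[i]^o)}) ->
  exists M : R, forall z, K z -> cabs (F z) <= M.
Proof.
move=> cK cF; have [[z0 Kz0]|K0] := pselect (K !=set0); last first.
  by exists 0 => z Kz; exfalso; apply: K0; exists z.
have cf : {within K, continuous (fun z => cabs (F z))}.
  by apply: continuous_in_subspaceT => z; rewrite inE => /cF cz; exact: cabs_cont.
have [c _ cP] := compact_EVT_max (ex_intro _ z0 Kz0) cK cf.
by exists (cabs (F c)) => z Kz; apply: cP; rewrite inE.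
Qed.

Lemma vabsZ (h : R[i]) (b : V) : vabs (h *: b) = cabs h * vabs b.
Proof. by apply: (@realC_inj R); rewrite -normV normrZ normC normV -rmorphM. Qed.

Lemma cdiff_line (g : V -> R[i]^o) (a b : V) (l : R[i]) :
  differentiable g (a + l *: b) -> cdiff (fun l => g (a + l *: b)) l.
Proof.
move=> /diff_eps dg; exists ('d g (a + l *: b) b) => e e0.
have K0 : 0 < vabs b + 1 by rewrite ltr_wpDl ?vabs_ge0.
have [r r0 rP] := dg _ (divr_gt0 e0 K0).
exists (r / (vabs b + 1)); first by rewrite divr_gt0.
move=> h; rewrite ltr_pdivlMr// => hr.
have hb : cabs h * vabs b <= cabs h * (vabs b + 1) by rewrite ler_wpM2l ?cabs_ge0// lerDl.
have := rP (h *: b); rewrite vabsZ => /(_ (le_lt_trans hb hr)).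
have e1 : (a + l *: b) + h *: b = a + (l + h) *: b by rewrite scalerDl addrA.
rewrite e1 linearZ vabsC [X in cabs (_ - _ - X)]mulrC => /le_trans; apply.
rewrite mulrAC ler_pdivrMr// -mulrA ler_wpM2l ?(ltW e0)//.
Qed.
End CompactBound.

(** * Averages over roots of unity *)

Section Averages.
Variable R : realType.

Lemma small_pow (r K e : R) : 1 < r -> 0 < e -> exists2 N, (0 < N)%N & K / r ^+ N <= e.
Proof.
move=> r1 e0; have r10 : 0 < r - 1 by rewrite subr_gt0.
have bern m : 1 + m%:R * (r - 1) <= r ^+ m.
  elim: m => [|m IH]; first by rewrite mul0r addr0 expr0.
  rewrite exprS (@le_trans _ _ (r * (1 + m%:R * (r - 1))))//; last by rewrite ler_wpM2l// ltW// (lt_trans _ r1).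
  rewrite -natr1 -subr_ge0 (_ : _ - _ = m%:R * (r - 1) ^+ 2); last by ring.
  by rewrite mulr_ge0// sqr_ge0.
pose N := (Num.truncn (K / e / (r - 1))).+1.
exists N => //; have rN : 0 < r ^+ N by rewrite exprn_gt0// (lt_trans _ r1).
rewrite ler_pdivrMr// mulrC -ler_pdivrMr// (le_trans _ (bern N))//.
rewrite ler_wpDl// -ler_pdivrMr// ltW//; exact: truncnS_gt.
Qed.

Definition rootu (N : nat) : R[i] := cexp (0 +i* (2 * pi / N%:R)).

Lemma cabs_rootu N : cabs (rootu N) = 1.
Proof. by rewrite cabs_cexp expR0. Qed.

Lemma rootuX N d : rootu N ^+ d = cexp (0 +i* (2 * pi / N%:R * d%:R)).
Proof.
elim: d => [|d IH]; first by rewrite mulr0 /cexp /= expR0 cos0 sin0 mul1r.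
by rewrite exprS IH -cexpD; congr cexp; rewrite -natr1; simpc; congr (_ +i* _); ring.
Qed.

Lemma rootuN N : (0 < N)%N -> rootu N ^+ N = 1.
Proof.
move=> N0; rewrite rootuX divfK ?pnatr_eq0 -?lt0n// /cexp /= expR0 mul1r.
by rewrite mulrC mulr_natr cos2pi sin2pi.
Qed.

Lemma rootu_neq1 N d : (0 < d < N)%N -> rootu N ^+ d != 1.
Proof.
move=> /andP[d0 dN]; have N0 : 0 < N%:R :> R by rewrite ltr0n (leq_trans _ dN).
have pi0 := pi_gt0 R.
rewrite rootuX; apply/eqP => h.
have e1 : cexp (0 : R[i]) = 1 by rewrite /cexp /= expR0 cos0 sin0 mul1r.
rewrite -e1 in h.
have q1 : d%:R / N%:R < 1 :> R by rewrite ltr_pdivrMr// mul1r ltr_nat.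
have yE : 2 * pi / N%:R * d%:R = 2 * pi * (d%:R / N%:R) :> R by ring.
have y1 : `|complex.Im (0 +i* (2 * pi / N%:R * d%:R)) - complex.Im (0 : R[i])| < 2 * pi.
  rewrite /= subr0 yE ger0_norm ?mulr_ge0 ?invr_ge0 ?(ltW N0) ?(ltW pi0)//.
  by rewrite -[ltRHS]mulr1 ltr_pM2l ?mulr_gt0.
have /(congr1 (@complex.Im R)) /= := cexp_inj y1 h.
rewrite yE => /eqP; rewrite gt_eqF// !mulr_gt0 ?invr_gt0// ltr0n//.
Qed.

Lemma sum_rootu N d : (0 < d < N)%N -> \sum_(j < N) (rootu N ^+ j) ^+ d = 0.
Proof.
move=> dN; have h : rootu N ^+ d - 1 != 0 by rewrite subr_eq0 rootu_neq1.
apply: (mulfI h); rewrite mulr0.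
rewrite (eq_bigr (fun j : 'I_N => (rootu N ^+ d) ^+ j)); last first.
  by move=> j _; rewrite -!exprM mulnC.
rewrite -subrX1 -exprM mulnC exprM rootuN ?expr1n ?subrr//.
by case/andP: dN => d0; apply: leq_trans.
Qed.

(** The average annihilates the Taylor monomials of degrees 1 to [N - 1]. The Taylor error counts
    twice, once in the average and once in [f 0 - c 0]. Being a finite sum, the average commutes
    with integrals over the sphere by linearity alone. *)
Lemma avg_rootu (f : R[i] -> R[i]) (R0 r M : R) (N : nat) :
  1 < r -> r < R0 -> (forall w, cabs w < R0 -> cdiff f w) ->
  (forall w, cabs w <= r -> cabs (f w) <= M) -> (0 < N)%N ->
  cabs (N%:R^-1 * (\sum_(j < N) f (rootu N ^+ j)) - f 0) <= 2 * (4 * M * (r / (r - 1)) / r ^+ N).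
Proof.
move=> r1 rR df fM N0; have [c cP] := taylor r1 rR df.
have {}cP := cP M fM N N0; set K := 4 * M * _ / _ in cP *.
have Nn : N%:R != 0 :> R[i] by rewrite pnatr_eq0 -lt0n.
have c0 : cabs (f 0 - c 0%N) <= K.
  have := cP 0; rewrite cabs0 ler01 => /(_ isT).
  move: N0 => /prednK <-; rewrite big_ord_recl expr0 mul1r big1 ?addr0// => i _.
  by rewrite expr0n mul0r.
have e1 : N%:R^-1 * (\sum_(j < N) \sum_(d < N) (rootu N ^+ j) ^+ d * c d) = c 0%N.
  rewrite exchange_big /=.
  rewrite (bigD1 (Ordinal N0)) //= [X in _ + X]big1 ?addr0; last first.
    move=> d d0; rewrite -mulr_suml sum_rootu ?mul0r// ltn_ord andbT lt0n.
    by apply: contra d0 => /eqP d0; apply/eqP/val_inj.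
  rewrite (eq_bigr (fun=> c 0%N)); last by move=> j _; rewrite expr0 mul1r.
  by rewrite sumr_const card_ord -[c 0%N *+ N]mulr_natl mulKf.
have -> : N%:R^-1 * (\sum_(j < N) f (rootu N ^+ j)) - f 0 =
   N%:R^-1 * (\sum_(j < N) (f (rootu N ^+ j) - \sum_(d < N) (rootu N ^+ j) ^+ d * c d)) - (f 0 - c 0%N).
  by rewrite sumrB mulrBr e1; ring.
rewrite (le_trans (cabsD _ _))// cabsN mulrDl mul1r lerD//.
rewrite cabsM cabsV (_ : cabs N%:R = N%:R); last first.
  by rewrite -(rmorph_nat (@real_complex R)) cabs_real ger0_norm.
rewrite mulrC ler_pdivrMr ?ltr0n// (le_trans (cabs_sum _ _ _))//.
rewrite (le_trans (ler_sum _ (fun i _ => cP _ _)))//.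
  by move=> i _; rewrite cabsX cabs_rootu expr1n.
by rewrite sumr_const card_ord mulr_natr.
Qed.
End Averages.

Lemma contC_comp (R : realType) (V : normedModType R[i]) (g : V -> R[i]^o) (h : V -> V) (z : V) :
  {for z, continuous h} -> {for h z, continuous g} -> {for z, continuous (fun w => g (h w))}.
Proof. by move=> ch cg; apply: continuous_comp. Qed.

Lemma diff_cont (R : realType) (V : normedModType R[i]) (g : V -> R[i]^o) (z : V) :
  differentiable g z -> {for z, continuous g}.
Proof. exact: differentiable_continuous. Qed.

(** * Reduction to functions of the first coordinate *)

Section Slice.
Variable R : realType.
Variable m : nat.
Local Notation n := m.+1.
Local Notation V := ('rV[R[i]]_n : normedModType R[i]).
Local Notation S := (@csphere R n).
Let n0 : (0 < n)%N := isT.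

Lemma cont_cmeas (F : V -> R[i]) (r : R) : 1 < r ->
  (forall z, nsq z < r -> {for z, continuous (F : V -> R[i]^o)}) ->
  cmeas (fun x => F (cvec x)) /\ bdd (fun x : cpt R n => F (cvec x)).
Proof.
move=> r1 cF; have Sr (x : cpt R n) : S x -> nsq (cvec x) < r by move=> ->.
have mS := @measurable_csphere R n.
split; last first.
  have [|M hM] := @compact_bound R V F _ (@compact_nsq R n 1).
    by move=> z /= z1; apply: cF; exact: le_lt_trans z1 r1.
  by exists M => x Sx; apply: hM; rewrite /= Sx.
split.
  apply: (@cont_measurable R n [set z | nsq z < r] (fun z => complex.Re (F z))) => //.
    exact: open_nsq.
  by move=> z /cF cz; exact: Re_cont.
apply: (@cont_measurable R n [set z | nsq z < r] (fun z => complex.Im (F z))) => //.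
  exact: open_nsq.
by move=> z /cF cz; exact: Im_cont.
Qed.

Lemma cmeas_umap U (F : cpt R n -> R[i]) : unitary U -> cmeas F -> cmeas (fun x => F (umap U x)).
Proof.
move=> uU [Fr Fi]; have mS := @measurable_csphere R n.
have im : umap U @` S `<=` S by move=> _ [x Sx <-]; exact/(csphere_umap x uU).
by split; [apply: (measurable_comp mS im Fr)|apply: (measurable_comp mS im Fi)];
  apply: measurable_funTS; exact: measurable_umap.
Qed.

Lemma bdd_umap U (F : cpt R n -> R[i]) : unitary U -> bdd F -> bdd (fun x => F (umap U x)).
Proof. by move=> uU [M hM]; exists M => x /(csphere_umap x uU) /hM. Qed.

Definition head0 (z : 'rV[R[i]]_n) : 'rV[R[i]]_n :=
  \row_j (if j == ord0 then z ord0 ord0 else 0).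

Definition tail_mx (w : R[i]) : 'M[R[i]]_n := diag_mx (\row_j (if j == ord0 then 1 else w)).

Lemma mul_tail_mx (z : 'rV[R[i]]_n) w : z *m tail_mx w = head0 z + w *: (z - head0 z).
Proof.
apply/rowP => j; rewrite mul_mx_diag !mxE.
by case: eqP => [->|_]; rewrite ?subrr ?mulr0 ?addr0 ?mulr1 // subr0 add0r mulrC.
Qed.

Lemma unitary_tail_mx w : cabs w = 1 -> unitary (tail_mx w).
Proof.
move=> w1; apply/matrixP => i j; rewrite mul_diag_mx !mxE.
have [->|ij] := eqVneq i j; last first.
  by rewrite mulr0n conjc0 mulr0.
rewrite mulr1n; case: eqP => _; first by rewrite conjc1 mulr1.
by rewrite -csq_cabs -cabs_sqr w1 expr1n.
Qed.

Lemma nsq_head0 z : nsq (head0 z) = csq (z ord0 ord0).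
Proof.
rewrite /nsq (bigD1 ord0)//= mxE eqxx big1 ?addr0// => j j0.
by rewrite mxE (negPf j0) /csq /= expr0n /= addr0.
Qed.

Lemma nsq_slice z (w : R[i]) :
  nsq (head0 z + w *: (z - head0 z)) = csq (z ord0 ord0) + csq w * (nsq z - csq (z ord0 ord0)).
Proof.
rewrite /nsq (bigD1 ord0)//= [X in _ = _ + _ * (X - _)](bigD1 ord0)//= !mxE eqxx subrr mulr0 addr0.
rewrite [X in _ * X]addrAC subrr add0r mulr_sumr; congr (_ + _); apply: eq_bigr => j j0.
by rewrite !mxE (negPf j0) subr0 add0r csqM.
Qed.

Lemma csq_head_le (z : 'rV[R[i]]_n) : csq (z ord0 ord0) <= nsq z.
Proof. by rewrite /nsq (bigD1 ord0)//= lerDl sumr_ge0// => k _; exact: csq_ge0. Qed.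

Lemma head0_cont (z : V) : {for z, continuous (head0 : V -> V)}.
Proof.
apply/cont_eps => e e0; exists e => // w we; apply: vabs_lt => // j.
apply: le_lt_trans we; rewrite !mxE; case: eqP => _; last by rewrite subrr cabs0 vabs_ge0.
by have := coord_le_vabs (w - z) ord0; rewrite !mxE.
Qed.

(* Average over the rotations of all coordinates but the first: by Taylor
   expansion in these coordinates, only their origin contributes. *)
Lemma slice_integral (g : V -> R[i]^o) (R0 : R) (F : cpt R n -> R[i]) : 1 < R0 ->
  (forall z : V, nsq z < R0 ^+ 2 -> differentiable g z) -> cmeas F -> bdd F ->
  (forall w x, cabs w = 1 -> F (umap (tail_mx w) x) = F x) ->
  cintegral (fun x => g (cvec x) * F x) = cintegral (fun x => g (head0 (cvec x)) * F x).
Proof.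
move=> R01 dg mF bF Finv.
have R021 : 1 < R0 ^+ 2 by rewrite expr2 (lt_trans R01)// ltr_pMr// (lt_trans _ R01).
have cg (z : V) : nsq z < R0 ^+ 2 -> {for z, continuous g} by move=> /dg; exact: diff_cont.
have [mg bg] := cont_cmeas R021 cg.
have cgh (z : V) : nsq z < R0 ^+ 2 -> {for z, continuous (fun z : V => g (head0 z))}.
  move=> zR; apply: contC_comp; first exact: head0_cont.
  by apply: cg; rewrite nsq_head0 (le_lt_trans _ zR)// csq_head_le.
have [mgh bgh] := cont_cmeas R021 cgh.
have [MF hMF] := bF.
pose r := (1 + R0) / 2.
have r1 : 1 < r by rewrite ltr_pdivlMr//; lra.
have rR : r < R0 by rewrite ltr_pdivrMr//; lra.
have r2R : r ^+ 2 < R0 ^+ 2 by rewrite ltr_pXn2r// ?nnegrE; lra.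
have [|M hM] := @compact_bound R V g _ (@compact_nsq R n (r ^+ 2)).
  by move=> z /= zr; apply: cg; exact: le_lt_trans zr r2R.
(* For [x] on the sphere the squared norm is a convex combination of 1 and [csq w], with weights
   [csq (x 0)] and its complement. *)
have sl (t u : R) (x : cpt R n) w : S x -> csq w <= t -> 1 <= t ->
    nsq (head0 (cvec x) + w *: (cvec x - head0 (cvec x))) <= t.
  move=> Sx onem_nsq t1; rewrite nsq_slice Sx.
  have := csq_head_le (cvec x); rewrite Sx; set c := csq _ => c1.
  have c0 : 0 <= c := csq_ge0 _.
  have h : (1 - c) * csq w <= (1 - c) * t by rewrite ler_wpM2l// subr_ge0.
  have h2 : c * 1 <= c * t by rewrite ler_wpM2l.
  move: h h2; move: (csq w) => l; lra.
apply/eqP; rewrite -subr_eq0 -cabs_eq0 eq_le cabs_ge0 andbT.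
apply/ler_addgt0Pr => e e0; rewrite add0r.
have [N N0 hN] := small_pow (2 * (2 * (4 * M * (r / (r - 1)))) * `|MF|) r1 e0.
pose w j := rootu R N ^+ j.
have w1 j : cabs (w j) = 1 by rewrite cabsX cabs_rootu expr1n.
(* Rotated copies of the integrand: they share one integral, so the integral of [g * F] is that of
   their average. *)
pose G j x := g (cvec (umap (tail_mx (w j)) x)) * F x.
have GE j : cintegral (G j) = cintegral (fun x => g (cvec x) * F x).
  rewrite -[RHS](cintegral_umap (unitary_tail_mx (w1 j))); [|exact: cmeasM|exact: bddM].
  by apply: eq_cintegral => x _; rewrite /G Finv.
have mG j : cmeas (G j).
  apply: cmeasM => //; apply: (@cmeas_umap _ (fun x => g (cvec x))) => //; exact: unitary_tail_mx.
have bG j : bdd (G j).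
  apply: bddM => //; apply: (@bdd_umap _ (fun x => g (cvec x))) => //; exact: unitary_tail_mx.
have [sG1 sG2] := @cintegral_sum R n n0 _ (index_enum 'I_N) (fun j : 'I_N => G j) (fun j => cmeas_bdd (mG j) (bG j)).
have Nn : N%:R != 0 :> R[i] by rewrite pnatr_eq0 -lt0n.
have -> : cintegral (fun x => g (cvec x) * F x) =
    cintegral (fun x => N%:R^-1 * \sum_(j < N) G j x).
  rewrite cintegralZ// sG2 (eq_bigr (fun=> cintegral (fun x => g (cvec x) * F x))); last by move=> j _.
  by rewrite sumr_const card_ord -[cintegral _ *+ N]mulr_natl mulKf.
rewrite -mulN1r -cintegralZ; last by apply: cmeas_bdd; [exact: cmeasM|exact: bddM].
have mA : cmeas (fun x => N%:R^-1 * \sum_(j < N) G j x).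
  apply: cmeasM; first exact: cmeas_cst.
  exact: cmeas_sum.
have bA : bdd (fun x => N%:R^-1 * \sum_(j < N) G j x).
  apply: bddM; first exact: bdd_cst.
  exact: bdd_sum.
have mB : cmeas (fun x => -1 * (g (head0 (cvec x)) * F x)).
  by apply: cmeasM; [exact: cmeas_cst|exact: cmeasM].
have bB : bdd (fun x => -1 * (g (head0 (cvec x)) * F x)).
  by apply: bddM; [exact: bdd_cst|exact: bddM].
rewrite -cintegralD; [|exact: cmeas_bdd|exact: cmeas_bdd].
set K := 4 * M * (r / (r - 1)) in hN.
apply: (@le_trans _ _ (2 * (2 * (K / r ^+ N) * `|MF|))); last first.
  by apply: le_trans hN; rewrite le_eqVlt; apply/orP; left; apply/eqP; ring.
apply: cintegral_bound => //; first exact: cmeasD.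
move=> x Sx.
have -> : N%:R^-1 * \sum_(j < N) G j x + -1 * (g (head0 (cvec x)) * F x) =
   (N%:R^-1 * (\sum_(j < N) g (head0 (cvec x) + rootu R N ^+ j *: (cvec x - head0 (cvec x))))
     - g (head0 (cvec x) + 0 *: (cvec x - head0 (cvec x)))) * F x.
  rewrite scale0r addr0 mulrBl mulN1r -mulrA mulr_suml; congr (_ * _ - _).
  by apply: eq_bigr => j _; rewrite /G cvec_umap mul_tail_mx.
rewrite cabsM ler_pM ?cabs_ge0//; last by rewrite (le_trans (hMF x Sx))// ler_norm.
apply: (@avg_rootu R (fun l => g (head0 (cvec x) + l *: (cvec x - head0 (cvec x)))) R0 r M N) => //.
  move=> l lR; apply: cdiff_line; apply: dg.
  have lR2 : csq l < R0 ^+ 2 by rewrite -cabs_sqr ltr_pXn2r// ?nnegrE ?cabs_ge0//; lra.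
  pose t := Num.max 1 (csq l).
  apply: (@le_lt_trans _ _ t); last by rewrite gt_max R021.
  by apply: (sl t 0) => //; rewrite le_max lexx ?orbT.
move=> l lr; apply: hM; rewrite /=; apply: (sl _ 0) => //.
  by rewrite -cabs_sqr ler_pXn2r// ?nnegrE ?cabs_ge0//; lra.
by rewrite expr_ge1//; lra.
Qed.
End Slice.

(** * Moments of the first coordinate *)

Section HeadMonomials.
Variable R : realType.
Variable m : nat.
Local Notation n := m.+1.
Local Notation S := (@csphere R n).
Let n0 : (0 < n)%N := isT.

Definition zcoord (j : 'I_n) (x : cpt R n) : R[i] := cvec x ord0 j.

Lemma zcoord_le1 j x : S x -> cabs (zcoord j x) <= 1.
Proof.
move=> Sx; rewrite -(@ler_sqr _ (cabs _)) ?nnegrE ?cabs_ge0// cabs_sqr expr1n.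
rewrite -[leRHS]Sx /nsq (bigD1 j)//= lerDl sumr_ge0// => k _; exact: csq_ge0.
Qed.

Lemma zcoord_ok j : cmeas (zcoord j) /\ bdd (zcoord j).
Proof.
split; last by exists 1 => x; exact: zcoord_le1.
have [] := @cont_cmeas R m (fun z => z ord0 j) 2 _ _ => //; first by rewrite ltr1n.
by move=> z _; exact: coord_contC.
Qed.

Lemma csum_sq x : S x -> \sum_j zcoord j x * conjc (zcoord j x) = 1.
Proof.
move=> Sx; rewrite (eq_bigr (fun j => (csq (zcoord j x))%:C)); last by move=> j _; rewrite csq_cabs.
by rewrite -rmorph_sum /= [X in X%:C]Sx.
Qed.

Definition head_mono (i j : nat) (x : cpt R n) : R[i] := zcoord ord0 x ^+ i * conjc (zcoord ord0 x) ^+ j.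

Lemma head_mono_ok i j : cmeas (head_mono i j) /\ bdd (head_mono i j).
Proof.
have [h1 h2] := zcoord_ok ord0; split.
  by apply: cmeasM; apply: cmeasX => //; exact: cmeas_conj.
by apply: bddM; apply: bddX => //; exact: bdd_conj.
Qed.

Lemma head_mono_le1 i j x : S x -> cabs (head_mono i j x) <= 1.
Proof.
move=> Sx; rewrite /head_mono cabsM !cabsX cabs_conj -exprD exprn_ile1 ?cabs_ge0// zcoord_le1//.
Qed.

Lemma unitary_scalar (w : R[i]) : cabs w = 1 -> unitary (w%:M : 'M[R[i]]_n).
Proof.
move=> w1; apply/matrixP => i j; rewrite mul_scalar_mx !mxE.
have [_|_] := eqVneq i j; last by rewrite mulr0n conjc0 mulr0.
by rewrite mulr1n -csq_cabs -cabs_sqr w1 expr1n.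
Qed.

(** Multiplying all coordinates by a unimodular [w] multiplies the integral by [w ^ i * conj w ^ j],
    and some root of unity makes this factor different from 1. *)
Lemma head_mono_orth i j : i != j -> cintegral (head_mono i j) = 0.
Proof.
move=> ij.
have [w w1 wij] : exists2 w : R[i], cabs w = 1 & w ^+ i * conjc w ^+ j != 1.
  (* The absolute difference of [i] and [j]; a root of unity of order [d + 1] has a [d]-th power
     different from 1. *)
  pose d := ((i - j) + (j - i))%N; exists (rootu R d.+1); first exact: cabs_rootu.
  set w := rootu R d.+1.
  have ww : w * conjc w = 1 by rewrite -csq_cabs -cabs_sqr cabs_rootu expr1n.
  have wd : w ^+ d != 1.
    by apply: rootu_neq1; rewrite ltnS leqnn andbT /d; move: ij; case: ltngtP => //; lia.
  have [ji|ji] := leqP j i.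
    have -> : i = (d + j)%N by rewrite /d; lia.
    by rewrite exprD -mulrA -exprMn ww expr1n mulr1.
  have -> : j = (d + i)%N by rewrite /d; lia.
  rewrite exprD mulrCA -exprMn ww expr1n mulr1 -conjcX.
  by apply: contra_neq wd => /(congr1 conjc); rewrite conjcK conjc1.
have [h1 h2] := head_mono_ok i j.
have := cintegral_umap (unitary_scalar w1) h1 h2.
rewrite (@eq_cintegral _ _ _ (fun x => (w ^+ i * conjc w ^+ j) * head_mono i j x)); last first.
  move=> x _; rewrite /head_mono /zcoord cvec_umap mul_mx_scalar mxE rmorphM !exprMn /=; ring.
rewrite cintegralZ; last exact: cmeas_bdd.
move/eqP; rewrite -subr_eq0 -{2}[cintegral _]mul1r -mulrBl mulf_eq0 subr_eq0 (negPf wij) /=.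
by move/eqP.
Qed.

(** [f0] is the value and [f1] the derivative at [s = 0], uniformly on the sphere. The common bound
    [C] makes products of expansions expansions again; together with [first_order_integral0] this
    stands for differentiation under the integral sign. *)
Definition first_order (f : R -> cpt R n -> R[i]) (f0 f1 : cpt R n -> R[i]) :=
  exists C : R, forall s x, 0 <= s <= 1 -> S x ->
    [/\ cabs (f s x - f0 x - s%:C * f1 x) <= C * s ^+ 2,
        cabs (f s x) <= C, cabs (f0 x) <= C & cabs (f1 x) <= C].

Lemma first_orderM f f0 f1 g g0 g1 : first_order f f0 f1 -> first_order g g0 g1 ->
  first_order (fun s x => f s x * g s x) (fun x => f0 x * g0 x) (fun x => f0 x * g1 x + f1 x * g0 x).
Proof.
(* The error of the product splits into four terms, each at most [|A| * |B| * s ^ 2]. *)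
move=> [A hA] [B hB]; exists (4 * (`|A| * `|B|)) => s x sP Sx.
have [a1 a2 a3 a4] := hA s x sP Sx; have [b1 b2 b3 b4] := hB s x sP Sx.
have {a2 a3 a4} [a2 a3 a4] : [/\ cabs (f s x) <= `|A|, cabs (f0 x) <= `|A| & cabs (f1 x) <= `|A|].
  by split; apply: le_trans (ler_norm A).
have {b2 b3 b4} [b2 b3 b4] : [/\ cabs (g s x) <= `|B|, cabs (g0 x) <= `|B| & cabs (g1 x) <= `|B|].
  by split; apply: le_trans (ler_norm B).
have {}a1 : cabs (f s x - f0 x - s%:C * f1 x) <= `|A| * s ^+ 2.
  by rewrite (le_trans a1)// ler_wpM2r ?sqr_ge0// ler_norm.
have {}b1 : cabs (g s x - g0 x - s%:C * g1 x) <= `|B| * s ^+ 2.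
  by rewrite (le_trans b1)// ler_wpM2r ?sqr_ge0// ler_norm.
have AB : 0 <= `|A| * `|B| by rewrite mulr_ge0.
have pr (u v : R[i]) : cabs u <= `|A| -> cabs v <= `|B| -> cabs (u * v) <= `|A| * `|B|.
  by move=> h1 h2; rewrite cabsM ler_pM ?cabs_ge0.
have s2 : 0 <= s ^+ 2 := sqr_ge0 s.
split.
- set rf := f s x - _ - _ in a1; set rg := g s x - _ - _ in b1.
  have -> : f s x * g s x - f0 x * g0 x - s%:C * (f0 x * g1 x + f1 x * g0 x) =
     (f s x * rg + rf * g0 x) + (s ^+ 2)%:C * (f1 x * g1 x) + s%:C * (rf * g1 x).
    by rewrite /rf /rg realCX; ring.
  have s1 : 0 <= s <= 1 := sP; case/andP: s1 => s0 s1.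
  have t1 : cabs (f s x * rg) <= `|A| * `|B| * s ^+ 2.
    by rewrite cabsM -mulrA ler_pM ?cabs_ge0.
  have t2 : cabs (rf * g0 x) <= `|A| * `|B| * s ^+ 2.
    by rewrite cabsM mulrAC ler_pM ?cabs_ge0.
  have t3 : cabs ((s ^+ 2)%:C * (f1 x * g1 x)) <= `|A| * `|B| * s ^+ 2.
    by rewrite cabsM cabs_real ger0_norm// mulrC ler_wpM2r// pr.
  have t4 : cabs (s%:C * (rf * g1 x)) <= `|A| * `|B| * s ^+ 2.
    rewrite cabsM cabs_real ger0_norm// -[leRHS]mul1r ler_pM ?cabs_ge0//.
    by rewrite cabsM mulrAC ler_pM ?cabs_ge0.
  rewrite (le_trans (cabsD _ _))// (le_trans (lerD (cabsD _ _) t4))//.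
  rewrite (le_trans (lerD (lerD (cabsD _ _) t3) (lexx _)))//.
  rewrite (le_trans (lerD (lerD (lerD t1 t2) (lexx _)) (lexx _)))//.
  by rewrite le_eqVlt; apply/orP; left; apply/eqP; ring.
- by rewrite (le_trans (pr _ _ a2 b2))//; lra.
- by rewrite (le_trans (pr _ _ a3 b3))//; lra.
- rewrite (le_trans (cabsD _ _))// (le_trans (lerD (pr _ _ a3 b4) (pr _ _ a4 b3)))//; lra.
Qed.

Lemma first_orderX f f0 f1 k : first_order f f0 f1 ->
  first_order (fun s x => f s x ^+ k.+1) (fun x => f0 x ^+ k.+1) (fun x => k.+1%:R * f0 x ^+ k * f1 x).
Proof.
move=> hf; elim: k => [|k IH].
  have [C hC] := hf; exists C => s x sP Sx; have := hC s x sP Sx.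
  by rewrite !expr1 expr0 mul1r mul1r.
have [C hC] := first_orderM hf IH; exists C => s x sP Sx; have := hC s x sP Sx.
have -> : f0 x * (k.+1%:R * f0 x ^+ k * f1 x) + f1 x * f0 x ^+ k.+1 =
  k.+2%:R * f0 x ^+ k.+1 * f1 x.
  by rewrite -[k.+2%:R]natr1 exprS; ring.
by rewrite -!exprS.
Qed.

(** The integral of [f1] multiplied by [s] is of order [s ^ 2], since the other two integrals
    vanish; divide by [s] and let it tend to 0. *)
Lemma first_order_integral0 f f0 f1 : first_order f f0 f1 -> (forall s, cmeas (f s)) -> cmeas f0 -> cmeas f1 ->
  (forall s, 0 <= s <= 1 -> cintegral (f s) = 0) -> cintegral f0 = 0 -> cintegral f1 = 0.
Proof.
move=> [C hC] mf mf0 mf1 If If0.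
have P1 : ((0 : R) <= (1 : R)) && ((1 : R) <= (1 : R)) by rewrite ler01 lexx.
have b0 : bdd f0 by exists C => x Sx; have [] := hC 1 x P1 Sx.
have b1 : bdd f1 by exists C => x Sx; have [] := hC 1 x P1 Sx.
apply/eqP; rewrite -cabs_eq0 eq_le cabs_ge0 andbT.
apply/ler_addgt0Pr => e e0; rewrite add0r.
have K0 : 0 < 2 * `|C| + 1 by rewrite ltr_wpDl// mulr_ge0.
pose s := Num.min 1 (e / (2 * `|C| + 1)).
have s0 : 0 < s by rewrite lt_min ltr01 divr_gt0.
have s1 : s <= 1 by rewrite ge_min lexx.
have se : s * (2 * `|C| + 1) <= e by rewrite -ler_pdivlMr// ge_min lexx orbT.
have sP : 0 <= s <= 1 by rewrite ltW.
have bs : bdd (f s) by exists C => x Sx; have [] := hC s x sP Sx.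
have E : s%:C * cintegral f1 = - cintegral (fun x => f s x + -1 * f0 x + - s%:C * f1 x).
  have i1 := cmeas_bdd (mf s) bs; have i2 := cmeas_bdd mf0 b0; have i3 := cmeas_bdd mf1 b1.
  rewrite cintegralD; [|apply: cintegrableD => //; exact: cintegrableZ|exact: cintegrableZ].
  rewrite cintegralD//; last exact: cintegrableZ.
  by rewrite !cintegralZ// If// If0 mulr0 !add0r mulNr opprK.
have : cabs (s%:C * cintegral f1) <= 2 * (`|C| * s ^+ 2).
  rewrite E cabsN; apply: (@cintegral_bound R n n0) => //.
    apply: cmeasD; first by apply: cmeasD => //; apply: cmeasM => //; exact: cmeas_cst.
    by apply: cmeasM => //; exact: cmeas_cst.
  move=> x Sx; have [h _ _ _] := hC s x sP Sx.
  rewrite mulN1r mulNr (le_trans h)// ler_wpM2r ?sqr_ge0// ler_norm//.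
rewrite cabsM cabs_real gtr0_norm// => h.
have {}h : cabs (cintegral f1) <= 2 * `|C| * s.
  by rewrite -(ler_pM2l s0) (le_trans h)// le_eqVlt; apply/orP; left; apply/eqP; ring.
rewrite (le_trans h)// (le_trans _ se)// mulrC ler_wpM2l ?(ltW s0)// lerDl//.
Qed.
End HeadMonomials.

Section HeadMoments.
Variable R : realType.
Variable m : nat.
Local Notation n := m.+1.
Let n0 : (0 < n)%N := isT.

(** The Householder reflection: it sends [u] to [- u] and fixes the vectors orthogonal to [u]. *)
Definition refl_mx (u : 'rV[R[i]]_n) : 'M[R[i]]_n :=
  1%:M - (2 / nsq u)%:C *: (adjmx u *m u).

Lemma unitary_refl u : nsq u != 0 -> unitary (refl_mx u).
Proof.
move=> u0; rewrite /unitary /refl_mx; set k := (2 / nsq u)%:C; set P := adjmx u *m u.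
have PP : P *m P = (nsq u)%:C *: P.
  rewrite /P mulmxA -(mulmxA (adjmx u)) (_ : u *m adjmx u = (nsq u)%:C%:M).
    by rewrite mul_mx_scalar -scalemxAl.
  by apply/matrixP => i j; rewrite !ord1 nsqE !mxE mulr1n.
have kc : conjc k = k by rewrite /k conjc_real.
have -> : adjmx (1%:M - k *: P) = 1%:M - k *: P.
  apply/matrixP => i j; rewrite /P !mxE (rmorphB (@conjc R)) (rmorphM (@conjc R)); congr (_ - _ * _).
  - by rewrite [j == i]eq_sym; exact: conjc_nat.
  - exact: kc.
  - rewrite (rmorph_sum (@conjc R)); apply: eq_bigr => l _.
    by rewrite !mxE (rmorphM (@conjc R)) mulrC; congr (_ * _); rewrite /= conjcK.
rewrite mulmxBl mul1mx mulmxBr mulmx1 -scalemxAl -scalemxAr PP !scalerA.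
have -> : k * k * (nsq u)%:C = k + k.
  by rewrite /k -!rmorphM -rmorphD /=; congr (_%:C); field; exact: u0.
by rewrite scalerDl opprB addrK subrK.
Qed.

(** A rotation of all coordinates but the first by a cube root of unity multiplies the integral by
    its [k]-th power. The order 3 is enough for the exponents 1 and 2 that [mixed_moment] meets. *)
Lemma head_invariant_orth (F : cpt R n -> R[i]) (i : 'I_n) (k : nat) : i != ord0 -> (0 < k < 3)%N ->
  cmeas F -> bdd F -> (forall w x, cabs w = 1 -> F (umap (tail_mx m w) x) = F x) ->
  cintegral (fun x => F x * zcoord i x ^+ k) = 0.
Proof.
move=> i0 k3 mF bF Finv; pose w := rootu R 3.
have w1 : cabs w = 1 := cabs_rootu R 3.
have wk : w ^+ k != 1 by exact: rootu_neq1.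
have [mz bz] := zcoord_ok R i.
have mG : cmeas (fun x => F x * zcoord i x ^+ k) by apply: cmeasM => //; exact: cmeasX.
have bG : bdd (fun x => F x * zcoord i x ^+ k) by apply: bddM => //; exact: bddX.
have := cintegral_umap (unitary_tail_mx m w1) mG bG.
rewrite (@eq_cintegral _ _ _ (fun x => w ^+ k * (F x * zcoord i x ^+ k))); last first.
  move=> x _; rewrite Finv// /zcoord cvec_umap mul_tail_mx !mxE (negPf i0) add0r subr0 exprMn; ring.
rewrite cintegralZ; last exact: cmeas_bdd.
move/eqP; rewrite -subr_eq0 -{2}[cintegral _]mul1r -mulrBl mulf_eq0 subr_eq0 (negPf wk) /=.
by move/eqP.
Qed.

Lemma head_mono_tail_mx i j w x : head_mono i j (umap (tail_mx m w) x) = head_mono i j x :> R[i].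
Proof. by rewrite /head_mono /zcoord cvec_umap mul_tail_mx !mxE eqxx subrr mulr0 addr0. Qed.

Lemma first_order_quadratic (a b c : cpt R n -> R[i]) : bdd a -> bdd b -> bdd c ->
  first_order (fun s x => a x + s%:C * b x + (s ^+ 2)%:C * c x) a b.
Proof.
move=> [A hA] [B hB] [C hC]; exists (`|A| + `|B| + `|C|) => s x /andP[s0 s1] Sx.
have h1 : cabs (a x) <= `|A| by rewrite (le_trans (hA x Sx))// ler_norm.
have h2 : cabs (b x) <= `|B| by rewrite (le_trans (hB x Sx))// ler_norm.
have h3 : cabs (c x) <= `|C| by rewrite (le_trans (hC x Sx))// ler_norm.
have s2 : 0 <= s ^+ 2 := sqr_ge0 s.
have s21 : s ^+ 2 <= 1 by rewrite exprn_ile1.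
have A0 : 0 <= `|A| := normr_ge0 _; have B0 : 0 <= `|B| := normr_ge0 _.
split.
- rewrite (_ : _ - _ = (s ^+ 2)%:C * c x); last by ring.
  rewrite cabsM cabs_real ger0_norm// mulrC ler_wpM2r// (le_trans h3)// lerDr addr_ge0//.
- rewrite (le_trans (cabsD _ _))// lerD//.
    rewrite (le_trans (cabsD _ _))// lerD// cabsM cabs_real ger0_norm//.
    by rewrite -[leRHS]mul1r ler_pM ?cabs_ge0.
  by rewrite cabsM cabs_real ger0_norm// -[leRHS]mul1r ler_pM ?cabs_ge0.
- by rewrite (le_trans h1)// -addrA lerDl addr_ge0.
- by rewrite (le_trans h2)// addrAC lerDr addr_ge0.
Qed.

Lemma first_order_exp (f : R -> cpt R n -> R[i]) (f0 f1 : cpt R n -> R[i]) k : first_order f f0 f1 ->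
  first_order (fun s x => f s x ^+ k) (fun x => f0 x ^+ k) (fun x => k%:R * f0 x ^+ k.-1 * f1 x).
Proof.
case: k => [_|k]; last exact: first_orderX.
exists 1 => s x /andP[s0 s1] Sx; rewrite !expr0 !mul0r cabs0 cabs1 mulr0 subr0 subrr cabs0.
by rewrite mul1r sqr_ge0; split.
Qed.

(* First-order term in s of the integral of conj(z_0)^(d+1) z_0^d z_i, which
   vanishes identically, after the reflection along the vector e_i - s e_0. *)
Lemma mixed_moment (d : nat) (i : 'I_n) : i != ord0 ->
  d.+1%:R * cintegral (fun x : cpt R n => head_mono d d x * (zcoord i x * conjc (zcoord i x))) =
  cintegral (@head_mono R m d.+1 d.+1).
Proof.
move=> i0.
have [mz0 bz0] := zcoord_ok R (ord0 : 'I_n); have [mzi bzi] := zcoord_ok R i.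
have mcs (k : R[i]) := cmeas_cst n k; have bcs (k : R[i]) := bdd_cst n k.
(* Multiplied by [1 + s ^ 2], the reflection along [e_i - s e_0] sends coordinate 0 to [f s] and
   coordinate [i] to [- g s]; clearing the denominator makes them quadratic in [s]. *)
pose f (s : R) (x : cpt R n) : R[i] := zcoord ord0 x + s%:C * (2 * zcoord i x) + (s ^+ 2)%:C * (-1 * zcoord ord0 x).
pose g (s : R) (x : cpt R n) : R[i] := zcoord i x + s%:C * (-2 * zcoord ord0 x) + (s ^+ 2)%:C * (-1 * zcoord i x).
pose fc (s : R) (x : cpt R n) : R[i] := conjc (zcoord ord0 x) + s%:C * (2 * conjc (zcoord i x)) + (s ^+ 2)%:C * (-1 * conjc (zcoord ord0 x)).
have fcE s x : fc s x = conjc (f s x).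
  rewrite /fc /f !(rmorphD (@conjc R)) !(rmorphM (@conjc R)).
  congr (_ + _ * (_ * _) + _ * (_ * _)); apply/esym.
  - exact: conjc_real.
  - exact: conjc_nat.
  - exact: conjc_real.
  - by rewrite (rmorphN (@conjc R)); congr (- _); exact: conjc1.
have Hf : first_order f (zcoord ord0) (fun x => 2 * zcoord i x) by apply: first_order_quadratic => //; exact: bddM.
have Hg : first_order g (zcoord i) (fun x => -2 * zcoord ord0 x) by apply: first_order_quadratic => //; exact: bddM.
have Hfc : first_order fc (fun x => conjc (zcoord ord0 x)) (fun x => 2 * conjc (zcoord i x)).
  by apply: first_order_quadratic; [exact: bdd_conj|apply: bddM => //; exact: bdd_conj|apply: bddM => //; exact: bdd_conj].
have H := first_orderM (first_orderM (first_order_exp d.+1 Hfc) (first_order_exp d Hf)) Hg.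
have mf s : cmeas (f s) by apply: cmeasD; [apply: cmeasD => //|]; apply: cmeasM => //; exact: cmeasM.
have mg s : cmeas (g s) by apply: cmeasD; [apply: cmeasD => //|]; apply: cmeasM => //; exact: cmeasM.
have mfc s : cmeas (fc s).
  rewrite (_ : fc s = fun x => conjc (f s x)); last by apply/funext.
  exact: cmeas_conj.
have mcz (j : 'I_n) : cmeas (fun x : cpt R n => conjc (zcoord j x)) by exact: cmeas_conj (zcoord_ok R j).1.
have bcz (j : 'I_n) : bdd (fun x : cpt R n => conjc (zcoord j x)) by exact: bdd_conj (zcoord_ok R j).2.
have Z0 : cintegral (fun x : cpt R n => conjc (zcoord ord0 x) ^+ d.+1 * zcoord ord0 x ^+ d * zcoord i x) = 0.
  transitivity (cintegral (fun x : cpt R n => @head_mono R m d d.+1 x * zcoord i x ^+ 1)).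
    by apply: eq_cintegral => x _; rewrite /head_mono expr1; ring.
  apply: head_invariant_orth => //; [exact: (head_mono_ok R m d d.+1).1|exact: (head_mono_ok R m d d.+1).2|].
  by move=> w x _; exact: head_mono_tail_mx.
(* Up to a nonzero constant this is the integrand of [Z0] composed with a unitary map. *)
have Hs (s : R) : 0 <= s <= 1 -> cintegral (fun x => fc s x ^+ d.+1 * f s x ^+ d * g s x) = 0.
  move=> _; pose u : 'rV[R[i]]_n := \row_j (if j == ord0 then (- s)%:C else if j == i then 1 else 0).
  have nu : nsq u = 1 + s ^+ 2.
    rewrite /nsq (bigD1 ord0)//= (bigD1 i)//= !mxE eqxx (negPf i0) eqxx big1 ?addr0.
      by rewrite /csq /= expr1n expr0n /= !addr0 sqrrN addrC.
    by move=> j /andP[j0 ji]; rewrite mxE (negPf j0) (negPf ji) /csq /= expr0n /= addr0.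
  have N0 : 0 < 1 + s ^+ 2 by rewrite ltr_wpDr// sqr_ge0.
  have u0 : nsq u != 0 by rewrite nu gt_eqF.
  have uU := unitary_refl u0.
  have dotE (x : cpt R n) : (cvec x *m adjmx u) ord0 ord0 = - s%:C * zcoord ord0 x + zcoord i x.
    rewrite mxE (bigD1 ord0)//= (bigD1 i)//= !mxE eqxx (negPf i0) eqxx big1 ?addr0.
      by rewrite conjc_real conjc1 mulr1 mulrC (rmorphN (real_complex R)) /zcoord !mxE.
    by move=> j /andP[j0 ji]; rewrite !mxE (negPf j0) (negPf ji) conjc0 mulr0.
  have mapE (x : cpt R n) j : zcoord j (umap (refl_mx u) x) = zcoord j x - (2 / (1 + s ^+ 2))%:C * ((- s%:C * zcoord ord0 x + zcoord i x) * u ord0 j).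
    rewrite -dotE /zcoord cvec_umap /refl_mx mulmxBr mulmx1 -scalemxAr mulmxA nu.
    move: (cvec x) (cvec x *m adjmx u) => p q.
    by rewrite !mxE big_ord1 /u mxE.
  set N : R[i] := (1 + s ^+ 2)%:C.
  have NN : N != 0 by rewrite (inj_eq (@realC_inj R)) gt_eqF.
  have kE : (2 / (1 + s ^+ 2))%:C = 2 / N :> R[i] by rewrite rmorphM fmorphV /= rmorph_nat.
  pose c : R[i] := s%:C.
  have NE : N = 1 + c ^+ 2 by rewrite /N /c -realCX -(rmorph1 (real_complex R)) -rmorphD.
  have cN : (- s)%:C = - c by exact: (rmorphN (real_complex R)).
  have NN' : 1 + c ^+ 2 != 0 by rewrite -NE.
  have m0E (x : cpt R n) : zcoord ord0 (umap (refl_mx u) x) = N^-1 * f s x.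
    rewrite mapE kE /u mxE eqxx cN /f realCX -/c NE; field; exact: NN'.
  have miE (x : cpt R n) : zcoord i (umap (refl_mx u) x) = - N^-1 * g s x.
    rewrite mapE kE /u mxE (negPf i0) eqxx /g realCX -/c NE; field; exact: NN'.
  pose F (x : cpt R n) : R[i] := conjc (zcoord ord0 x) ^+ d.+1 * zcoord ord0 x ^+ d * zcoord i x.
  have mF : cmeas F by apply: cmeasM => //; apply: cmeasM; apply: cmeasX.
  have bF : bdd F by apply: bddM => //; apply: bddM; apply: bddX.
  have := cintegral_umap uU mF bF; rewrite [RHS]Z0.
  rewrite (@eq_cintegral _ _ _ (fun x => (- conjc N^-1 ^+ d.+1 * N^-1 ^+ d * N^-1) * (fc s x ^+ d.+1 * f s x ^+ d * g s x))).
    have bffs : bdd (fun x => fc s x ^+ d.+1 * f s x ^+ d * g s x).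
      have bf : bdd (f s) by apply: bddD; [apply: bddD => //|]; apply: bddM => //; exact: bddM.
      have bg : bdd (g s) by apply: bddD; [apply: bddD => //|]; apply: bddM => //; exact: bddM.
      apply: bddM => //; apply: bddM; apply: bddX => //.
      by rewrite (_ : fc s = fun x => conjc (f s x)); [exact: bdd_conj|apply/funext].
    rewrite cintegralZ; last first.
      by apply: cmeas_bdd => //; apply: cmeasM => //; apply: cmeasM; exact: cmeasX.
    move/eqP; rewrite mulf_eq0 => /orP[|/eqP//].
    by rewrite !mulf_eq0 oppr_eq0 !expf_eq0 conjc_eq0 invr_eq0 (negPf NN) !andbF.
  move=> x _; rewrite /F m0E miE fcE rmorphM !exprMn /=; ring.
have := first_order_integral0 H.
pose T0 (x : cpt R n) : R[i] := (conjc (zcoord ord0 x) ^+ d.+1 * zcoord ord0 x ^+ d) * (-2 * zcoord ord0 x).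
(* [T1] comes from the derivative of [f], [T2] from that of [fc]. For [d = 0] the truncated exponent
   [d.-1] does no harm, since [T1] occurs with the coefficient [d%:R]. *)
pose T1 (x : cpt R n) : R[i] := head_mono d.-1 d.+1 x * zcoord i x ^+ 2.
pose T2 (x : cpt R n) : R[i] := head_mono d d x * (zcoord i x * conjc (zcoord i x)).
have mT1 : cmeas T1 by apply: cmeasM; [exact: (head_mono_ok R m _ _).1|exact: cmeasX].
have mT2 : cmeas T2 by apply: cmeasM; [exact: (head_mono_ok R m _ _).1|apply: cmeasM].
have mM j k : cmeas (@head_mono R m j k) := (head_mono_ok R m j k).1.
have bM j k : bdd (@head_mono R m j k) := (head_mono_ok R m j k).2.
have bT1 : bdd T1 by apply: bddM => //; exact: bddX.
have bT2 : bdd T2 by apply: bddM => //; exact: bddM.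
have T10 : cintegral T1 = 0 by apply: head_invariant_orth => // w x _; exact: head_mono_tail_mx.
rewrite (_ : (fun x => _ + _) = fun x => -2 * head_mono d.+1 d.+1 x + 2 * d%:R * T1 x + 2 * d.+1%:R * T2 x); last first.
  apply/funext => x; rewrite /T1 /T2 /head_mono /= [zcoord ord0 x ^+ d.+1]exprS [conjc (zcoord ord0 x) ^+ d.+1]exprS; ring.
move=> /(_ _ _ _ Hs Z0) h.
have : cintegral (fun x => -2 * head_mono d.+1 d.+1 x + 2 * d%:R * T1 x + 2 * d.+1%:R * T2 x) = 0.
  apply: h.
  - move=> s; apply: cmeasM => //; apply: cmeasM; exact: cmeasX.
  - by apply: cmeasM => //; apply: cmeasM; exact: cmeasX.
  - by apply: cmeasD; [apply: cmeasD|]; apply: cmeasM.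
have i1 := cmeas_bdd (mM d.+1 d.+1) (bM d.+1 d.+1).
have i2 := cmeas_bdd mT1 bT1; have i3 := cmeas_bdd mT2 bT2.
rewrite cintegralD; [|apply: cintegrableD|]; try exact: cintegrableZ.
rewrite cintegralD; [|exact: cintegrableZ|exact: cintegrableZ].
rewrite !cintegralZ// T10 mulr0 addr0 => /eqP; rewrite addr_eq0 mulNr eqr_opp -mulrA.
by move=> /eqP/mulfI -> //; rewrite pnatr_eq0.
Qed.

(** Insert the sum of all [|z_j|^2], which is 1 on the sphere: the term [j = 0] is the next moment,
    and [mixed_moment] expresses each of the other [m] terms by it. *)
Lemma moment_recurrence d : d.+1%:R * cintegral (@head_mono R m d d) = (d + n)%:R * cintegral (@head_mono R m d.+1 d.+1).
Proof.
have mM j k : cmeas (@head_mono R m j k) := (head_mono_ok R m j k).1.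
have bM j k : bdd (@head_mono R m j k) := (head_mono_ok R m j k).2.
have iT (j : 'I_n) : cintegrable (fun x : cpt R n => head_mono d d x * (zcoord j x * conjc (zcoord j x))).
  have [mz bz] := zcoord_ok R j.
  apply: cmeas_bdd; first by apply: cmeasM => //; apply: cmeasM => //; exact: cmeas_conj.
  by apply: bddM => //; apply: bddM => //; exact: bdd_conj.
have [_ hs] := @cintegral_sum R n n0 _ (index_enum 'I_n) _ iT.
have -> : cintegral (@head_mono R m d d) = cintegral (fun x : cpt R n => \sum_j head_mono d d x * (zcoord j x * conjc (zcoord j x))).
  by apply: eq_cintegral => x Sx; rewrite -mulr_sumr csum_sq// mulr1.
rewrite hs mulr_sumr (bigD1 ord0)//=.
rewrite (eq_bigr (fun=> cintegral (@head_mono R m d.+1 d.+1))); last by move=> j j0; rewrite mixed_moment.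
rewrite sumr_const cardC1 card_ord /=.
rewrite (_ : cintegral (fun x => _) = cintegral (@head_mono R m d.+1 d.+1)); last first.
  by apply: eq_cintegral => x _; rewrite /head_mono !exprS; ring.
by rewrite -[_ *+ m]mulr_natl -mulrDl -natrD addSnnS.
Qed.

(** The reciprocals of the moments are the Taylor coefficients of [(1 - t) ^ (- n)], which is why
    [ker] reproduces. *)
Lemma moment_binomial d : cintegral (@head_mono R m d d) * 'C(d + m, d)%:R = 1.
Proof.
elim: d => [|d IH].
  rewrite bin0 mulr1 (@eq_cintegral _ _ _ (fun=> 1)) ?cintegral_cst//.
  by move=> x _; rewrite /head_mono !expr0 mulr1.
have d1 : d.+1%:R != 0 :> R[i] by rewrite pnatr_eq0.
have hb := mul_bin_diag (d.+1 + m) d.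
apply: (mulfI d1); rewrite mulr1 mulrCA -natrM -hb addSn /= natrM -addnS mulrCA mulrA -moment_recurrence.
by rewrite -mulrA IH mulr1.
Qed.
End HeadMoments.

Section DiffRules.
Variable R : realType.
Variable V : normedModType R[i].
Implicit Types (F G : V -> R[i]^o) (z : V).

Lemma diff_cst (k : R[i]) z : differentiable (fun _ : V => k : R[i]^o) z.
Proof. exact: differentiable_cst. Qed.

Lemma diff_add F G z : differentiable F z -> differentiable G z ->
  differentiable (fun w => F w + G w : R[i]^o) z.
Proof. by move=> dF dG; have h := differentiableD dF dG; exact: h. Qed.

Lemma diff_mul F G z : differentiable F z -> differentiable G z ->
  differentiable (fun w => F w * G w : R[i]^o) z.
Proof. by move=> dF dG; have h := differentiableM dF dG; exact: h. Qed.

Lemma diff_inv F z : F z != 0 -> differentiable F z ->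
  differentiable (fun w => (F w)^-1 : R[i]^o) z.
Proof. by move=> F0 dF; have h := differentiableV dF F0; exact: h. Qed.

Lemma diff_exp F k z : differentiable F z -> differentiable (fun w => F w ^+ k : R[i]^o) z.
Proof.
move=> dF; elim: k => [|k IH]; first exact: diff_cst.
by rewrite (_ : (fun w => _) = fun w => F w * F w ^+ k); [exact: diff_mul|apply/funext => w; rewrite exprS].
Qed.

Lemma diff_sum I (r : seq I) (F : I -> V -> R[i]^o) z : (forall i, differentiable (F i) z) ->
  differentiable (fun w => \sum_(i <- r) F i w : R[i]^o) z.
Proof.
move=> dF; elim: r => [|i r IH].
  rewrite (_ : (fun w => _) = fun=> 0); first exact: diff_cst.
  by apply/funext => w; rewrite big_nil.
rewrite (_ : (fun w => _) = fun w => F i w + \sum_(j <- r) F j w); first exact: diff_add.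
by apply/funext => w; rewrite big_cons.
Qed.
End DiffRules.

(** * The kernels *)

Section Kernel.
Variable R : realType.
Variable n : nat.
Local Notation V := ('rV[R[i]]_n : normedModType R[i]).

Lemma coord_diff (j : 'I_n) (z : V) : differentiable (fun w : V => (w ord0 j : R[i]^o)) z.
Proof. exact: differentiable_coord. Qed.

Lemma cdot_diff (a : 'rV[R[i]]_n) (z : V) : differentiable (fun w : V => (cdot a w : R[i]^o)) z.
Proof.
by apply: diff_sum => j; apply: diff_mul; [exact: diff_cst|exact: coord_diff].
Qed.

Lemma cdotC (a z : 'rV[R[i]]_n) : cdot z a = conjc (cdot a z).
Proof.
rewrite /cdot (rmorph_sum (@conjc R)); apply: eq_bigr => j _.
by rewrite (rmorphM (@conjc R)) /= conjcK mulrC.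
Qed.

Lemma cdotZr (a z : 'rV[R[i]]_n) k : cdot a (k *: z) = k * cdot a z.
Proof. by rewrite /cdot mulr_sumr; apply: eq_bigr => j _; rewrite mxE mulrCA. Qed.

Lemma cdotZl (a z : 'rV[R[i]]_n) k : cdot (k *: a) z = conjc k * cdot a z.
Proof. by rewrite cdotC cdotZr (rmorphM (@conjc R)) [cdot a z]cdotC. Qed.

Lemma cdotDr (a z w : 'rV[R[i]]_n) : cdot a (z + w) = cdot a z + cdot a w.
Proof. by rewrite /cdot -big_split; apply: eq_bigr => j _; rewrite mxE mulrDr. Qed.

Lemma cdotDl (a z w : 'rV[R[i]]_n) : cdot (z + w) a = cdot z a + cdot w a.
Proof. by rewrite cdotC cdotDr (rmorphD (@conjc R)) [cdot z a]cdotC [cdot w a]cdotC. Qed.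

Lemma cdot_self (z : 'rV[R[i]]_n) : cdot z z = (nsq z)%:C.
Proof. by rewrite /nsq rmorph_sum /cdot /=; apply: eq_bigr => j _; rewrite csq_cabs mulrC. Qed.

Lemma cdot0l (z : 'rV[R[i]]_n) : cdot 0 z = 0.
Proof. by rewrite /cdot big1// => j _; rewrite mxE conjc0 mul0r. Qed.

Lemma cauchy_schwarz (a z : 'rV[R[i]]_n) : csq (cdot a z) <= nsq a * nsq z.
Proof.
have [a0|a0] := eqVneq (nsq a) 0.
  by rewrite (nsq_eq0 a0) cdot0l /csq /= expr0n /= addr0 mulr_ge0 ?nsq_ge0.
have ap : 0 < nsq a by rewrite lt_def a0 nsq_ge0.
have /= := nsq_ge0 ((nsq a)%:C *: z + (- cdot a z) *: a).
suff -> : nsq ((nsq a)%:C *: z + (- cdot a z) *: a) = nsq a * (nsq a * nsq z - csq (cdot a z)).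
  by rewrite pmulr_rge0// subr_ge0.
apply: realC_inj; rewrite /= -cdot_self !cdotDl !cdotDr !cdotZl !cdotZr (cdotC a z) !cdot_self.
rewrite conjc_real (rmorphN (@conjc R)) rmorphM rmorphB rmorphM /= csq_cabs; ring.
Qed.

Definition ker (a z : 'rV[R[i]]_n) : R[i] := (1 - cdot a z)^-1 ^+ n.

Lemma cdot_neq1 (a z : 'rV[R[i]]_n) : nsq a * nsq z < 1 -> 1 - cdot a z != 0.
Proof.
move=> h; rewrite subr_eq0; apply: contraTneq (cauchy_schwarz a z) => <-.
by rewrite -ltNge -cabs_sqr cabs1 expr1n.
Qed.

Lemma ker_diff (a : 'rV[R[i]]_n) (z : V) : nsq a * nsq z < 1 ->
  differentiable (ker a : V -> R[i]^o) z.
Proof.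
move=> az; apply: diff_exp; apply: (@diff_inv _ _ (fun w : V => 1 - cdot a w)); first exact: cdot_neq1.
apply: diff_add; first exact: diff_cst.
rewrite (_ : (fun w => _) = fun w : V => -1 * cdot a w); last by apply/funext => w; rewrite mulN1r.
by apply: diff_mul; [exact: diff_cst|exact: cdot_diff].
Qed.
End Kernel.

Section Conj.
Variable R : realType.
Implicit Types a b : R[i].
Lemma conjcN a : conjc (- a) = - conjc a. Proof. exact: (rmorphN (@conjc R)). Qed.
Lemma conjcB a b : conjc (a - b) = conjc a - conjc b. Proof. exact: (rmorphB (@conjc R)). Qed.
Lemma conjcM a b : conjc (a * b) = conjc a * conjc b. Proof. exact: (rmorphM (@conjc R)). Qed.
Lemma conjcV a : conjc a^-1 = (conjc a)^-1. Proof. exact: (fmorphV (@conjc R)). Qed.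
Lemma conjc_sum (I : Type) (r : seq I) (P : pred I) (F : I -> R[i]) :
  conjc (\sum_(i <- r | P i) F i) = \sum_(i <- r | P i) conjc (F i).
Proof. exact: (rmorph_sum (@conjc R)). Qed.
End Conj.

(** * The reproducing formula for powers of the first coordinate *)

Section MonomialFormula.
Variable R : realType.
Variable m : nat.
Local Notation n := m.+1.
Local Notation V := ('rV[R[i]]_n : normedModType R[i]).
Local Notation S := (@csphere R n).

Lemma kinv_ok (a : 'rV[R[i]]_n) : nsq a < 1 ->
  cmeas (fun x : cpt R n => (1 - cdot a (cvec x))^-1) /\
  bdd (fun x : cpt R n => (1 - cdot a (cvec x))^-1).
Proof.
move=> a1; have a0 := nsq_ge0 a.
have p0 : 0 < 1 + nsq a by rewrite ltr_wpDr.
apply: (@cont_cmeas R m (fun z => (1 - cdot a z)^-1) (2 / (1 + nsq a))).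
  by rewrite ltr_pdivlMr// mul1r; lra.
move=> z zr; apply: diff_cont; apply: (@diff_inv _ _ (fun w : V => 1 - cdot a w)).
  apply: cdot_neq1; apply: (@le_lt_trans _ _ (nsq a * (2 / (1 + nsq a)))).
    by rewrite ler_wpM2l// ltW.
  by rewrite mulrA ltr_pdivrMr// mul1r; lra.
apply: diff_add; first exact: diff_cst.
rewrite (_ : (fun w => _) = fun w : V => -1 * cdot a w); last by apply/funext => w; rewrite mulN1r.
by apply: diff_mul; [exact: diff_cst|exact: cdot_diff].
Qed.

Definition head_vec : 'rV[R[i]]_n := delta_mx ord0 ord0.

Lemma cdot_head_vec (rho : R[i]) (z : 'rV[R[i]]_n) : cdot (rho *: head_vec) z = conjc rho * z ord0 ord0.
Proof.
rewrite cdotZl; congr (_ * _); rewrite /cdot (bigD1 ord0)//= !mxE eqxx conjc1 mul1r big1 ?addr0//.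
by move=> j j0; rewrite mxE eqxx (negPf j0) conjc0 mul0r.
Qed.

Lemma nsq_head_vec (rho : R[i]) : nsq (rho *: head_vec) = csq rho.
Proof. by apply: realC_inj; rewrite /= -cdot_self cdot_head_vec !mxE eqxx mulr1 csq_cabs mulrC. Qed.

Variable rho : R[i].
Hypothesis rho1 : cabs rho < 1.

Let rho2 : nsq (rho *: head_vec) < 1.
Proof. by rewrite nsq_head_vec -cabs_sqr expr_lt1// cabs_ge0. Qed.

Let c (x : cpt R n) : R[i] := conjc (zcoord ord0 x).
Let W (x : cpt R n) : R[i] := conjc (1 - cdot (rho *: head_vec) (cvec x))^-1.

Let WE x : S x -> (1 - rho * c x) * W x = 1.
Proof.
move=> Sx; have := @cdot_neq1 R n (rho *: head_vec) (cvec x); rewrite Sx mulr1 => /(_ rho2) h.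
have -> : 1 - rho * c x = conjc (1 - cdot (rho *: head_vec) (cvec x)).
  by rewrite (rmorphB (@conjc R)) (rmorph1 (@conjc R)) cdot_head_vec (rmorphM (@conjc R)) /= conjcK.
by rewrite /W -(rmorphM (@conjc R)) divff// (rmorph1 (@conjc R)).
Qed.

Let W_ok : cmeas W /\ bdd W.
Proof. by have [h1 h2] := kinv_ok rho2; split; [exact: cmeas_conj h1|exact: bdd_conj h2]. Qed.

Variable d : nat.
Let F e j (x : cpt R n) : R[i] := head_mono d e x * W x ^+ j.
(** The integral of [z_0 ^ d * c ^ e * W ^ j]; the formula to prove is the case [e = 0], [j = n].
    The relation [(1 - rho * c) * W = 1] gives recurrences in [e] and [j] that replace the expansion
    of [W ^ j] in powers of [c]. *)
Let Z e j := cintegral (F e j).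

Let F_ok e j : cmeas (F e j) /\ bdd (F e j).
Proof.
have [h1 h2] := W_ok; have [h3 h4] := head_mono_ok R m d e; split.
  by apply: cmeasM => //; exact: cmeasX.
by apply: bddM => //; exact: bddX.
Qed.

Let Zrec e j : Z e j.+1 = Z e j + rho * Z e.+1 j.+1.
Proof.
have iF e' j' := cmeas_bdd (F_ok e' j').1 (F_ok e' j').2.
rewrite /Z -cintegralZ// -cintegralD//; last exact: cintegrableZ.
apply: eq_cintegral => x /WE h; rewrite /F /head_mono -/(c x) !exprS.
by rewrite -[W x ^+ j]mul1r -{2}h; ring.
Qed.

(** Induction on [j] from orthogonality. When the term in [j] vanishes, the recurrence only shifts
    [e] and extracts a factor [rho]; since the integrals stay bounded, iterating gives 0. *)
Let Z0 e j : (d < e)%N -> Z e j = 0.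
Proof.
elim: j e => [|j IH] e de.
  rewrite /Z /F (@eq_cintegral _ _ _ (head_mono d e)); last by move=> x _; rewrite expr0 mulr1.
  by apply: head_mono_orth; rewrite neq_ltn de.
have it k : Z e j.+1 = rho ^+ k * Z (e + k)%N j.+1.
  elim: k => [|k ->]; first by rewrite expr0 mul1r addn0.
  rewrite Zrec IH; last by rewrite ltn_addr.
  by rewrite add0r exprSr mulrA addnS.
have [B hB] : exists B : R, forall k, cabs (Z k j.+1) <= B.
  have [B hB] := bddX j.+1 W_ok.2; exists (2 * B) => k.
  apply: cintegral_bound => //; first exact: (F_ok _ _).1.
  move=> x Sx; rewrite /F cabsM -[leRHS]mul1r ler_pM ?cabs_ge0 ?hB//; exact: head_mono_le1.
have [r0|r0] := eqVneq rho 0; first by rewrite (it 1%N) r0 expr1 mul0r.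
apply/eqP; rewrite -cabs_eq0 eq_le cabs_ge0 andbT.
apply/ler_addgt0Pr => e1 e10; rewrite add0r.
have r1 : 1 < (cabs rho)^-1 by rewrite invf_gt1// cabs_gt0.
have [N N0 hN] := small_pow B r1 e10.
rewrite (it N) cabsM cabsX (le_trans _ hN)// exprVn invrK mulrC ler_wpM2r//.
by rewrite exprn_ge0 ?cabs_ge0.
Qed.

(** The binomial is the coefficient of [t ^ k] in [(1 - t) ^ (- j)]; [Zrec] turns into Pascal's
    rule. The predecessor gives the right values for [j = 0]: 1 if [k = 0], and 0 otherwise. *)
Let Zval k j : (k <= d)%N -> Z (d - k) j = cintegral (@head_mono R m d d) * (rho ^+ k * 'C((k + j).-1, k)%:R).
Proof.
elim: j k => [|j IH] k kd.
  rewrite addn0 /Z /F (@eq_cintegral _ _ _ (head_mono d (d - k))); last by move=> x _; rewrite expr0 mulr1.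
  case: k kd => [_|k kd]; first by rewrite subn0 bin0 expr0 !mulr1.
  rewrite head_mono_orth; last by lia.
  by rewrite /= bin_small// !mulr0.
elim: k kd => [_|k IHk kd].
  by rewrite Zrec subn0 (@Z0 d.+1)// mulr0 addr0; have := IH 0%N (leq0n d); rewrite subn0 !bin0.
rewrite Zrec IH// (_ : (d - k.+1).+1 = (d - k)%N); last by lia.
rewrite IHk; last by lia.
rewrite addSn addnS /= addnS /= binS natrD exprS; ring.
Qed.

Lemma reproducing_formula_monomial :
  cintegral (fun x : cpt R n => zcoord ord0 x ^+ d * conjc (ker (rho *: head_vec) (cvec x))) = rho ^+ d.
Proof.
have := @Zval d n (leqnn d); rewrite subnn /Z => h.
rewrite (@eq_cintegral _ _ _ (F 0 n)).
  by rewrite h mulrCA addnS /= moment_binomial mulr1.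
by move=> x _; rewrite /F /head_mono expr0 mulr1 /ker conjcX.
Qed.
End MonomialFormula.

Lemma lin_diff (R : realType) (V W : normedModType R[i]) (L : {linear V -> W})
    (g : W -> R[i]^o) (z : V) : continuous L -> differentiable g (L z) ->
  differentiable (fun w => g (L w)) z.
Proof.
move=> cL dg; have h := differentiable_comp (linear_differentiable z cL) dg.
exact: h.
Qed.

(** * The reproducing formula past the closed ball *)

Section Reproducing.
Variable R : realType.
Variable m : nat.
Local Notation n := m.+1.
Local Notation V := ('rV[R[i]]_n : normedModType R[i]).
Let n0 : (0 < n)%N := isT.

Lemma ker_ok (a : 'rV[R[i]]_n) : nsq a < 1 ->
  cmeas (fun x : cpt R n => ker a (cvec x)) /\ bdd (fun x : cpt R n => ker a (cvec x)).
Proof. by move=> /kinv_ok[h1 h2]; split; [exact: cmeasX|exact: bddX]. Qed.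

(** Taylor polynomials converge uniformly on the closed disc, and the kernel is bounded on the
    sphere, so the monomial case passes to the limit. *)
Lemma reproducing_formula_disc (f : R[i] -> R[i]) (R0 r M : R) (rho : R[i]) : 1 < r -> r < R0 ->
  (forall w, cabs w < R0 -> cdiff f w) -> (forall w, cabs w <= r -> cabs (f w) <= M) ->
  cabs rho < 1 -> cmeas (fun x : cpt R n => f (zcoord ord0 x)) ->
  cintegral (fun x : cpt R n => f (zcoord ord0 x) * conjc (ker (rho *: head_vec R m) (cvec x))) = f rho.
Proof.
move=> r1 rR df hM rho1 mf.
have [c hc] := taylor r1 rR df.
have rho2 : nsq (rho *: head_vec R m) < 1 by rewrite nsq_head_vec -cabs_sqr expr_lt1// cabs_ge0.
have [mk0 bk0] := ker_ok rho2.
have mk := cmeas_conj mk0; have bk := bdd_conj bk0; have [B hB] := bk.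
have [mz bz] := zcoord_ok R (ord0 : 'I_n).
have bf : bdd (fun x : cpt R n => f (zcoord ord0 x)).
  by exists M => x Sx; apply: hM; rewrite (le_trans (zcoord_le1 _ Sx))// ltW.
pose k (x : cpt R n) := conjc (ker (rho *: head_vec R m) (cvec x)).
apply/eqP; rewrite -subr_eq0 -cabs_eq0 eq_le cabs_ge0 andbT.
apply/ler_addgt0Pr => e ep; rewrite add0r.
(* [2 * |B|] accounts for the error inside the integral, 1 for the error at [rho]. *)
have [N N0 hN] := small_pow ((2 * `|B| + 1) * (4 * M * (r / (r - 1)))) r1 ep.
pose K := 4 * M * (r / (r - 1)) / r ^+ N.
have hK w : cabs w <= 1 -> cabs (f w - \sum_(j < N) w ^+ j * c j) <= K by move=> ?; exact: hc.
pose G (j : 'I_N) (x : cpt R n) : R[i] := c j * (zcoord ord0 x ^+ j * k x).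
have iG0 j : cintegrable (fun x : cpt R n => zcoord ord0 x ^+ j * k x).
  by apply: cmeas_bdd; [apply: cmeasM => //; exact: cmeasX|apply: bddM => //; exact: bddX].
have iG j : cintegrable (G j) by apply: cintegrableZ => //.
have [sG1 sG2] := @cintegral_sum R n n0 _ (index_enum 'I_N) G iG.
have PE : cintegral (fun x => \sum_j G j x) = \sum_(j < N) rho ^+ j * c j.
  rewrite sG2; apply: eq_bigr => j _.
  by rewrite /G cintegralZ// reproducing_formula_monomial// mulrC.
have ifk : cintegrable (fun x => f (zcoord ord0 x) * k x) by apply: cmeas_bdd; [exact: cmeasM|exact: bddM].
have -> : cintegral (fun x => f (zcoord ord0 x) * k x) - f rho =
   cintegral (fun x => f (zcoord ord0 x) * k x + -1 * \sum_j G j x) - (f rho - \sum_(j < N) rho ^+ j * c j).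
  rewrite cintegralD//; last exact: cintegrableZ.
  rewrite cintegralZ// PE; ring.
have bnd : cabs (cintegral (fun x => f (zcoord ord0 x) * k x + -1 * \sum_j G j x)) <= 2 * (K * `|B|).
  apply: cintegral_bound => //.
    apply: cmeasD; first exact: cmeasM.
    apply: cmeasM; first exact: cmeas_cst.
    apply: cmeas_sum => j; apply: cmeasM; first exact: cmeas_cst.
    by apply: cmeasM => //; exact: cmeasX.
  move=> x Sx.
  have -> : f (zcoord ord0 x) * k x + -1 * (\sum_j G j x) =
     (f (zcoord ord0 x) - \sum_(j < N) zcoord ord0 x ^+ j * c j) * k x.
    rewrite mulrBl mulr_suml mulN1r; congr (_ - _); apply: eq_bigr => j _; rewrite /G; ring.
  rewrite cabsM ler_pM ?cabs_ge0// ?(le_trans (hB x Sx)) ?ler_norm//.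
  by apply: hK; exact: zcoord_le1.
rewrite (le_trans (cabsD _ _))// cabsN (le_trans (lerD bnd (hK _ (ltW rho1))))//.
by apply: le_trans hN; rewrite le_eqVlt; apply/orP; left; apply/eqP; rewrite /K; ring.
Qed.

(** A kernel centred on the first axis is unchanged by rotations of the other coordinates, so
    [slice_integral] replaces [g] by its restriction to that axis. *)
Lemma reproducing_formula_head (g : V -> R[i]^o) (R0 : R) (rho : R[i]) : 1 < R0 ->
  (forall z : V, nsq z < R0 ^+ 2 -> differentiable g z) -> cabs rho < 1 ->
  cintegral (fun x : cpt R n => g (cvec x) * conjc (ker (rho *: head_vec R m) (cvec x))) = g (rho *: head_vec R m).
Proof.
move=> R01 dg rho1.
have rho2 : nsq (rho *: head_vec R m) < 1 by rewrite nsq_head_vec -cabs_sqr expr_lt1// cabs_ge0.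
have [mk0 bk0] := ker_ok rho2.
have mk := cmeas_conj mk0; have bk := bdd_conj bk0.
rewrite (slice_integral R01 dg mk bk); last first.
  move=> w x _; congr (conjc (_^-1 ^+ _)); rewrite !cdot_head_vec cvec_umap mul_tail_mx !mxE eqxx.
  by rewrite subrr mulr0 addr0.
have hE (z : 'rV[R[i]]_n) : head0 z = z ord0 ord0 *: head_vec R m.
  by apply/rowP => j; rewrite !mxE eqxx; case: eqP => [_|_]; rewrite ?mulr1 ?mulr0.
rewrite (@eq_cintegral _ _ _ (fun x : cpt R n => (fun w => g (w *: head_vec R m)) (zcoord ord0 x) * conjc (ker (rho *: head_vec R m) (cvec x)))); last first.
  by move=> x _; rewrite hE.
have R021 : 1 < R0 ^+ 2 by rewrite expr2 (lt_trans R01)// ltr_pMr// (lt_trans _ R01).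
pose r := (1 + R0) / 2.
have r1 : 1 < r by rewrite ltr_pdivlMr//; lra.
have rR : r < R0 by rewrite ltr_pdivrMr//; lra.
have r2R : r ^+ 2 < R0 ^+ 2 by rewrite ltr_pXn2r// ?nnegrE; lra.
have cg (z : V) : nsq z < R0 ^+ 2 -> {for z, continuous g} by move=> /dg; exact: diff_cont.
have [|M hM] := @compact_bound R V g _ (@compact_nsq R n (r ^+ 2)).
  by move=> z /= zr; apply: cg; exact: le_lt_trans zr r2R.
apply: (@reproducing_formula_disc (fun w => g (w *: head_vec R m)) R0 r M rho r1 rR) => //.
- move=> w wR; have := @cdiff_line R V g 0 (head_vec R m) w; rewrite add0r.
  have -> : (fun l => g (0 + l *: head_vec R m)) = (fun l => g (l *: head_vec R m)) by apply/funext => l; rewrite add0r.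
  apply; apply: dg; rewrite nsq_head_vec -cabs_sqr ltr_pXn2r ?nnegrE ?cabs_ge0//; lra.
- by move=> w wr; apply: hM; rewrite /= nsq_head_vec -cabs_sqr ler_pXn2r ?nnegrE ?cabs_ge0//; lra.
have cgh (z : V) : nsq z < R0 ^+ 2 -> {for z, continuous (fun z : V => g (head0 z))}.
  move=> zR; apply: contC_comp; first exact: head0_cont.
  by apply: cg; rewrite nsq_head0 (le_lt_trans _ zR)// csq_head_le.
have [mgh bgh] := cont_cmeas R021 cgh.
by rewrite (_ : (fun x => _) = fun x : cpt R n => g (head0 (cvec x)))//; apply/funext => x; rewrite hE.
Qed.

Lemma umap_diff (g : V -> R[i]^o) (U : 'M[R[i]]_n) (z : V) : differentiable g (z *m U) ->
  differentiable (fun w : V => g (w *m U)) z.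
Proof.
apply: (@lin_diff R V V (mulmxr U)) => w; apply/cont_eps => e ep.
pose K := \sum_k \sum_j cabs (U k j) + 1.
have K0 : 0 < K by rewrite ltr_wpDl// sumr_ge0// => k _; rewrite sumr_ge0// => j _; exact: cabs_ge0.
exists (e / K); first exact: divr_gt0.
move=> y yw; apply: vabs_lt => // j.
rewrite -mulmxBl mxE (le_lt_trans (cabs_sum _ _ _))//.
apply: (@le_lt_trans _ _ (\sum_k vabs (y - w : V) * cabs (U k j))).
  by apply: ler_sum => k _; rewrite cabsM ler_wpM2r ?cabs_ge0//; exact: coord_le_vabs.
rewrite -mulr_sumr; move: yw; rewrite ltr_pdivlMr//; apply: le_lt_trans.
rewrite ler_wpM2l ?vabs_ge0//; apply: (@le_trans _ _ (\sum_k \sum_j cabs (U k j))); last by rewrite lerDl.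
by apply: ler_sum => k _; rewrite (bigD1 j)//= lerDl sumr_ge0// => l _; exact: cabs_ge0.
Qed.

Lemma cdotE (a z : 'rV[R[i]]_n) : cdot a z = (z *m adjmx a) ord0 ord0.
Proof. by rewrite mxE; apply: eq_bigr => j _; rewrite !mxE mulrC. Qed.

Lemma cdot_unitary U (a z : 'rV[R[i]]_n) : unitary U -> cdot (a *m U) (z *m U) = cdot a z.
Proof. by move=> uU; rewrite !cdotE adjmxM -mulmxA (mulmxA U) uU mul1mx. Qed.

Lemma unitary1 : unitary (1%:M : 'M[R[i]]_n).
Proof. by apply: unitary_scalar; exact: cabs1. Qed.

(** A reflection exchanges two unit vectors when their inner product is real. So [a] is first turned
    by the phase that makes its first coordinate real; this phase goes into [rho]. *)
Lemma unitary_to_head (a : 'rV[R[i]]_n) : exists U rho, unitary U /\ a = rho *: head_vec R m *m U.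
Proof.
have [a0|a0] := eqVneq (nsq a) 0.
  exists 1%:M, 0; split; first exact: unitary1.
  by rewrite (nsq_eq0 a0) scale0r mul0mx.
have ap : 0 < nsq a by rewrite lt_def a0 nsq_ge0.
pose N := Num.sqrt (nsq a).
have N0 : N != 0 by rewrite gt_eqF// sqrtr_gt0.
have NC : N%:C != 0 :> R[i] by rewrite (inj_eq (@realC_inj R)).
(* [t] is the phase of the first coordinate of [a], or 1 when that coordinate vanishes. *)
have [t t1 [h hh]] : exists2 t : R[i], t * conjc t = 1 & exists h : R, conjc t * a ord0 ord0 = h%:C.
  have [z0|z0] := eqVneq (a ord0 ord0) 0.
    by exists 1; [rewrite conjc1 mulr1|exists 0; rewrite z0 mulr0].
  have c0 : (cabs (a ord0 ord0))%:C != 0 :> R[i] by rewrite (inj_eq (@realC_inj R)) cabs_eq0.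
  have ck : a ord0 ord0 * conjc (a ord0 ord0) = (cabs (a ord0 ord0))%:C ^+ 2.
    by rewrite -realCX cabs_sqr csq_cabs.
  exists (a ord0 ord0 / (cabs (a ord0 ord0))%:C).
    rewrite conjcM conjcV conjc_real mulrACA ck expr2 -invfM divff//.
    by rewrite mulf_neq0.
  exists (cabs (a ord0 ord0)).
  rewrite conjcM conjcV conjc_real mulrAC mulrC [X in _ * X]mulrC ck expr2 mulKf//.
pose b : 'rV[R[i]]_n := (conjc t / N%:C) *: a.
have ab : a = (N%:C * t) *: b.
  rewrite /b scalerA (_ : _ * _ = 1) ?scale1r//.
  by rewrite mulrA -[N%:C * t * _]mulrA t1 mulr1 divff.
have nb : nsq b = 1.
  apply: realC_inj; rewrite /= -cdot_self cdotZl cdotZr cdot_self mulrA.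
  rewrite conjcM conjcV conjcK conjc_real mulrACA t1 mul1r -invfM.
  by rewrite -rmorphM /= -expr2 sqr_sqrtr ?nsq_ge0// mulVf// (inj_eq (@realC_inj R)).
have hb : b ord0 ord0 = (h / N)%:C by rewrite mxE mulrAC hh rmorphM fmorphV.
clearbody b.
have [be|be] := eqVneq b (head_vec R m).
  by exists 1%:M, (N%:C * t); split; [exact: unitary1|rewrite mulmx1 -be].
(* Since [b] has a real first coordinate, [nsq u] is [2 - 2 * b_0], which is what makes the
   reflection along [u] send [e_0] to [b]. *)
pose u := b - head_vec R m.
have nu : (nsq u)%:C = 2 - 2 * b ord0 ord0 :> R[i].
  have e1 z : cdot (head_vec R m) z = z ord0 ord0.
    by have := cdot_head_vec 1 z; rewrite scale1r conjc1 mul1r.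
  have -> : u = b + (-1) *: head_vec R m by rewrite scaleN1r.
  rewrite -cdot_self cdotDl !cdotDr !cdotZl !cdotZr (cdot_self b) nb (cdotC (head_vec R m) b) !e1.
  rewrite conjcN conjc1 hb conjc_real [head_vec R m _ _]mxE !eqxx (rmorph1 (real_complex R)) /=; ring.
have u0 : nsq u != 0.
  by apply: contra be => /eqP/nsq_eq0/eqP; rewrite subr_eq0.
exists (refl_mx u), (N%:C * t); split; first exact: unitary_refl.
have uC : (nsq u)%:C != 0 :> R[i] by rewrite (inj_eq (@realC_inj R)).
rewrite [LHS]ab -scalemxAl; congr (_ *: _).
rewrite /refl_mx mulmxBr mulmx1 -scalemxAr mulmxA.
have -> : head_vec R m *m adjmx u = (b ord0 ord0 - 1)%:M.
  apply/matrixP => i j; rewrite !ord1 -cdotE cdotC.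
  have := cdot_head_vec 1 u; rewrite scale1r conjc1 mul1r => ->.
  have -> : u ord0 ord0 = b ord0 ord0 - 1 by rewrite /u !mxE !eqxx.
  by rewrite conjcB hb conjc_real conjc1 [RHS]mxE mulr1n.
rewrite mul_scalar_mx scalerA (_ : _ * _ = -1) ?scaleN1r ?opprK /u ?subrKC//.
rewrite rmorphM fmorphV rmorph_nat /= nu; move: uC; rewrite nu => uC; field.
exact: uC.
Qed.

Theorem reproducing_formula (g : V -> R[i]^o) (R0 : R) (a : V) : 1 < R0 ->
  (forall z : V, nsq z < R0 ^+ 2 -> differentiable g z) -> nsq a < 1 ->
  cintegral (fun x : cpt R n => g (cvec x) * conjc (ker a (cvec x))) = g a.
Proof.
move=> R01 dg a1; have [U [rho [uU aE]]] := unitary_to_head a.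
have rho1 : cabs rho < 1.
  have := a1; rewrite aE nsq_unitary// nsq_head_vec -cabs_sqr expr_lt1// ?cabs_ge0//.
have R021 : 1 < R0 ^+ 2 by rewrite expr2 (lt_trans R01)// ltr_pMr// (lt_trans _ R01).
have cg (z : V) : nsq z < R0 ^+ 2 -> {for z, continuous g} by move=> /dg; exact: diff_cont.
have [mg bg] := cont_cmeas R021 cg; have [mk bk] := ker_ok a1.
rewrite -(cintegral_umap uU); last 2 first.
- by apply: cmeasM => //; exact: cmeas_conj.
- by apply: bddM => //; exact: bdd_conj.
have := @reproducing_formula_head (fun w => g (w *m U)) R0 rho R01 _ rho1; rewrite -aE => <-.
  apply: eq_cintegral => x _; rewrite cvec_umap; congr (_ * conjc _).
  by rewrite /ker {1}aE cdot_unitary.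
by move=> z zR; apply: umap_diff; apply: dg; rewrite nsq_unitary.
Qed.
End Reproducing.

(** * Radial limits *)

Section LimMul.
Variables (K : numFieldType) (T : Type) (Fi : set_system T).
Context {FF : ProperFilter Fi}.

(* When F diverges, so does G * F, and both limits are the default point 0. *)
Lemma lim_mul (F G : T -> K^o) (k : K^o) : k != 0 -> (point : K^o) = 0 ->
  G r @[r --> Fi] --> k ->
  lim (G r * F r @[r --> Fi]) = k * lim (F r @[r --> Fi]).
Proof.
move=> k0 p0 cG.
have [cF|nF] := pselect (cvg (F r @[r --> Fi])).
  apply: cvg_lim; first exact: norm_hausdorff.
  by have := cvgM cG cF; apply.
rewrite (dvgP nF) p0 mulr0 dvgP// => cGF; apply: nF.
have cV : (G r)^-1 @[r --> Fi] --> k^-1 by have := cvgV k0 cG; apply.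
have h : (G r)^-1 * (G r * F r) @[r --> Fi] --> k^-1 * lim (G r * F r @[r --> Fi]).
  by have := cvgM cV cGF; apply.
apply/cvg_ex; exists (k^-1 * lim (G r * F r @[r --> Fi])).
apply: cvg_trans h; apply: near_eq_cvg; near=> r => /=; rewrite /= mulrA mulVf ?mul1r//.
near: r.
have kp : 0 < `|k| by rewrite normr_gt0.
move/cvgrPdist_lt : cG => /(_ _ kp); apply: filterS => r.
by apply: contraTneq => ->; rewrite subr0 ltxx.
Unshelve. all: by end_near. Qed.
End LimMul.

Section LeftLimit.
Variable R : realType.

Lemma cvg_left (F : R -> R[i]) (l : R[i]) : (F r : R[i]^o) @[r --> 1^'-] --> (l : R[i]^o) <->
  forall e : R, 0 < e -> \forall r \near 1^'-, cabs (F r - l) < e.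
Proof.
split=> [/cvgrPdist_lt h e ep|h].
  have eC : (0 : R[i]) < e%:C by rewrite ltcR.
  near=> r; have : `|(l : R[i]^o) - F r| < e%:C by near: r; exact: h.
  by rewrite normC ltcR cabsB.
apply/cvgrPdist_lt => e ep; have eE := realC_ge0 (ltW ep).
have e0 : 0 < complex.Re e by rewrite -ltcR -eE.
near=> r; rewrite eE normC ltcR cabsB; near: r; exact: h.
Unshelve. all: by end_near. Qed.

Lemma left_lim (F : R -> R[i]) (l : R[i]) :
  (forall e : R, 0 < e -> \forall r \near 1^'-, cabs (F r - l) < e) ->
  lim ((F r : R[i]^o) @[r --> 1^'-]) = l.
Proof. by move=> /cvg_left h; apply: cvg_lim => //; exact: norm_hausdorff. Qed.

Lemma ereal_left (F : R -> \bar R) : F r @[r --> 1^'-] --> 0%E ->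
  forall e : R, 0 < e -> \forall r \near 1^'-, (F r < e%:E)%E.
Proof.
move=> h e ep; apply: (h [set y | (y < e%:E)%E]).
by apply: open_nbhs_nbhs; split; [exact: open_ereal_lt_ereal|rewrite /= lte_fin].
Qed.

Lemma left_ereal (F : R -> \bar R) : (forall r, 0 <= F r)%E ->
  (forall e : R, 0 < e -> \forall r \near 1^'-, (F r <= e%:E)%E) ->
  F r @[r --> 1^'-] --> 0%E.
Proof.
move=> F0 h; apply/fine_cvgP; split.
  have := h 1 ltr01; apply: filterS => r Fr; rewrite ge0_fin_numE//.
  exact: le_lt_trans Fr (ltry _).
apply/cvgrPdist_le => e ep; have := h e ep; apply: filterS => r Fr.
rewrite sub0r normrN ger0_norm ?fine_ge0//.
rewrite -lee_fin fineK// ge0_fin_numE//; exact: le_lt_trans Fr (ltry _).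
Qed.

Lemma near_left_itv (d : R) : 0 < d -> \forall r \near 1^'-, 1 - d < r < 1.
Proof.
move=> d0; near=> r; apply/andP; split; near: r; last exact: nbhs_left_lt.
by apply: nbhs_left_gt; rewrite ltrBlDr ltrDl.
Unshelve. all: by end_near. Qed.
End LeftLimit.

Lemma scale_diff (R : realType) (V : normedModType R[i]) (k : R[i]) (g : V -> R[i]^o) (z : V) :
  differentiable g (k *: z) -> differentiable (fun w : V => g (k *: w)) z.
Proof.
apply: (@lin_diff R V V ( *:%R k)); exact: scaler_continuous.
Qed.

(** * Boundary values of Hardy functions *)

Section HardyLimits.
Variable R : realType.
Variable m : nat.
Local Notation n := m.+1.
Local Notation V := ('rV[R[i]]_n : normedModType R[i]).
Local Notation S := (@csphere R n).
Local Notation mu := (sigma R n).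
Let n0 : (0 < n)%N := isT.
Let mS : measurable S := @measurable_csphere R n.

(** The inequality [t <= e + t ^ 2 / e] takes the place of Cauchy-Schwarz: it yields integrability
    and, for [eta = e ^ 2], a bound proportional to [e]. *)
Lemma L2_pairing_bound (D k : cpt R n -> R[i]) (B e eta : R) : cmeas D -> cmeas k ->
  (forall x, S x -> cabs (k x) <= B) -> 0 < e ->
  (\int[mu]_(x in S) (csq (D x))%:E <= eta%:E)%E ->
  cintegrable (fun x => D x * k x) /\
  cabs (cintegral (fun x => D x * k x)) <= 2 * (B * (e + eta / e)).
Proof.
move=> mD mk kB ep De.
have mcsq : measurable_fun S (fun x => csq (D x)).
  have [h1 h2] := mD.
  by apply: measurable_funD; exact: measurable_funX.
have ic : mu.-integrable S (EFin \o (fun x => csq (D x))).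
  apply/integrableP; split; first exact/measurable_EFinP.
  rewrite (eq_integral (fun x => (csq (D x))%:E)); last first.
    by move=> x _; rewrite /= ger0_norm ?csq_ge0.
  exact: le_lt_trans De (ltry _).
have i1 : mu.-integrable S (EFin \o (fun=> e)).
  by apply: (@bdd_integrable R n (fun=> e) `|e|) => // x Sx.
have i2 : mu.-integrable S (EFin \o (fun x => e^-1 * csq (D x))).
  by have := integrableZl mS e^-1 ic; apply: eq_integrable => // x _; rewrite /= EFinM.
have i3 : mu.-integrable S (EFin \o (fun x => e + e^-1 * csq (D x))).
  by have := integrableD mS i1 i2; apply: eq_integrable => // x _; rewrite /= EFinD.
have i4 : mu.-integrable S (EFin \o (fun x => B * (e + e^-1 * csq (D x)))).
  by have := integrableZl mS B i3; apply: eq_integrable => // x _; rewrite /= EFinM.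
have bd x : S x -> cabs (D x * k x) <= B * (e + e^-1 * csq (D x)).
  move=> Sx; rewrite cabsM mulrC ler_pM ?cabs_ge0 ?kB// -cabs_sqr.
  have := cabs_ge0 (D x); set t := cabs (D x) => t0.
  have -> : e + e^-1 * t ^+ 2 = t + ((e - t) ^+ 2 + e * t) / e by field; rewrite gt_eqF.
  by rewrite lerDl divr_ge0 ?addr_ge0 ?sqr_ge0 ?mulr_ge0 ?(ltW ep).
have [mr mi] := cmeasM mD mk.
have Fi : cintegrable (fun x => D x * k x).
  split; apply: (le_integrable mS _ _ i4); try exact/measurable_EFinP.
    move=> x Sx; rewrite lee_fin (le_trans (Re_le_cabs _))// (le_trans (bd x Sx))// ler_norm//.
  move=> x Sx; rewrite lee_fin (le_trans (Im_le_cabs _))// (le_trans (bd x Sx))// ler_norm//.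
split=> //; rewrite (le_trans (cintegral_le Fi i4 bd))// ler_wpM2l//.
rewrite RintegralZl//.
have B0 : 0 <= B.
  have [x Sx] : exists x, S x by exists (cptv (head_vec R m)); rewrite /csphere /= cptvK -[head_vec R m]scale1r nsq_head_vec -cabs_sqr cabs1 expr1n.
  exact: le_trans (cabs_ge0 _) (kB x Sx).
rewrite ler_wpM2l// RintegralD// RintegralZl// Rintegral_cst//.
have /= -> := sigma_csphere R n0; rewrite mulr1 lerD2l mulrC ler_wpM2r ?invr_ge0 ?(ltW ep)//.
rewrite -lee_fin /Rintegral fineK//; exact: integrable_fin_num.
Qed.

Lemma radial_ok (h : V -> R[i]^o) (r : R) : holomorphic h -> 0 <= r < 1 ->
  cmeas (radial h r) /\ bdd (radial h r : cpt R n -> R[i]).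
Proof.
move=> hh /andP[r0 r1]; have p0 : 0 < 1 + r ^+ 2 by rewrite ltr_wpDr// sqr_ge0.
have r2 : r ^+ 2 < 1 by rewrite expr_lt1.
(* A squared radius above 1 whose product with [r ^ 2] stays below 1, so that the dilate is
   holomorphic past the sphere. *)
apply: (@cont_cmeas R m (fun z => h (r%:C *: z)) (2 / (1 + r ^+ 2))).
  by rewrite ltr_pdivlMr// mul1r; lra.
move=> z zr; apply: diff_cont; apply: scale_diff; apply: hh; rewrite /cball /= nsqZ csq_real.
apply: (@le_lt_trans _ _ (r ^+ 2 * (2 / (1 + r ^+ 2)))); first by rewrite ler_wpM2l ?sqr_ge0 ?ltW.
by rewrite mulrA ltr_pdivrMr// mul1r; lra.
Qed.

Lemma hardy_radial_limit (h : V -> R[i]^o) (k : cpt R n -> R[i]) : hardy h -> cmeas k -> bdd k ->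
  cintegrable (fun x => bval h x * k x) /\
  ((cintegral (fun x => radial h r x * k x) : R[i]^o) @[r --> 1^'-] -->
    (cintegral (fun x => bval h x * k x) : R[i]^o)).
Proof.
move=> [hh _ mb fb lb] mk bk; have [B0 hB0] := bk.
pose B := `|B0| + 1; have Bp : 0 < B by rewrite ltr_wpDl.
have hB x : S x -> cabs (k x) <= B.
  by move=> Sx; rewrite (le_trans (hB0 x Sx))// (le_trans (ler_norm _))// lerDl.
have [|ib _] := L2_pairing_bound (eta := fine (\int[mu]_(x in S) (csq (bval h x))%:E)) mb mk hB ltr01.
  rewrite fineK// ge0_fin_numE//; apply: integral_ge0 => x _; rewrite lee_fin; exact: csq_ge0.
split=> //; apply/cvg_left => e ep.
(* [L2_pairing_bound] with [eta = e1 * e1] then gives [4 * B * e1], which is [e / 2]. *)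
pose e1 := e / (8 * B).
have e1p : 0 < e1 by rewrite divr_gt0// mulr_gt0.
have := ereal_left lb (mulr_gt0 e1p e1p); apply: filterS2 (near_left_itv ltr01) => r /andP[r0 r1] hr.
have rP : 0 <= r < 1 by rewrite r1 andbT; move: r0; rewrite subrr => /ltW.
have [mr br] := radial_ok hh rP.
have mD : cmeas (fun x => radial h r x - bval h x).
  rewrite (_ : (fun x => _) = fun x => radial h r x + -1 * bval h x).
    by apply: cmeasD => //; apply: cmeasM => //; exact: cmeas_cst.
  by apply/funext => x; rewrite mulN1r.
have [iD bD] := L2_pairing_bound mD mk hB e1p (ltW hr).
have ir : cintegrable (fun x => radial h r x * k x) by apply: cmeas_bdd; [exact: cmeasM|exact: bddM].
have <- : cintegral (fun x => (radial h r x - bval h x) * k x) =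
   cintegral (fun x => radial h r x * k x) - cintegral (fun x => bval h x * k x).
  rewrite -[X in _ - X]mul1r -mulNr -cintegralZ// -cintegralD//; last exact: cintegrableZ.
  by apply: eq_cintegral => x _; ring.
apply: le_lt_trans bD _; rewrite mulfK ?gt_eqF//.
have -> : 2 * (B * (e1 + e1)) = e / 2 by rewrite /e1; field; rewrite gt_eqF.
by rewrite ltr_pdivrMr// ltr_pMr// ltr1n.
Qed.

(** The formula holds for the dilates of [h], holomorphic past the sphere, and both sides pass to
    the limit. The factor [ker b] is used with [b = 0] for plain reproduction and with [b = a] for
    inner products weighted by the squared modulus of a kernel. *)
Lemma hardy_reproduce (h : V -> R[i]^o) (a b : V) : hardy h -> nsq a < 1 -> nsq b < 1 ->
  cintegrable (fun x => bval h x * (ker b (cvec x) * conjc (ker a (cvec x)))) /\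
  cintegral (fun x => bval h x * (ker b (cvec x) * conjc (ker a (cvec x)))) = h a * ker b a.
Proof.
move=> Hh a1 b1; have [ma ba] := ker_ok a1; have [mb bb] := ker_ok b1.
have mk := cmeasM mb (cmeas_conj ma); have bk := bddM bb (bdd_conj ba).
have [ik ck] := hardy_radial_limit Hh mk bk; split=> //.
have hh : holomorphic h by case: Hh.
move/cvg_left/left_lim: ck => <-.
apply: left_lim => e ep.
have K0 : 0 < cabs (ker b a) + 1 by rewrite ltr_wpDl ?cabs_ge0.
have /contC_eps/(_ _ (divr_gt0 ep K0))[d d0 dP] : {for a, continuous h} by apply: diff_cont; exact: hh.
have A0 : 0 < vabs a + 1 by rewrite ltr_wpDl ?vabs_ge0.
apply: filterS2 (near_left_itv ltr01) (near_left_itv (divr_gt0 d0 A0)) => r /andP[r0 r1] /andP[rd _].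
have {}r0 : 0 < r by move: r0; rewrite subrr.
have -> : cintegral (fun x => radial h r x * (ker b (cvec x) * conjc (ker a (cvec x)))) = h (r%:C *: a) * ker b a.
  (* [c] bounds both [r] and the norm of [b], and [c * (2 / (1 + c)) <= 1]: the dilate and [ker b]
     are both holomorphic in the ball of radius [2 / (1 + c) > 1]. *)
  pose c := Num.max r (Num.sqrt (nsq b)).
  have sb : Num.sqrt (nsq b) < 1 by rewrite -sqrtr1 ltr_sqrt.
  have c1 : c < 1 by rewrite gt_max r1.
  have c0 : 0 < c by rewrite lt_max r0.
  have rc : r <= c by rewrite le_max lexx.
  have bc : Num.sqrt (nsq b) <= c by rewrite le_max lexx orbT.
  have p0 : 0 < 1 + c by rewrite ltr_wpDr// ltW.
  have R01 : 1 < 2 / (1 + c) by rewrite ltr_pdivlMr// mul1r; lra.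
  have cR : c * (2 / (1 + c)) <= 1 by rewrite mulrA ler_pdivrMr// mul1r; lra.
  have R0p : 0 < 2 / (1 + c) by rewrite divr_gt0.
  have := @reproducing_formula R m (fun z => h (r%:C *: z) * ker b z) _ a R01 _ a1 => <-; last first.
    move=> z zR; have h1 s : 0 <= s -> s <= c -> s ^+ 2 * nsq z < 1.
      move=> s0 sc; have [->|sn] := eqVneq s 0; first by rewrite expr0n mul0r.
      have sp : 0 < s by rewrite lt_def sn.
      apply: (@lt_le_trans _ _ (s ^+ 2 * (2 / (1 + c)) ^+ 2)); first by rewrite ltr_pM2l// exprn_gt0.
      rewrite -exprMn; apply: exprn_ile1; first by rewrite mulr_ge0// ltW.
      by apply: le_trans cR; rewrite ler_wpM2r// ltW.
    apply: diff_mul; last first.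
      by apply: ker_diff; have := h1 _ (sqrtr_ge0 (nsq b)) bc; rewrite sqr_sqrtr ?nsq_ge0.
    by apply: scale_diff; apply: hh; rewrite /cball /= nsqZ csq_real h1// ltW.
  by apply: eq_cintegral => x _; rewrite /radial mulrA.
rewrite -mulrBl cabsM.
apply: (@le_lt_trans _ _ (e / (cabs (ker b a) + 1) * cabs (ker b a))).
  rewrite ler_wpM2r ?cabs_ge0// ltW//; apply: dP.
  have -> : r%:C *: a - a = (r%:C - 1) *: a by rewrite scalerBl scale1r.
  rewrite vabsZ.
  have -> : cabs (r%:C - 1) = 1 - r.
    by rewrite cabsB -(rmorph1 (real_complex R)) -rmorphB /= cabs_real ger0_norm// subr_ge0 ltW.
  move: rd; rewrite ltrBlDr -ltrBlDl ltr_pdivlMr//; apply: le_lt_trans.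
  by rewrite ler_wpM2l ?lerDl// subr_ge0 ltW.
by rewrite mulrAC ltr_pdivrMr// ltr_pM2l// ltrDl.
Qed.
End HardyLimits.

(** * Kernels as Hardy functions *)

Section HardyKernel.
Variable R : realType.
Variable m : nat.
Local Notation n := m.+1.
Local Notation V := ('rV[R[i]]_n : normedModType R[i]).
Local Notation S := (@csphere R n).
Local Notation mu := (sigma R n).
Let n0 : (0 < n)%N := isT.
Let mS : measurable S := @measurable_csphere R n.

(** Only the values of [f] in the ball are meaningful; [F] is a formula that agrees with it there
    and is continuous up to [x]. *)
Lemma radial_cvg (f F : V -> R[i]) (x : cpt R n) : S x ->
  (forall z, nsq z < 1 -> f z = F z) -> {for (cvec x : V), continuous (F : V -> R[i]^o)} ->
  (radial f r x : R[i]^o) @[r --> 1^'-] --> (F (cvec x) : R[i]^o).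
Proof.
move=> Sx fF /contC_eps cF; apply/cvg_left => e /cF[d d0 dP].
have A0 : 0 < vabs (cvec x : V) + 1 by rewrite ltr_wpDl ?vabs_ge0.
apply: filterS2 (near_left_itv ltr01) (near_left_itv (divr_gt0 d0 A0)) => r /andP[r0 r1] /andP[rd _].
have {}r0 : 0 < r by move: r0; rewrite subrr.
rewrite /radial fF; last by rewrite nsqZ csq_real Sx mulr1 expr_lt1// ltW.
apply: dP.
have -> : r%:C *: cvec x - cvec x = (r%:C - 1) *: cvec x by rewrite scalerBl scale1r.
rewrite vabsZ.
have -> : cabs (r%:C - 1) = 1 - r.
  by rewrite cabsB -(rmorph1 (real_complex R)) -rmorphB /= cabs_real ger0_norm// subr_ge0 ltW.
move: rd; rewrite ltrBlDr -ltrBlDl ltr_pdivlMr//; apply: le_lt_trans.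
by rewrite ler_wpM2l ?lerDl// subr_ge0 ltW.
Qed.

Lemma bval_cont (f F : V -> R[i]) (x : cpt R n) : S x ->
  (forall z, nsq z < 1 -> f z = F z) -> {for (cvec x : V), continuous (F : V -> R[i]^o)} ->
  bval f x = F (cvec x).
Proof. by move=> Sx fF cF; apply/left_lim/cvg_left; exact: radial_cvg. Qed.

Lemma pow_lip (Q : R) k : exists C : R, 0 <= C /\ forall A B : R[i], cabs A <= Q -> cabs B <= Q ->
  cabs (A ^+ k - B ^+ k) <= C * cabs (A - B).
Proof.
elim: k => [|k [C [C0 hC]]].
  by exists 0; split=> // A B _ _; rewrite !expr0 subrr cabs0 mul0r.
exists (`|Q| * C + `|Q| ^+ k); split; first by rewrite addr_ge0 ?mulr_ge0 ?exprn_ge0.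
move=> A B AQ BQ.
have AQ' : cabs A <= `|Q| by rewrite (le_trans AQ)// ler_norm.
have BQ' : cabs B <= `|Q| by rewrite (le_trans BQ)// ler_norm.
have -> : A ^+ k.+1 - B ^+ k.+1 = A * (A ^+ k - B ^+ k) + B ^+ k * (A - B) by rewrite !exprS; ring.
rewrite (le_trans (cabsD _ _))// !cabsM mulrDl -mulrA cabsX lerD//.
  by rewrite ler_pM ?cabs_ge0 ?mulr_ge0 ?cabs_ge0// hC.
by rewrite ler_wpM2r ?cabs_ge0// lerXn2r ?nnegrE ?cabs_ge0.
Qed.

(** A rate uniform in [x], from which [ker_hardy] gets the L^2 convergence of the dilates; the
    denominators stay at distance at least [1 - |u|] from 0. *)
Lemma ker_lip (u : V) : nsq u < 1 -> exists L : R, 0 <= L /\ forall r x, 0 <= r <= 1 -> S x ->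
  cabs (ker u (r%:C *: cvec x) - ker u (cvec x)) <= L * (1 - r).
Proof.
move=> u1; pose s := Num.sqrt (nsq u).
have s1 : s < 1 by rewrite -sqrtr1 ltr_sqrt.
have s0 : 0 <= s := sqrtr_ge0 _.
have d0 : 0 < 1 - s by rewrite subr_gt0.
pose Q := (1 - s)^-1.
have Q0 : 0 < Q by rewrite invr_gt0.
have [C [C0 hC]] := pow_lip Q n.
exists (C * Q ^+ 2); split; first by rewrite mulr_ge0// sqr_ge0.
move=> r x /andP[r0 r1] Sx.
have tP : cabs (cdot u (cvec x)) <= s.
  by rewrite -(@ler_sqr _ (cabs _)) ?nnegrE ?cabs_ge0// cabs_sqr sqr_sqrtr ?nsq_ge0// (le_trans (cauchy_schwarz _ _))// Sx mulr1.
rewrite /ker cdotZr; move: tP; set t := cdot u _ => tP.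
have inv w : cabs w <= s -> cabs (1 - w)^-1 <= Q /\ 1 - w != 0.
  move=> ws; have h : 1 - s <= cabs (1 - w).
    rewrite lerBlDr -[leLHS](@cabs1 R) -[X in cabs X](subrK w) (le_trans (cabsD _ _))// lerD2l//.
  split; first by rewrite cabsV lef_pV2// posrE; exact: lt_le_trans h.
  by rewrite -cabs_gt0; exact: lt_le_trans h.
have rt : cabs (r%:C * t) <= s.
  rewrite cabsM cabs_real ger0_norm// (le_trans _ tP)// -[leRHS]mul1r ler_wpM2r ?cabs_ge0//.
have [a1 a2] := inv _ rt; have [b1 b2] := inv _ tP.
rewrite (le_trans (hC _ _ a1 b1))// -mulrA ler_wpM2l//.
have -> : (1 - r%:C * t)^-1 - (1 - t)^-1 = (1 - r%:C * t)^-1 * (1 - t)^-1 * ((r%:C - 1) * t).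
  by field; rewrite a2 b2.
rewrite !cabsM expr2.
have -> : cabs (r%:C - 1) = 1 - r.
  by rewrite cabsB -(rmorph1 (real_complex R)) -rmorphB /= cabs_real ger0_norm// subr_ge0.
apply: ler_pM; rewrite ?mulr_ge0 ?cabs_ge0 ?subr_ge0//; first by rewrite ler_pM ?cabs_ge0.
by rewrite -[leRHS]mulr1 ler_wpM2l ?subr_ge0// (le_trans tP)// ltW.
Qed.

Lemma ker_cont_near (u z : V) : nsq u < 1 -> nsq z <= 1 -> {for z, continuous (ker u : V -> R[i]^o)}.
Proof.
move=> u1 z1; apply: diff_cont; apply: ker_diff.
by apply: le_lt_trans u1; rewrite -[leRHS]mulr1 ler_wpM2l ?nsq_ge0.
Qed.

Lemma ker_bval (u : V) x : nsq u < 1 -> S x -> bval (ker u) x = ker u (cvec x).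
Proof. by move=> u1 Sx; apply: bval_cont => //; apply: ker_cont_near => //; rewrite Sx. Qed.

Lemma ker_hardy (u : V) : nsq u < 1 -> hardy (ker u).
Proof.
move=> u1; have [mk bk] := ker_ok u1; have [B hB] := bk.
have holk : holomorphic (ker u).
  move=> z z1; apply: ker_diff; apply: le_lt_trans u1.
  by rewrite -[leRHS]mulr1 ler_wpM2l ?nsq_ge0// ltW.
have mb : cmeas (bval (ker u)).
  have [h1 h2] := mk; split.
    by apply: eq_measurable_fun h1 => x; rewrite inE => Sx; rewrite ker_bval.
  by apply: eq_measurable_fun h2 => x; rewrite inE => Sx; rewrite ker_bval.
split=> //.
- apply/aeW => x Sx; apply/cvg_ex; exists (ker u (cvec x)).
  by apply: radial_cvg => //; apply: ker_cont_near => //; rewrite Sx.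
- apply: (@le_lt_trans _ _ (\int[mu]_(x in S) (B ^+ 2)%:E)%E).
    apply: ge0_le_integral => //.
    + by move=> x _; rewrite lee_fin csq_ge0.
    + by apply/measurable_EFinP; have [h1 h2] := mb; apply: measurable_funD; exact: measurable_funX.
    + move=> x Sx; rewrite lee_fin -cabs_sqr ker_bval// ler_pXn2r ?nnegrE ?cabs_ge0 ?hB//.
      exact: le_trans (cabs_ge0 _) (hB x Sx).
  rewrite integral_cst//; have /= -> := sigma_csphere R n0; rewrite mule1 ltry//.
have [L [L0 hL]] := ker_lip u1.
apply: left_ereal => [r|e ep].
  by apply: integral_ge0 => x _; rewrite lee_fin csq_ge0.
have K0 : 0 < L ^+ 2 + 1 by rewrite ltr_wpDl// sqr_ge0.
apply: filterS2 (near_left_itv ltr01) (near_left_itv (divr_gt0 ep K0)) => r /andP[r0 r1] /andP[rd _].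
have {}r0 : 0 < r by move: r0; rewrite subrr.
have rP : 0 <= r < 1 by rewrite ltW.
have [mr br] := radial_ok holk rP.
apply: (@le_trans _ _ (\int[mu]_(x in S) e%:E)%E); last first.
  by rewrite integral_cst//; have /= -> := sigma_csphere R n0; rewrite mule1.
apply: ge0_le_integral => //.
- by move=> x _; rewrite lee_fin csq_ge0.
- apply/measurable_EFinP.
  have [h1 h2] : cmeas (fun x => radial (ker u) r x + -1 * bval (ker u) x).
    by apply: cmeasD => //; apply: cmeasM => //; exact: cmeas_cst.
  rewrite (_ : (fun x => _) = fun x => csq (radial (ker u) r x + -1 * bval (ker u) x)).
    by apply: measurable_funD; exact: measurable_funX.
  by apply/funext => x; rewrite mulN1r.
move=> x Sx; rewrite lee_fin -cabs_sqr ker_bval//.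
have h : cabs (radial (ker u) r x - ker u (cvec x)) <= L * (1 - r).
  by apply: hL => //; rewrite !ltW.
apply: (@le_trans _ _ ((L * (1 - r)) ^+ 2)).
  by rewrite ler_pXn2r ?nnegrE ?cabs_ge0// mulr_ge0// subr_ge0 ltW.
have h1 : (1 - r) ^+ 2 <= 1 - r by rewrite expr2 ger_pMl ?subr_gt0// lerBlDr lerDl ltW.
move: rd; rewrite ltrBlDr -ltrBlDl ltr_pdivlMr// => rd.
rewrite exprMn (le_trans _ (ltW rd))// mulrC.
by apply: ler_pM; rewrite ?sqr_ge0// lerDl.
Qed.
End HardyKernel.

Section ContRules.
Variables (K : numFieldType) (T : topologicalType).
Implicit Types (f g : T -> K^o) (z : T).

Lemma cont_add f g z : {for z, continuous f} -> {for z, continuous g} ->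
  {for z, continuous (fun w => f w + g w : K^o)}.
Proof. by move=> cf cg; apply: cvgD. Qed.

Lemma cont_mul f g z : {for z, continuous f} -> {for z, continuous g} ->
  {for z, continuous (fun w => f w * g w : K^o)}.
Proof. by move=> cf cg; apply: cvgM. Qed.

Lemma cont_sum I (r : seq I) (f : I -> T -> K^o) z : (forall i, {for z, continuous (f i)}) ->
  {for z, continuous (fun w => \sum_(i <- r) f i w : K^o)}.
Proof.
move=> cf; elim: r => [|i r IH].
  rewrite (_ : (fun w => _) = fun=> 0); first exact: cvg_cst.
  by apply/funext => w; rewrite big_nil.
rewrite (_ : (fun w => _) = fun w => f i w + \sum_(j <- r) f j w); first exact: cont_add.
by apply/funext => w; rewrite big_cons.
Qed.
Lemma cont_cst (k : K^o) z : {for z, continuous (fun _ : T => k)}.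
Proof. exact: cvg_cst. Qed.
End ContRules.

Lemma cont_conj (R : realType) (V : normedModType R[i]) (F : V -> R[i]^o) (z : V) :
  {for z, continuous F} -> {for z, continuous (fun w => conjc (F w) : R[i]^o)}.
Proof.
move=> /cont_eps cF; apply/cont_eps => e /cF[d d0 dP]; exists d => // w /dP.
by rewrite !vabsC -conjcB cabs_conj.
Qed.

(** * Consequences of the representation *)

Section SphereZero.
Variable R : realType.
Variable m : nat.
Local Notation n := m.+1.
Local Notation V := ('rV[R[i]]_n : normedModType R[i]).
Local Notation S := (@csphere R n).
Local Notation mu := (sigma R n).
Let mS : measurable S := @measurable_csphere R n.

(** A vanishing integral of [|D|^2] makes [D] vanish almost everywhere on the sphere; if [D z] were
    nonzero, [D] would be nonzero near [z], on a set of positive measure. *)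
Lemma sphere_zero (D : V -> R[i]^o) (z : V) :
  cmeas (fun x => D (cvec x)) -> bdd (fun x : cpt R n => D (cvec x)) ->
  cintegral (fun x : cpt R n => D (cvec x) * conjc (D (cvec x))) = 0 ->
  {for z, continuous D} -> nsq z = 1 -> D z = 0.
Proof.
move=> mD bD ID cD z1; apply/eqP/negPn/negP => Dz.
pose f (x : cpt R n) := csq (D (cvec x)).
have mf : measurable_fun S f.
  by have [h1 h2] := mD; apply: measurable_funD; exact: measurable_funX.
have int0 : (\int[mu]_(x in S) (f x)%:E = 0)%E.
  have [B hB] := bD.
  have fi : mu.-integrable S (EFin \o f).
    apply: (@bdd_integrable R n f (B ^+ 2)) => // x Sx.
    by rewrite ger0_norm ?csq_ge0// /f -cabs_sqr lerXn2r ?nnegrE ?cabs_ge0 ?hB// (le_trans (cabs_ge0 _) (hB x Sx)).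
  have h : \int[mu]_(x in S) f x = 0.
    transitivity (complex.Re (cintegral (fun x : cpt R n => D (cvec x) * conjc (D (cvec x))))); last by rewrite ID.
    by apply: eq_Rintegral => x _; rewrite -csq_cabs.
  have h2 := integrable_fin_num mS fi.
  by rewrite -[LHS]fineK//; congr (_%:E).
pose N := S `&` [set x | 0 < f x].
have mN : measurable N.
  rewrite (_ : N = S `&` f @^-1` `]0, +oo[); first exact: mf.
  by rewrite /N; congr (_ `&` _); apply/seteqP; split => x /=; rewrite in_itv /= andbT.
have N0 : mu N = 0%E.
  have f0 x : S x -> (0 <= (f x)%:E)%E by move=> _; rewrite lee_fin csq_ge0.
  have mE : measurable_fun S (EFin \o f) by exact/measurable_EFinP.
  have [+ _] := @ae_eq_integral_abs _ _ _ mu S mS _ mE.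
  rewrite (eq_integral (fun x => (f x)%:E)); last by move=> x; rewrite inE => Sx; rewrite gee0_abs// f0.
  move=> /(_ int0) [A [mA A0 sA]]; apply/eqP; rewrite eq_le measure_ge0 andbT -A0.
  apply: le_measure; rewrite ?inE// => x [Sx fx]; apply: sA => /= h.
  by have [h0] := h Sx; move: fx; rewrite /= h0 ltxx.
have : (0 < mu N)%E.
  apply: (@sigma_pos R n (fun w : V => D w != 0) z N) => //; last first.
    move=> x Sx Dx; split => //=; rewrite /f -cabs_sqr exprn_gt0// cabs_gt0//.
  have Dp : 0 < cabs (D z) by rewrite cabs_gt0.
  have /contC_eps/(_ _ Dp)[d d0 dP] := cD.
  apply/near_eps; exists d => // y /dP; apply: contraTneq => ->.
  by rewrite sub0r cabsN ltxx.
by rewrite N0 ltxx.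
Qed.
End SphereZero.

Lemma left_lim_mul (R : realType) (F G : R -> R[i]) (k : R[i]) : k != 0 ->
  (G r : R[i]^o) @[r --> 1^'-] --> (k : R[i]^o) ->
  lim ((G r * F r : R[i]^o) @[r --> 1^'-]) = k * lim ((F r : R[i]^o) @[r --> 1^'-]).
Proof.
move=> k0 cG.
exact: (@lim_mul R[i] R (at_left (1:R)) (at_left_proper_filter (1:R)) F G k k0 erefl cG).
Qed.

(** * The representation tested on kernels *)

Section Represent.
Variable R : realType.
Variable m : nat.
Local Notation n := m.+1.
Local Notation V := ('rV[R[i]]_n : normedModType R[i]).
Local Notation S := (@csphere R n).
Let n0 : (0 < n)%N := isT.

Definition onem_nsq (a : 'rV[R[i]]_n) : R := 1 - nsq a.

Lemma nsq0 : nsq (0 : 'rV[R[i]]_n) = 0.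
Proof. by apply: realC_inj; rewrite /= -cdot_self cdot0l. Qed.

Lemma khatE (a z : 'rV[R[i]]_n) : khat a z = (Num.sqrt (onem_nsq a))%:C ^+ n * ker a z.
Proof. by rewrite /khat exprMn. Qed.

Lemma khat_sqr (a : 'rV[R[i]]_n) : nsq a < 1 -> (Num.sqrt (onem_nsq a))%:C ^+ n * (Num.sqrt (onem_nsq a))%:C ^+ n = (onem_nsq a)%:C ^+ n :> R[i].
Proof.
move=> a1; rewrite -exprMn -rmorphM /=; congr (_%:C ^+ _).
by rewrite -expr2 sqr_sqrtr// subr_ge0 ltW.
Qed.

Lemma khat0 z : khat (0 : 'rV[R[i]]_n) z = 1.
Proof. by rewrite /khat nsq0 cdot0l !subr0 sqrtr1 divr1 expr1n. Qed.

Lemma ker0 z : ker (0 : 'rV[R[i]]_n) z = 1.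
Proof. by rewrite /ker cdot0l subr0 invr1 expr1n. Qed.

Lemma kerC (a z : 'rV[R[i]]_n) : conjc (ker a z) = ker z a.
Proof. by rewrite /ker conjcX conjcV conjcB conjc1 -cdotC. Qed.

Lemma ker_self (a : 'rV[R[i]]_n) : nsq a < 1 -> (onem_nsq a)%:C ^+ n * ker a a = 1.
Proof.
move=> a1; rewrite /ker cdot_self -exprMn.
have -> : 1 - (nsq a)%:C = (onem_nsq a)%:C by rewrite /onem_nsq rmorphB rmorph1.
by rewrite divff ?expr1n// (inj_eq (@realC_inj R)) subr_eq0 gt_eqF.
Qed.

Lemma ker_neq0 (a z : 'rV[R[i]]_n) : nsq a < 1 -> nsq z <= 1 -> ker a z != 0.
Proof.
move=> a1 z1; rewrite expf_neq0// invr_neq0// cdot_neq1//.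
by apply: le_lt_trans a1; rewrite -[leRHS]mulr1 ler_wpM2l ?nsq_ge0.
Qed.

Lemma khat_neq0 (a z : 'rV[R[i]]_n) : nsq a < 1 -> nsq z <= 1 -> khat a z != 0.
Proof.
move=> a1 z1; rewrite khatE mulf_neq0 ?ker_neq0// expf_neq0//.
by rewrite (inj_eq (@realC_inj R)) gt_eqF// sqrtr_gt0 subr_gt0.
Qed.

Lemma khat_cont (a z : V) : nsq a < 1 -> nsq z <= 1 -> {for z, continuous (khat a : V -> R[i]^o)}.
Proof.
move=> a1 z1; rewrite (_ : khat a = fun w : V => (Num.sqrt (onem_nsq a))%:C ^+ n * ker a w).
  by apply: (@cont_mul R[i] V (fun=> _)); [exact: cont_cst|exact: ker_cont_near].
by apply/funext => w; exact: khatE.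
Qed.

(** [f] is arbitrary and [x] any point of the sphere: [left_lim_mul] also covers the points where
    the radial limit of [f] does not exist, both sides being 0. *)
Lemma bval_khat (a : V) f (x : cpt R n) : nsq a < 1 -> S x ->
  bval (fun z => khat a z * f z) x = khat a (cvec x) * bval f x.
Proof.
move=> a1 Sx; have h := @radial_cvg R m (khat a) (khat a) x Sx (fun _ _ => erefl).
have x1 : nsq (cvec x) <= 1 by rewrite Sx.
have e := left_lim_mul (radial f ^~ x) (khat_neq0 a1 x1) (h (khat_cont a1 x1)).
exact: e.
Qed.

Variables (M : nat) (a : 'I_M -> 'rV[R[i]]_n) (theta : 'I_M.+1 -> R) (psi : 'rV[R[i]]_n -> R[i]).
Hypothesis a1 : forall k, cball (a k).
Hypothesis hpsi : normalized_invertible_multiplier psi.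
Hypothesis hrep : represents a theta psi.
Local Notation b := (node a).

Lemma node_ball i : nsq (b i) < 1.
Proof.
rewrite /node; case: unliftP => [j _|_] /=; first exact: a1.
by rewrite nsq0.
Qed.

Lemma represents_node f g : hardy f -> hardy g ->
  \sum_i (theta i)%:C * hinner (fun z => khat (b i) z * f z) (fun z => khat (b i) z * g z) =
  hinner (fun z => psi z * f z) (fun z => psi z * g z).
Proof.
move=> hf hg; have e := hrep hf hg.
pose T (c : 'rV[R[i]]_n) := hinner (fun z => khat c z * f z) (fun z => khat c z * g z).
have N0 : b ord0 = 0 by rewrite /node unlift_none.
have Nk k : b (lift ord0 k) = a k by rewrite /node liftK.
have h0 (h : 'rV[R[i]]_n -> R[i]) : (fun z => khat 0 z * h z) = h.
  by apply/funext => z; rewrite khat0 mul1r.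
have T0 : T (b ord0) = hinner f g by rewrite N0; exact: f_equal2 (h0 f) (h0 g).
apply: etrans e; rewrite big_ord_recl -/(T _) T0; apply: f_equal2; first by [].
by apply: eq_bigr => k _; rewrite Nk.
Qed.

Lemma psi_neq0 z : nsq z < 1 -> psi z != 0.
Proof. by have [h _ _ _] := hpsi => z1; exact: (h z z1). Qed.

(** Against [ker u / psi], the right-hand side of the representation loses its second [psi] and
    reproduces [psi] at [u]. The constant 1 enters as [ker 0]. *)
Lemma psi_formula u : nsq u < 1 ->
  psi u = \sum_i (theta i)%:C / conjc (psi (b i)) * ker (b i) u.
Proof.
move=> u1; have [_ m1 m2 _] := hpsi.
pose g z := (psi z)^-1 * ker u z.
have z1 : nsq (0 : 'rV[R[i]]_n) < 1 by rewrite nsq0.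
have hg : hardy g by apply: m2; exact: ker_hardy.
have h1 : hardy (ker (0 : 'rV[R[i]]_n)) by exact: ker_hardy.
have hp : hardy (fun z => psi z * ker 0 z) by exact: m1.
have := represents_node h1 hg.
have -> : hinner (fun z => psi z * ker 0 z) (fun z => psi z * g z) = psi u.
  have [_ e] := hardy_reproduce hp u1 z1; rewrite !ker0 !mulr1 in e; rewrite -[RHS]e.
  apply: eq_cintegral => x Sx; rewrite ker0 mul1r; congr (_ * conjc _).
  apply: bval_cont => //; last by apply: ker_cont_near => //; rewrite Sx.
  by move=> z zb; rewrite /g mulVKf// psi_neq0.
move=> <-; apply: eq_bigr => i _; have bi := node_ball i.
rewrite -mulrA; congr (_ * _).
have [ie e] := hardy_reproduce hg bi bi.
(* The squared normalization of [khat] cancels the value of [ker (b i)] at [b i], so that only the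
   conjugate of [g (b i)] remains. *)
have wk := ker_self bi.
transitivity (conjc ((onem_nsq (b i))%:C ^+ n * (g (b i) * ker (b i) (b i)))); last first.
  by rewrite mulrCA wk mulr1 /g conjcM conjcV kerC.
rewrite -e -cintegralZ// -cintegral_conj; last exact: cintegrableZ.
apply: eq_cintegral => x Sx; rewrite !bval_khat// ker_bval// ker0 mulr1.
rewrite -(khat_sqr bi) !conjcM conjcK khatE !conjcM conjcX conjc_real; ring.
Qed.

(** An extension of [psi] that is continuous up to the sphere; boundary values of [psi] are computed
    through it. *)
Definition psi_sum (z : 'rV[R[i]]_n) : R[i] := \sum_i (theta i)%:C / conjc (psi (b i)) * ker (b i) z.

Definition modulus_gap (z : 'rV[R[i]]_n) : R[i] :=
  psi_sum z * conjc (psi_sum z) - \sum_i (theta i)%:C * (khat (b i) z * conjc (khat (b i) z)).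

Lemma psi_sum_cont (z : V) : nsq z <= 1 -> {for z, continuous (psi_sum : V -> R[i]^o)}.
Proof.
move=> z1; apply: cont_sum => i; apply: (@cont_mul R[i] V (fun=> _)); first exact: cont_cst.
by apply: ker_cont_near => //; exact: node_ball.
Qed.

Lemma modulus_gap_cont (z : V) : nsq z <= 1 -> {for z, continuous (modulus_gap : V -> R[i]^o)}.
Proof.
move=> z1; rewrite (_ : modulus_gap = fun w : V => psi_sum w * conjc (psi_sum w) +
   \sum_i (- (theta i)%:C) * (khat (b i) w * conjc (khat (b i) w))).
  apply: cont_add.
    by apply: cont_mul; [exact: psi_sum_cont|apply: cont_conj; exact: psi_sum_cont].
  apply: cont_sum => i; apply: (@cont_mul R[i] V (fun=> _)); first exact: cont_cst.
  have ck := khat_cont (node_ball i) z1.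
  exact: (@cont_mul R[i] V _ _ z ck (cont_conj ck)).
by apply/funext => w; rewrite /modulus_gap -sumrN; congr (_ + _); apply: eq_bigr => i _; rewrite mulNr.
Qed.

Lemma modulus_gap_orth i j :
  cintegral (fun x : cpt R n => modulus_gap (cvec x) * (ker (b i) (cvec x) * conjc (ker (b j) (cvec x)))) = 0.
Proof.
have bb := node_ball.
have [mi bi] := ker_ok (bb i); have [mj bj] := ker_ok (bb j).
pose kk (x : cpt R n) := ker (b i) (cvec x) * conjc (ker (b j) (cvec x)).
have mk : cmeas kk := cmeasM mi (cmeas_conj mj).
have bk : bdd kk := bddM bi (bdd_conj bj).
have kok l : cmeas (fun x : cpt R n => khat (b l) (cvec x)) /\ bdd (fun x : cpt R n => khat (b l) (cvec x)).
  have [h1 h2] := ker_ok (bb l).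
  rewrite (_ : (fun x => _) = fun x : cpt R n => (Num.sqrt (onem_nsq (b l)))%:C ^+ n * ker (b l) (cvec x)); last first.
    by apply/funext => x; exact: khatE.
  by split; [exact: (cmeasM (cmeas_cst n _) h1)|exact: (bddM (bdd_cst n _) h2)].
have pok : cmeas (fun x : cpt R n => psi_sum (cvec x)) /\ bdd (fun x : cpt R n => psi_sum (cvec x)).
  split; [apply: cmeas_sum => l; exact: (cmeasM (cmeas_cst n _) (ker_ok (bb l)).1)
         |apply: bdd_sum => l; exact: (bddM (bdd_cst n _) (ker_ok (bb l)).2)].
pose G l (x : cpt R n) := (theta l)%:C * ((khat (b l) (cvec x) * conjc (khat (b l) (cvec x))) * kk x).
have iG0 l : cintegrable (fun x : cpt R n => (khat (b l) (cvec x) * conjc (khat (b l) (cvec x))) * kk x).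
  have [h1 h2] := kok l; apply: cmeas_bdd.
    exact: (cmeasM (cmeasM h1 (cmeas_conj h1)) mk).
  exact: (bddM (bddM h2 (bdd_conj h2)) bk).
have iG l : cintegrable (G l) by apply: cintegrableZ.
have [iS eS] := @cintegral_sum R n n0 _ (index_enum 'I_M.+1) G iG.
have iP : cintegrable (fun x : cpt R n => (psi_sum (cvec x) * conjc (psi_sum (cvec x))) * kk x).
  have [h1 h2] := pok; apply: cmeas_bdd.
    exact: (cmeasM (cmeasM h1 (cmeas_conj h1)) mk).
  exact: (bddM (bddM h2 (bdd_conj h2)) bk).
have := represents_node (ker_hardy (bb i)) (ker_hardy (bb j)).
have -> : hinner (fun z => psi z * ker (b i) z) (fun z => psi z * ker (b j) z) =
   cintegral (fun x : cpt R n => (psi_sum (cvec x) * conjc (psi_sum (cvec x))) * kk x).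
  apply: eq_cintegral => x Sx.
  have hb l : bval (fun z => psi z * ker (b l) z) x = psi_sum (cvec x) * ker (b l) (cvec x).
    have x1 : nsq (cvec x) <= 1 by rewrite Sx.
    apply: (@bval_cont R m _ (fun z => psi_sum z * ker (b l) z)) => //.
      by move=> z zb; rewrite psi_formula.
    by apply: cont_mul; [exact: psi_sum_cont|apply: ker_cont_near].
  rewrite !hb conjcM /kk; ring.
have -> : \sum_l (theta l)%:C * hinner (fun z => khat (b l) z * ker (b i) z) (fun z => khat (b l) z * ker (b j) z) =
  \sum_l cintegral (G l).
  apply: eq_bigr => l _; rewrite /G cintegralZ//; congr (_ * _); apply: eq_cintegral => x Sx.
  rewrite !bval_khat// !ker_bval// conjcM /kk; ring.
rewrite -eS => e.
rewrite (@eq_cintegral _ _ _ (fun x => psi_sum (cvec x) * conjc (psi_sum (cvec x)) * kk x + -1 * (\sum_l G l x))).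
  rewrite cintegralD//; last exact: cintegrableZ.
  by rewrite cintegralZ// e mulN1r subrr.
move=> x _; have -> : \sum_l G l x = (\sum_i (theta i)%:C * (khat (b i) (cvec x) * conjc (khat (b i) (cvec x)))) * kk x.
  by rewrite mulr_suml; apply: eq_bigr => l _; rewrite /G mulrA.
by rewrite /modulus_gap mulrBl mulN1r.
Qed.

Lemma modulus_gap_eq0 (z : V) : nsq z = 1 -> modulus_gap z = 0.
Proof.
have bb := node_ball.
have [mD bD] : cmeas (fun x : cpt R n => modulus_gap (cvec x)) /\ bdd (fun x : cpt R n => modulus_gap (cvec x)).
  have pok : cmeas (fun x : cpt R n => psi_sum (cvec x)) /\ bdd (fun x : cpt R n => psi_sum (cvec x)).
    split; [apply: cmeas_sum => l; exact: (cmeasM (cmeas_cst n _) (ker_ok (bb l)).1)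
           |apply: bdd_sum => l; exact: (bddM (bdd_cst n _) (ker_ok (bb l)).2)].
  have -> : (fun x : cpt R n => modulus_gap (cvec x)) = fun x : cpt R n => psi_sum (cvec x) * conjc (psi_sum (cvec x)) +
    \sum_i (- (theta i)%:C * (onem_nsq (b i))%:C ^+ n) * (ker (b i) (cvec x) * conjc (ker (b i) (cvec x))).
    apply/funext => x; rewrite /modulus_gap -sumrN; congr (_ + _).
    by apply: eq_bigr => i _; rewrite -(khat_sqr (bb i)) khatE conjcM conjcX conjc_real; ring.
  have [h1 h2] := pok; split.
    apply: (cmeasD (cmeasM h1 (cmeas_conj h1))); apply: cmeas_sum => i.
    have [mi _] := ker_ok (bb i).
    exact: (cmeasM (cmeas_cst n _) (cmeasM mi (cmeas_conj mi))).
  apply: (bddD (bddM h2 (bdd_conj h2))); apply: bdd_sum => i.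
  have [_ bi] := ker_ok (bb i).
  exact: (bddM (bdd_cst n _) (bddM bi (bdd_conj bi))).
move=> z1; apply: (@sphere_zero R m modulus_gap) => //; last by apply: modulus_gap_cont; rewrite z1.
(* Integrability travels with the vanishing of the integral, so that [ort] is stable under linear
   combinations. *)
pose ort (G : cpt R n -> R[i]) := cintegrable (fun x => modulus_gap (cvec x) * G x) /\ cintegral (fun x => modulus_gap (cvec x) * G x) = 0.
have ortK i j : ort (fun x => ker (b i) (cvec x) * conjc (ker (b j) (cvec x))).
  split; last exact: modulus_gap_orth.
  have [mi bi] := ker_ok (bb i); have [mj bj] := ker_ok (bb j).
  apply: cmeas_bdd; first exact: (cmeasM mD (cmeasM mi (cmeas_conj mj))).
  exact: (bddM bD (bddM bi (bdd_conj bj))).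
have ortZ k G : ort G -> ort (fun x => k * G x).
  move=> [h1 h2]; rewrite /ort (_ : (fun x => _) = fun x => k * (modulus_gap (cvec x) * G x)).
    by split; [exact: cintegrableZ|rewrite cintegralZ// h2 mulr0].
  by apply/funext => x; ring.
have ortS (I : finType) (G : I -> cpt R n -> R[i]) : (forall i, ort (G i)) -> ort (fun x => \sum_i G i x).
  move=> h; have [h1 h2] := @cintegral_sum R n n0 _ (index_enum I) (fun i x => modulus_gap (cvec x) * G i x) (fun i => (h i).1).
  rewrite /ort (_ : (fun x => _) = fun x => \sum_i modulus_gap (cvec x) * G i x).
    by split=> //; rewrite h2 big1// => i _; exact: (h i).2.
  by apply/funext => x; rewrite mulr_sumr.
have ortD G H : ort G -> ort H -> ort (fun x => G x + H x).
  move=> [h1 h2] [h3 h4]; rewrite /ort (_ : (fun x => _) = fun x => modulus_gap (cvec x) * G x + modulus_gap (cvec x) * H x).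
    by split; [exact: cintegrableD|rewrite cintegralD// h2 h4 addr0].
  by apply/funext => x; rewrite mulrDr.
suff [] : ort (fun x => conjc (modulus_gap (cvec x))) by [].
have -> : (fun x => conjc (modulus_gap (cvec x))) = fun x : cpt R n =>
   (\sum_i \sum_j ((theta i)%:C / conjc (psi (b i)) * conjc ((theta j)%:C / conjc (psi (b j)))) *
      (ker (b i) (cvec x) * conjc (ker (b j) (cvec x)))) +
   \sum_i (- (theta i)%:C * (onem_nsq (b i))%:C ^+ n) * (ker (b i) (cvec x) * conjc (ker (b i) (cvec x))).
  apply/funext => x.
  have -> : conjc (modulus_gap (cvec x)) = modulus_gap (cvec x).
    rewrite /modulus_gap conjcB conjcM conjcK mulrC; congr (_ - _); rewrite conjc_sum; apply: eq_bigr => i _.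
    by rewrite !conjcM conjcK conjc_real [conjc _ * _]mulrC.
  rewrite /modulus_gap -sumrN; congr (_ + _).
    rewrite /psi_sum conjc_sum mulr_suml; apply: eq_bigr => i _; rewrite mulr_sumr; apply: eq_bigr => j _.
    by rewrite [conjc (_ * ker _ _)]conjcM; ring.
  by apply: eq_bigr => i _; rewrite -(khat_sqr (bb i)) khatE conjcM conjcX conjc_real; ring.
apply: (ortD); last by apply: (ortS) => i; exact: ortZ.
by apply: (ortS) => i; apply: (ortS) => j; exact: ortZ.
Qed.
End Represent.

(** * Comparing poles *)

Section Generic.
Variable R : realType.
Variable m : nat.
Local Notation n := m.+1.
Implicit Types (c d v w z : 'rV[R[i]]_n).

Lemma poly_eq0_infinite_roots (p : {poly R[i]}) (f : nat -> R[i]) : injective f -> (forall j, p.[f j] = 0) -> p = 0.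
Proof.
move=> fi fp; apply/eqP/negPn/negP => p0.
have := @max_poly_roots _ p (map f (iota 0 (size p))) p0.
rewrite map_inj_uniq// iota_uniq size_map size_iota ltnn => h.
suff : false by []. apply: h => //.
by apply/allP => _ /mapP[j _ ->]; rewrite /root fp.
Qed.

(** The quotients of [1 + j i] by its conjugate are pairwise distinct and unimodular. *)
Lemma circle_infinite (k : R[i]) : k != 0 -> exists f : nat -> R[i], injective f /\
  forall j, f j != 0 /\ csq (f j) = csq k.
Proof.
move=> k0; pose u j : R[i] := 1 +i* j%:R.
have u0 j : u j != 0 by apply/eqP => -[/eqP]; rewrite oner_eq0.
have cu0 j : conjc (u j) != 0 by rewrite conjc_eq0.
exists (fun j => k * (u j / conjc (u j))); split=> [i j /(mulfI k0)|j].
  have h (l : nat) : u l = 2 - conjc (u l) by rewrite /u /=; simpc; congr (_ +i* _); ring.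
  have q l : u l / conjc (u l) = 2 / conjc (u l) - 1 by rewrite {1}h mulrBl divff.
  have t0 : 2 != 0 :> R[i] by rewrite pnatr_eq0.
  rewrite !q => /addIr/(mulfI t0)/invr_inj/(congr1 (@conjc R)).
  by rewrite !conjcK => -[] /eqP; rewrite eqr_nat => /eqP.
split; first by rewrite !mulf_neq0// invr_neq0.
rewrite csqM -[RHS]mulr1; congr (_ * _).
rewrite -cabs_sqr cabsM cabsV cabs_conj divff ?expr1n//.
by rewrite cabs_eq0.
Qed.

(** An affine function of [t] that is not identically 0 has no zero in some interval []0, d[];
    finitely many are treated at once. *)
Lemma small_avoid (l : seq (R[i] * R[i])) : all (fun p => (p.1 != 0) || (p.2 != 0)) l ->
  exists2 d : R, 0 < d & forall t : R, 0 < t < d -> all (fun p => p.1 + t%:C * p.2 != 0) l.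
Proof.
elim: l => [_|[A B] l IH /= /andP[AB /IH[d d0 dP]]]; first by exists 1.
have B0 : 0 < cabs B + 1 by rewrite ltr_wpDl ?cabs_ge0.
have [A0|A0] := eqVneq A 0.
  exists d => // t td; have /andP[t0 _] := td; rewrite dP// andbT A0 add0r mulf_neq0//.
    by rewrite (inj_eq (@realC_inj R)) gt_eqF.
  by move: AB; rewrite A0 eqxx.
exists (Num.min d (cabs A / (cabs B + 1))).
  by rewrite lt_min d0 divr_gt0// cabs_gt0.
move=> t /andP[t0]; rewrite lt_min => /andP[td tA].
rewrite dP ?t0// andbT; apply: contraTneq tA => h.
rewrite -leNgt ler_pdivrMr//.
have -> : A = - (t%:C * B) by apply/eqP; rewrite -addr_eq0 h.
by rewrite cabsN cabsM cabs_real gtr0_norm// ler_wpM2l ?(ltW t0)// lerDl.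
Qed.

(** Finitely many hyperplanes do not cover the space. A vector good for the tail of the list is
    moved slightly along the new vector [e], whose product with itself is nonzero. *)
Lemma generic_vector (l : seq 'rV[R[i]]_n) : all (fun d => d != 0) l ->
  exists w, all (fun d => cdot d w != 0) l.
Proof.
elim: l => [_|e l IH /= /andP[e0 /IH[w wP]]]; first by exists 0.
pose L := (cdot e w, cdot e e) :: [seq (cdot d w, cdot d e) | d <- l].
have [|t t0 tP] := @small_avoid L.
  rewrite /= cdot_self (inj_eq (@realC_inj R)).
  rewrite (contra_neq (@nsq_eq0 R n e))// orbT /=.
  by rewrite all_map; apply: sub_all wP => d /= ->.
have t2 : 0 < t / 2 < t by rewrite divr_gt0//= ltr_pdivrMr// ltr_pMr// ltr1n.
exists (w + (t / 2)%:C *: e).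
have /= /andP[h1 h2] := tP _ t2.
rewrite cdotDr cdotZr h1 /=; move: h2; rewrite all_map; apply: sub_all => d /=.
by rewrite cdotDr cdotZr.
Qed.
End Generic.

(** The sum [psi_sum] regrouped: [s] is meant to list the nodes without repetition and [W] to give
    their total weights. *)
Definition kernel_sum (R : realType) (n : nat) (s : seq 'rV[R[i]]_n) (W : 'rV[R[i]]_n -> R)
    (psi : 'rV[R[i]]_n -> R[i]) (z : 'rV[R[i]]_n) : R[i] :=
  \sum_(c <- s) (W c)%:C / conjc (psi c) * ker c z.

(** * The pole identity *)

Section PoleIdentity.
Variable R : realType.
Variable m : nat.
Local Notation n := m.+1.
Implicit Types (c d v w z : 'rV[R[i]]_n).
Variables (s : seq 'rV[R[i]]_n) (W : 'rV[R[i]]_n -> R) (psi : 'rV[R[i]]_n -> R[i]).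
Hypothesis us : uniq s.
Hypothesis sball : forall c, c \in s -> nsq c < 1.
Hypothesis W0 : forall c, c \in s -> 0 < W c.
Hypothesis psi0 : forall z, nsq z < 1 -> psi z != 0.
Local Notation P := (kernel_sum s W psi).
Hypothesis psiE : forall z, nsq z < 1 -> psi z = P z.
Hypothesis sphereE : forall z, nsq z = 1 ->
  P z * conjc (P z) = \sum_(c <- s) (W c)%:C * (onem_nsq c)%:C ^+ n * (ker c z * conjc (ker c z)).

Let C c : R[i] := (W c)%:C / conjc (psi c).

(* On the circle {mu v} of the sphere, the modulus identity is one between
   rational functions of mu, since conj mu = 1 / (mu |v|^2); the equation is
   the comparison of their residues at the pole mu = 1 / cdot k v. *)
Lemma pole_identity v k : v != 0 -> k \in s -> cdot k v != 0 ->
  (forall c, c \in s -> c != k -> cdot c v != cdot k v) ->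
  let z := (conjc (cdot k v) / (nsq v)%:C) *: v in
  psi z * (1 - cdot k z) ^+ n = psi k * (onem_nsq k)%:C ^+ n.
Proof.
move=> v0 ks bk0 bk z.
have N0 : nsq v != 0 by apply: contra_neq v0 => /nsq_eq0.
have Np : 0 < nsq v by rewrite lt_def N0 nsq_ge0.
have NC : (nsq v)%:C != 0 :> R[i] by rewrite (inj_eq (@realC_inj R)).
pose N : R[i] := (nsq v)%:C.
(* At [mu *: v] on the sphere the denominator of [ker c] is a power of [1 - be c * mu], whose
   conjugate is [(mu - ga c) / mu] because [conjc mu] is [(mu * N)^-1]. *)
pose be c := cdot c v; pose ga c := conjc (be c) / N.
pose T c : {poly R[i]} := \prod_(d <- s | d != c) (1 - be d *: 'X) ^+ n.
pose U c : {poly R[i]} := \prod_(d <- s | d != c) ('X - (ga d)%:P) ^+ n.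
(* The modulus identity multiplied by all denominators, up to a power of [mu]. *)
pose Q : {poly R[i]} := (\sum_(c <- s) C c *: T c) * (\sum_(c <- s) conjc (C c) *: U c) -
   \sum_(c <- s) ((W c)%:C * (onem_nsq c)%:C ^+ n) *: (T c * U c).
have zk c : cdot c z = be c * (conjc (be k) / N) by rewrite /z cdotZr mulrC.
have zball : nsq z < 1.
  rewrite /z nsqZ csqM -!cabs_sqr cabs_conj cabsV cabs_sqr cabs_real gtr0_norm//.
  rewrite exprVn expr2 invfM -!mulrA mulVf// mulr1 ltr_pdivrMr// mul1r.
  apply: le_lt_trans (cauchy_schwarz _ _) _; rewrite -[ltRHS]mul1r ltr_pM2r// sball//.
have Thorner c x : (T c).[x] = \prod_(d <- s | d != c) (1 - be d * x) ^+ n.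
  by rewrite /T horner_prod; apply: eq_bigr => d _; rewrite !hornerE.
have Uhorner c x : (U c).[x] = \prod_(d <- s | d != c) (x - ga d) ^+ n.
  by rewrite /U horner_prod; apply: eq_bigr => d _; rewrite !hornerE.
have Qhorner x : Q.[x] = (\sum_(c <- s) C c * (T c).[x]) * (\sum_(c <- s) conjc (C c) * (U c).[x]) -
   \sum_(c <- s) ((W c)%:C * (onem_nsq c)%:C ^+ n) * ((T c).[x] * (U c).[x]).
  rewrite /Q hornerD hornerN hornerM !horner_sum; congr (_ * _ - _); apply: eq_bigr => c _;
    by rewrite !hornerE.
have Q0 : Q = 0.
  have [|f [fi fP]] := @circle_infinite R (Num.sqrt (nsq v))^-1%:C.
    by rewrite (inj_eq (@realC_inj R)) invr_eq0 gt_eqF// sqrtr_gt0.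
  apply: (poly_eq0_infinite_roots fi) => j; have [mu0 mu2] := fP j; set mu := f j in mu0 mu2 *.
  have {}mu2 : csq mu * nsq v = 1.
    by rewrite mu2 csq_real exprVn sqr_sqrtr ?nsq_ge0// mulVf.
  have x1 : nsq (mu *: v) = 1 by rewrite nsqZ.
  have cm : conjc mu = (mu * N)^-1.
    apply: (mulfI mu0); rewrite -csq_cabs invfM mulrA divff// mul1r -fmorphV /=; congr (_%:C).
    by apply: (mulIf N0); rewrite mu2 mulVf.
  have a0 c : c \in s -> 1 - be c * mu != 0.
    move=> cs; have := @cdot_neq1 R n c (mu *: v); rewrite x1 mulr1 cdotZr mulrC; apply; exact: sball.
  have kE c : c \in s -> ker c (mu *: v) = (1 - be c * mu)^-1 ^+ n by move=> cs; rewrite /ker cdotZr mulrC.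
  have b0 c : c \in s -> mu - ga c != 0 /\ conjc (ker c (mu *: v)) = mu ^+ n * (mu - ga c)^-1 ^+ n.
    move=> cs; have h : mu - ga c = mu * conjc (1 - be c * mu).
      rewrite conjcB conjc1 conjcM cm mulrBr mulr1; congr (_ - _).
      by rewrite /ga; field; apply/andP; split; [exact: NC|exact: mu0].
    have h0 : mu - ga c != 0 by rewrite h mulf_neq0// conjc_eq0 a0.
    split=> //; rewrite kE// conjcX conjcV h -exprMn; congr (_ ^+ _).
    by rewrite invfM mulrA divff// mul1r.
  pose A := \prod_(d <- s) (1 - be d * mu) ^+ n; pose B := \prod_(d <- s) (mu - ga d) ^+ n.
  have TE c : c \in s -> (T c).[mu] = A * (1 - be c * mu)^-1 ^+ n.
    move=> cs; rewrite Thorner /A (bigD1_seq c)//= mulrAC -exprMn divff ?a0// expr1n mul1r//.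
  have UE c : c \in s -> (U c).[mu] = B * (mu - ga c)^-1 ^+ n.
    move=> cs; have [h _] := b0 _ cs.
    rewrite Uhorner /B (bigD1_seq c)//= mulrAC -exprMn divff// expr1n mul1r//.
  apply: (mulfI (expf_neq0 n mu0)); rewrite mulr0 Qhorner.
  have := sphereE x1.
  have -> : P (mu *: v) = \sum_(c <- s) C c * (1 - be c * mu)^-1 ^+ n.
    by rewrite /kernel_sum; apply: eq_big_seq => c cs; rewrite kE.
  rewrite conjc_sum => e.
  have eA : \sum_(c <- s) C c * (T c).[mu] = A * \sum_(c <- s) C c * (1 - be c * mu)^-1 ^+ n.
    by rewrite mulr_sumr; apply: eq_big_seq => c cs; rewrite TE// mulrCA.
  have eB : mu ^+ n * (\sum_(c <- s) conjc (C c) * (U c).[mu]) =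
     B * \sum_(c <- s) conjc (C c * (1 - be c * mu)^-1 ^+ n).
    rewrite !mulr_sumr; apply: eq_big_seq => c cs; rewrite UE// conjcM -(kE c cs) (b0 _ cs).2; ring.
  have eC : mu ^+ n * (\sum_(c <- s) ((W c)%:C * (onem_nsq c)%:C ^+ n) * ((T c).[mu] * (U c).[mu])) =
     A * B * \sum_(c <- s) (W c)%:C * (onem_nsq c)%:C ^+ n * (ker c (mu *: v) * conjc (ker c (mu *: v))).
    rewrite !mulr_sumr; apply: eq_big_seq => c cs; rewrite TE// UE// (b0 _ cs).2 kE//; ring.
  rewrite mulrBr mulrCA eA eB eC -e; ring.
(* At the pole of [ker k] each [T c] with [c != k] contains the vanishing factor of [k]; [T k] does
   not vanish since no other [be c] equals [be k]. *)
have := Qhorner (be k)^-1; rewrite Q0 horner0 => /esym/eqP; rewrite subr_eq0 => /eqP.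
set x := (be k)^-1.
have Tz c : c \in s -> c != k -> (T c).[x] = 0.
  move=> cs ck; rewrite Thorner; apply/eqP; rewrite prodf_seq_eq0; apply/hasP; exists k => //.
  by rewrite eq_sym ck /= expf_eq0 /= divff// subrr.
have Tk0 : (T k).[x] != 0.
  rewrite Thorner prodf_seq_neq0; apply/allP => d ds; apply/implyP => dk.
  rewrite expf_neq0// subr_eq0; apply/eqP => h; have /eqP := bk d ds dk; apply.
  by apply: (mulIf (invr_neq0 bk0)); rewrite -/(be d) -h divff.
(* The parameter of [z] on the line is the reflection of [x] in the circle, so the factors of [U] at
   [x] are, up to [x], conjugates of the denominators of the kernels at [z]. *)
have g0 c : c \in s -> x - ga c != 0 /\ conjc (ker c z) = x ^+ n * (x - ga c)^-1 ^+ n.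
  move=> cs.
  have h : x - ga c = x * conjc (1 - cdot c z).
    rewrite conjcB conjc1 zk !conjcM conjcV conjcK conjc_real mulrBr mulr1; congr (_ - _).
    by rewrite /ga /x; field; apply/andP; split; [exact: NC|exact: bk0].
  have z0 : 1 - cdot c z != 0.
    apply: cdot_neq1; apply: (@le_lt_trans _ _ (nsq c)); last exact: sball.
    by rewrite -[leRHS]mulr1 ler_wpM2l ?nsq_ge0// ltW.
  have x0 : x != 0 by rewrite invr_neq0.
  split; first by rewrite h mulf_neq0// conjc_eq0.
  by rewrite /ker conjcX conjcV h -exprMn invfM mulrA divff// mul1r.
rewrite (bigD1_seq k)//= big1_seq ?addr0; last by move=> c /andP[ck cs]; rewrite Tz ?mulr0.
rewrite [RHS](bigD1_seq k)//= [X in _ + X]big1_seq ?addr0; last by move=> c /andP[ck cs]; rewrite Tz ?mul0r ?mulr0.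
pose B := \prod_(d <- s) (x - ga d) ^+ n.
have B0 : B != 0 by rewrite prodf_seq_neq0; apply/allP => d ds /=; rewrite expf_neq0// (g0 _ ds).1.
have UE c : c \in s -> (U c).[x] = B * (x - ga c)^-1 ^+ n.
  move=> cs; have [h _] := g0 _ cs.
  rewrite Uhorner /B (bigD1_seq c)//= mulrAC -exprMn divff// expr1n mul1r//.
move=> e.
have {}e : C k * (\sum_(c <- s) conjc (C c) * (U c).[x]) = ((W k)%:C * (onem_nsq k)%:C ^+ n) * (U k).[x].
  by apply: (mulfI Tk0); rewrite mulrA [_ * C k]mulrC e; ring.
have x0 : x ^+ n != 0 by rewrite expf_neq0// invr_neq0.
have eP : x ^+ n * (\sum_(c <- s) conjc (C c) * (U c).[x]) = B * conjc (psi z).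
  rewrite psiE// /kernel_sum conjc_sum !mulr_sumr; apply: eq_big_seq => c cs.
  by rewrite UE// [conjc (_ * ker _ _)]conjcM (g0 _ cs).2 -/(C c); ring.
have {}e : C k * conjc (psi z) = ((W k)%:C * (onem_nsq k)%:C ^+ n) * conjc (ker k z).
  apply: (mulfI B0); rewrite mulrCA -eP (g0 _ ks).2 mulrCA e UE//; ring.
have Wk0 : (W k)%:C != 0 :> R[i] by rewrite (inj_eq (@realC_inj R)) gt_eqF// W0.
have pk0 : conjc (psi k) != 0 by rewrite conjc_eq0 psi0// sball.
have kz0 : 1 - cdot k z != 0.
  apply: cdot_neq1; apply: (@le_lt_trans _ _ (nsq k)); last exact: sball.
  by rewrite -[leRHS]mulr1 ler_wpM2l ?nsq_ge0// ltW.
have {}e : conjc (psi z) = conjc (psi k) * (onem_nsq k)%:C ^+ n * conjc (ker k z).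
  apply: (mulfI Wk0).
  have -> : (W k)%:C * conjc (psi z) = conjc (psi k) * (C k * conjc (psi z)).
    by rewrite /C mulrCA !mulrA mulfVK.
  by rewrite e; ring.
move/(congr1 (@conjc R)): e; rewrite !conjcM !conjcK conjcX conjc_real => ->.
have kk : ker k z * (1 - cdot k z) ^+ n = 1 by rewrite /ker -exprMn mulVf// expr1n.
by rewrite -mulrA kk mulr1.
Qed.
End PoleIdentity.

(** * The contradiction for two distinct nodes *)

Section Contradiction.
Variable R : realType.
Variable m : nat.
Hypothesis m0 : (0 < m)%N.
Local Notation n := m.+1.
Local Notation V := ('rV[R[i]]_n : normedModType R[i]).
Implicit Types (c d v w z : 'rV[R[i]]_n).
Variables (s : seq 'rV[R[i]]_n) (W : 'rV[R[i]]_n -> R) (psi : 'rV[R[i]]_n -> R[i]).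
Hypothesis us : uniq s.
Hypothesis sball : forall c, c \in s -> nsq c < 1.
Hypothesis W0 : forall c, c \in s -> 0 < W c.
Hypothesis psi0 : forall z, nsq z < 1 -> psi z != 0.
Local Notation P := (kernel_sum s W psi).
Hypothesis psiE : forall z, nsq z < 1 -> psi z = P z.
Hypothesis sphereE : forall z, nsq z = 1 ->
  P z * conjc (P z) = \sum_(c <- s) (W c)%:C * (onem_nsq c)%:C ^+ n * (ker c z * conjc (ker c z)).

Lemma cdotBl c d z : cdot (c - d) z = cdot c z - cdot d z.
Proof. by rewrite cdotDl -(scaleN1r d) cdotZl conjcN conjc1 mulN1r. Qed.

(** This is where [n > 1] enters: a second coordinate is available to balance the first. *)
Lemma ortho_exists k : exists2 e : 'rV[R[i]]_n, e != 0 & cdot k e = 0.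
Proof.
pose i1 : 'I_n := lift ord0 (Ordinal m0).
have i10 : i1 != ord0 by [].
have dl (j : 'I_n) (v : 'rV[R[i]]_n) : cdot v (delta_mx ord0 j) = conjc (v ord0 j).
  rewrite /cdot (bigD1 j)//= !mxE !eqxx mulr1 big1 ?addr0// => l lj.
  by rewrite mxE (negPf lj) andbF mulr0.
have [k1|k1] := eqVneq (k ord0 i1) 0.
  exists (delta_mx ord0 i1); last by rewrite dl k1 conjc0.
  by apply/eqP => /rowP/(_ i1); rewrite !mxE !eqxx => /eqP; rewrite oner_eq0.
exists (conjc (k ord0 i1) *: delta_mx ord0 ord0 - conjc (k ord0 ord0) *: delta_mx ord0 i1).
  apply/eqP => /rowP/(_ ord0); rewrite !mxE !eqxx [ord0 == i1]eq_sym (negPf i10) mulr1 mulr0 subr0.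
  by move/eqP; rewrite conjc_eq0 (negPf k1).
by rewrite -scaleNr cdotDr !cdotZr !dl mulNr mulrC subrr.
Qed.

Lemma kernel_sum_cont (z : V) : nsq z <= 1 -> {for z, continuous (P : V -> R[i]^o)}.
Proof.
move=> z1; rewrite (_ : (P : V -> R[i]^o) = fun w => \sum_(i < size s)
   (W (tnth (in_tuple s) i))%:C / conjc (psi (tnth (in_tuple s) i)) * ker (tnth (in_tuple s) i) w).
  apply: cont_sum => i; apply: (@cont_mul R[i] V (fun=> _)); first exact: cont_cst.
  by apply: ker_cont_near => //; apply: sball; exact: mem_tnth.
by apply/funext => w; rewrite /kernel_sum big_tnth.
Qed.

Lemma vabs_lt_nsq (z : V) (d : R) : 0 < d -> nsq z < d ^+ 2 -> vabs z < d.
Proof.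
move=> d0 zd; apply: vabs_lt => // j.
rewrite -(@ltr_pXn2r _ 2)// ?nnegrE ?cabs_ge0 ?(ltW d0)// cabs_sqr (le_lt_trans _ zd)//.
by rewrite /nsq (bigD1 j)//= lerDl sumr_ge0// => l _; exact: csq_ge0.
Qed.

(* The pole identity at v = v0 + t k, with v0 orthogonal to k: the evaluation
   point tends to 0 with t. *)
Lemma psi_node k : k \in s -> psi k * (onem_nsq k)%:C ^+ n = psi 0.
Proof.
move=> ks; have z01 : nsq (0 : 'rV[R[i]]_n) < 1 by rewrite nsq0.
have [->|k0] := eqVneq k 0; first by rewrite /onem_nsq nsq0 subr0 expr1n mulr1.
have kk : nsq k != 0 := contra_neq (@nsq_eq0 R n k) k0.
have kp : 0 < nsq k by rewrite lt_def kk nsq_ge0.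
have kC : (nsq k)%:C != 0 :> R[i] by rewrite (inj_eq (@realC_inj R)).
have [e e0 ke] := ortho_exists k.
(* [cdot e w != 0] keeps the projection [v0] of [w] orthogonally to [k] away from 0; the differences
   of nodes serve to separate the poles. *)
have [w /= /andP[ew /allP wP]] : exists w, all (fun d => cdot d w != 0) (e :: [seq c - k | c <- s & c != k]).
  apply: generic_vector; rewrite /= e0 /=; apply/allP => d /mapP[c].
  by rewrite mem_filter => /andP[ck _] ->; rewrite subr_eq0.
pose v0 := w - (cdot k w / (nsq k)%:C) *: k.
have kv0 : cdot k v0 = 0.
  by rewrite /v0 -scaleNr cdotDr cdotZr cdot_self mulNr divfK// subrr.
have ev0 : cdot e v0 = cdot e w.
  by rewrite /v0 -scaleNr cdotDr cdotZr (cdotC k e) ke conjc0 mulr0 addr0.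
have v00 : v0 != 0.
  apply: contra_neq ew => h; rewrite -ev0 h.
  by rewrite /cdot big1// => j _; rewrite mxE mulr0.
have vv : nsq v0 != 0 := contra_neq (@nsq_eq0 R n v0) v00.
have vp : 0 < nsq v0 by rewrite lt_def vv nsq_ge0.
(* The coefficients of [cdot (c - k) (v0 + t k)] as an affine function of [t]. If the second is 0,
   the first equals [cdot (c - k) w], which is not. *)
pose L := [seq (cdot (c - k) v0, cdot (c - k) k) | c <- s & c != k].
have [|d d0 dP] := @small_avoid R L.
  apply/allP => p /mapP[c]; rewrite mem_filter => /andP[ck cs] -> /=.
  have [h|h] := boolP (cdot (c - k) k == 0); last by rewrite orbT.
  rewrite orbF; move/eqP: h => h.
  rewrite /v0 -scaleNr cdotDr cdotZr h mulr0 addr0; apply: wP.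
  by apply/mapP; exists c => //; rewrite mem_filter ck.
clearbody v0.
pose G z := P z * (1 - cdot k z) ^+ n.
have cG : {for (0 : V), continuous (G : V -> R[i]^o)}.
  apply: (@cont_mul R[i] V (P : V -> R[i]^o) (fun z => (1 - cdot k z) ^+ n)).
    by apply: kernel_sum_cont; rewrite ltW.
  apply: diff_cont; apply: diff_exp; apply: (@diff_add R V (fun=> 1)); first exact: diff_cst.
  rewrite (_ : (fun w => _) = fun w : V => -1 * cdot k w); last by apply/funext => u; rewrite mulN1r.
  by apply: diff_mul; [exact: diff_cst|exact: cdot_diff].
have G0 : G 0 = psi 0.
  by rewrite /G (_ : cdot k 0 = 0) ?subr0 ?expr1n ?mulr1 ?psiE// /cdot big1// => j _; rewrite mxE mulr0.
apply/eqP; rewrite -subr_eq0 -cabs_eq0 eq_le cabs_ge0 andbT.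
apply/ler_addgt0Pr => ee ep; rewrite add0r ltW//.
have /contC_eps/(_ _ ep)[r r0 rP] := cG.
(* For [t <= 1] one has [nsq z <= t * (nsq k ^+ 2 / nsq v0)], so [t < q] puts [z] within [r] of
   0. *)
have q0 : 0 < r ^+ 2 / (nsq k ^+ 2 / nsq v0) by apply: divr_gt0; [exact: exprn_gt0|apply: divr_gt0 => //; exact: exprn_gt0].
set q := _ / _ in q0.
pose t := Num.min (d / 2) (Num.min 1 (q / 2)).
have t0 : 0 < t by rewrite !lt_min ltr01 (divr_gt0 d0)// (divr_gt0 q0).
have t1 : t <= 1 by rewrite !ge_min lexx orbT.
have td : t < d by rewrite gt_min ltr_pdivrMr// ltr_pMr// ltr1n.
have tq : t < q by rewrite !gt_min [q / 2 < q]ltr_pdivrMr// ltr_pMr// ltr1n !orbT.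
have tC : t%:C != 0 :> R[i] by rewrite (inj_eq (@realC_inj R)) gt_eqF.
clearbody t.
pose v := v0 + t%:C *: k.
have kv : cdot k v = (t * nsq k)%:C by rewrite /v cdotDr kv0 add0r cdotZr cdot_self rmorphM.
have v1 : v != 0.
  apply/eqP => h; move: kv; rewrite h (_ : cdot k 0 = 0); last by rewrite /cdot big1// => j _; rewrite mxE mulr0.
  by move/esym/eqP; rewrite rmorphM mulf_eq0 (negPf tC) (negPf kC).
have nv : nsq v = nsq v0 + t ^+ 2 * nsq k.
  apply: realC_inj; rewrite /= -cdot_self /v cdotDl !cdotDr !cdotZl !cdotZr kv0 (cdotC k v0) kv0 !cdot_self.
  by rewrite conjc0 conjc_real rmorphD rmorphM /= realCX; ring.
have := @pole_identity R m s W psi us sball W0 psi0 psiE sphereE v k v1 ks.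
have kv1 : cdot k v != 0 by rewrite kv rmorphM mulf_neq0.
move=> /(_ kv1).
have h c : c \in s -> c != k -> cdot c v != cdot k v.
  move=> cs ck; rewrite -subr_eq0.
  have -> : cdot c v - cdot k v = cdot (c - k) v0 + t%:C * cdot (c - k) k.
    by rewrite -cdotZr -cdotDr cdotBl.
  have tt : 0 < t < d by rewrite t0.
  have := allP (dP t tt) (cdot (c - k) v0, cdot (c - k) k); apply.
  by apply/mapP; exists c => //; rewrite mem_filter ck.
move=> /(_ h) /=; set z := _ *: v => zE.
have nz : nsq z < r ^+ 2.
  rewrite /z kv conjc_real nsqZ csqM -[csq _^-1]cabs_sqr cabsV exprVn cabs_sqr !csq_real.
  rewrite exprMn nv -mulrA.
  have Np : 0 < nsq v0 + t ^+ 2 * nsq k by rewrite ltr_wpDr// mulr_ge0 ?sqr_ge0 ?nsq_ge0.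
  have -> : ((nsq v0 + t ^+ 2 * nsq k) ^+ 2)^-1 * (nsq v0 + t ^+ 2 * nsq k) = (nsq v0 + t ^+ 2 * nsq k)^-1.
    by rewrite expr2 invfM -mulrA mulVf ?mulr1// gt_eqF.
  apply: (@le_lt_trans _ _ (t * (nsq k ^+ 2 / nsq v0))).
    rewrite -[leLHS]mulrA; apply: ler_pM; rewrite ?sqr_ge0 ?mulr_ge0 ?sqr_ge0 ?invr_ge0 ?(ltW Np) ?nsq_ge0//.
      by rewrite expr2 ler_piMr// ltW.
    rewrite ler_wpM2l ?sqr_ge0// lef_pV2 ?posrE// lerDl mulr_ge0 ?sqr_ge0 ?nsq_ge0//.
  by rewrite -ltr_pdivlMr// divr_gt0 ?exprn_gt0.
have zb : nsq z < 1.
  rewrite /z kv conjc_real nsqZ csqM -[csq _^-1]cabs_sqr cabsV exprVn cabs_sqr !csq_real.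
  have Np : 0 < nsq v by rewrite nv ltr_wpDr// mulr_ge0 ?sqr_ge0 ?nsq_ge0.
  rewrite -mulrA [(nsq v ^+ 2)^-1 * _](_ : _ = (nsq v)^-1).
    rewrite ltr_pdivrMr// mul1r exprMn nv ltr_pwDl// ler_wpM2l ?sqr_ge0//.
    by rewrite expr2 ler_piMr ?nsq_ge0// ltW// sball.
  by rewrite expr2 invfM -mulrA mulVf ?mulr1// gt_eqF.
rewrite -zE -G0 psiE//; apply: rP; apply: vabs_lt_nsq => //.
by rewrite subr0.
Qed.

(** The disc of radius [q] about 0 and that of radius [1 - q] about 1 are tangent, and meet at [q]
    only. *)
Lemma ltr_cabs_onem (t : R[i]) (q : R) : 0 < q < 1 -> cabs t <= q -> t != q%:C -> 1 - q < cabs (1 - t).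
Proof.
case: t => x y /andP[q0 q1] tq; rewrite ltNge; apply: contra => h.
have hx : q <= x.
  have := Re_le_cabs (1 - (x +i* y)) => /= /ler_normlW h1.
  have := le_trans h1 h; lra.
have h2 : x ^+ 2 + y ^+ 2 <= q ^+ 2.
  have : cabs (x +i* y) ^+ 2 <= q ^+ 2 by rewrite ler_pXn2r ?nnegrE ?cabs_ge0 ?(ltW q0).
  by rewrite cabs_sqr.
have h3 : q ^+ 2 <= x ^+ 2 by rewrite ler_pXn2r ?nnegrE ?(ltW q0)// (le_trans (ltW q0)).
have y0 : y = 0.
  by apply/eqP; rewrite -sqrf_eq0 eq_le sqr_ge0 andbT; lra.
have xq : x = q.
  apply/eqP; rewrite eq_le hx andbT -(@ler_pXn2r _ 2)// ?nnegrE ?(ltW q0) ?(le_trans (ltW q0))//.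
  by move: h2 (sqr_ge0 y); lra.
by rewrite y0 xq.
Qed.

(* At the evaluation point z of the pole identity for a node k that maximizes
   |cdot k w|, every |1 - cdot c z| is at least 1 - cdot k z, with equality only
   for c = k. *)
Theorem kernel_sum_contradiction k1 k2 : k1 \in s -> k2 \in s -> k1 != k2 -> False.
Proof.
move=> k1s k2s k12.
(* A direction orthogonal to no nonzero node, and taking different inner products with different
   nodes. *)
pose L := [seq c <- s | c != 0] ++ [seq p.1 - p.2 | p <- [seq (c, d) | c <- s, d <- s] & p.1 != p.2].
have [w /allP wP] : exists w, all (fun d => cdot d w != 0) L.
  apply: generic_vector; rewrite all_cat filter_all /=; apply/allP => p /mapP[[c d]].
  by rewrite mem_filter => /andP[/= cd _] ->; rewrite subr_eq0.
have wb c : c \in s -> c != 0 -> cdot c w != 0.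
  by move=> cs c0; apply: wP; rewrite mem_cat mem_filter c0 cs.
have wd c d : c \in s -> d \in s -> c != d -> cdot c w != cdot d w.
  move=> cs ds cd; have : cdot (c - d) w != 0.
    apply: wP; rewrite mem_cat; apply/orP; right; apply/mapP; exists (c, d) => //.
    by rewrite mem_filter cd /=; apply/allpairsP; exists (c, d).
  by rewrite cdotBl subr_eq0.
have [k ks kmax] : exists2 k, k \in s & forall c, c \in s -> cabs (cdot c w) <= cabs (cdot k w).
  have : s != [::] by case: (s) k1s.
  elim: (s) => [//|c l IH _]; case: (eqVneq l [::]) => [->|/IH[k kl kP]].
    by exists c; rewrite ?mem_head// => d; rewrite inE => /eqP ->.
  case: (leP (cabs (cdot c w)) (cabs (cdot k w))) => h.
    by exists k; rewrite ?inE ?kl ?orbT// => d /predU1P[->//|/kP].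
  exists c; rewrite ?mem_head// => d /predU1P[->//|/kP/le_trans]; apply; exact: ltW.
have kw0 : cdot k w != 0.
  have [c cs c0] : exists2 c, c \in s & c != 0.
    by have [h|h] := eqVneq k1 0; [exists k2 => //; rewrite -h eq_sym|exists k1].
  by rewrite -cabs_gt0; apply: lt_le_trans (kmax c cs); rewrite cabs_gt0 wb.
have w0 : w != 0.
  by apply: contra_neq kw0 => ->; rewrite /cdot big1// => j _; rewrite mxE mulr0.
have nw : nsq w != 0 := contra_neq (@nsq_eq0 R n w) w0.
have np : 0 < nsq w by rewrite lt_def nw nsq_ge0.
have nC : (nsq w)%:C != 0 :> R[i] by rewrite (inj_eq (@realC_inj R)).
have := @pole_identity R m s W psi us sball W0 psi0 psiE sphereE w k w0 ks kw0.
move=> /(_ (fun c cs ck => wd c k cs ks ck)) /=; set z := _ *: w.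
rewrite psi_node// => zE.
have z01 : nsq (0 : 'rV[R[i]]_n) < 1 by rewrite nsq0.
pose q : R := csq (cdot k w) / nsq w.
have kzE : cdot k z = q%:C.
  by rewrite /z cdotZr mulrAC [_ * cdot k w]mulrC -csq_cabs /q rmorphM fmorphV.
have q0 : 0 < q by rewrite divr_gt0// -cabs_sqr exprn_gt0// cabs_gt0.
have q1 : q < 1.
  rewrite ltr_pdivrMr// mul1r (le_lt_trans (cauchy_schwarz _ _))//.
  by rewrite -[ltRHS]mul1r ltr_pM2r// sball.
have zb : nsq z < 1.
  rewrite /z nsqZ csqM -!cabs_sqr cabs_conj cabsV cabs_sqr cabs_real gtr0_norm//.
  by rewrite exprVn [in X in X^-1]expr2 invfM -!mulrA mulVf// mulr1.
have tq c : c \in s -> cabs (cdot c z) <= q.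
  move=> cs; rewrite /z cdotZr !cabsM cabs_conj cabsV cabs_real gtr0_norm// /q -cabs_sqr expr2.
  by rewrite mulrAC ler_wpM2r ?invr_ge0 ?(ltW np)// ler_wpM2l ?cabs_ge0// kmax.
have tne c : c \in s -> c != k -> cdot c z != q%:C.
  move=> cs ck; rewrite -kzE /z !cdotZr; apply: contra_neq (wd _ _ cs ks ck) => h.
  by apply: (mulfI _ h); rewrite mulf_neq0 ?invr_neq0// conjc_eq0.
have p0 := psi0 z01.
(* By [psi_node] all coefficients are positive multiples of one and the same complex number. *)
have coef c : c \in s -> (W c)%:C / conjc (psi c) = (W c * onem_nsq c ^+ n)%:C / conjc (psi 0).
  move=> cs; have pc : conjc (psi c) != 0 by rewrite conjc_eq0 psi0// sball.
  have wc : (onem_nsq c)%:C != 0 :> R[i] by rewrite (inj_eq (@realC_inj R)) gt_eqF// subr_gt0 sball.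
  rewrite -(psi_node cs) conjcM conjcX conjc_real rmorphM /= realCX; field.
  by apply/andP; split => //; rewrite expf_neq0.
have PE u : nsq u < 1 -> psi u = (\sum_(c <- s) (W c * onem_nsq c ^+ n)%:C * ker c u) / conjc (psi 0).
  move=> u1; rewrite psiE// /kernel_sum mulr_suml; apply: eq_big_seq => c cs.
  by rewrite coef// mulrAC.
(* The pole identity reads [psi z * (1 - q) ^ n = psi 0]; at 0 every kernel equals 1. *)
have e : \sum_(c <- s) (W c * onem_nsq c ^+ n)%:C * (ker c z * (1 - q%:C) ^+ n) = \sum_(c <- s) (W c * onem_nsq c ^+ n)%:C.
  have pc0 : conjc (psi 0) != 0 by rewrite conjc_eq0.
  apply: (mulIf (invr_neq0 pc0)).
  transitivity (psi 0).
    rewrite -[RHS]zE kzE (PE z)// [RHS]mulrAC; congr (_ / _).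
    by rewrite mulr_suml; apply: eq_bigr => c _; rewrite mulrA.
  rewrite [LHS]PE//; congr (_ / _); apply: eq_bigr => c _; rewrite /ker.
  rewrite (_ : cdot c 0 = 0) ?subr0 ?invr1 ?expr1n ?mulr1//.
  by rewrite /cdot big1// => j _; rewrite mxE mulr0.
have Wp c : c \in s -> 0 < W c * onem_nsq c ^+ n.
  by move=> cs; rewrite mulr_gt0 ?W0// exprn_gt0// subr_gt0 sball.
(* The modulus by which the weight of [c] is multiplied on the left of [e], up to the power [n]: at
   most 1, and below 1 for every node other than [k]. *)
pose rho c := (1 - q) / cabs (1 - cdot c z).
have oq : 0 < 1 - q by rewrite subr_gt0.
have oz c : c \in s -> 1 - q <= cabs (1 - cdot c z).
  move=> cs; have := cabsD (1 - cdot c z) (cdot c z); rewrite subrK cabs1; have := tq c cs; lra.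
have rho1 c : c \in s -> 0 <= rho c <= 1.
  move=> cs; rewrite divr_ge0 ?cabs_ge0 ?(ltW oq)//= ler_pdivrMr ?mul1r ?oz//.
  exact: lt_le_trans (oz c cs).
have kE c : c \in s -> cabs (ker c z * (1 - q%:C) ^+ n) = rho c ^+ n.
  move=> cs; rewrite /ker -exprMn cabsX cabsM cabsV mulrC.
  by rewrite -(rmorph1 (real_complex R)) -rmorphB /= cabs_real gtr0_norm.
have le1 : \sum_(c <- s) W c * onem_nsq c ^+ n <= \sum_(c <- s) (W c * onem_nsq c ^+ n) * rho c ^+ n.
  have -> : \sum_(c <- s) W c * onem_nsq c ^+ n = cabs (\sum_(c <- s) (W c * onem_nsq c ^+ n)%:C).
    by rewrite -rmorph_sum /= cabs_real ger0_norm// big_seq sumr_ge0// => c cs; rewrite ltW// Wp.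
  rewrite -e big_seq (le_trans (cabs_sum _ _ _))// [leRHS]big_seq; apply: ler_sum => c cs.
  by rewrite cabsM kE// cabs_real gtr0_norm ?Wp.
have [c cs ck] : exists2 c, c \in s & c != k.
  by have [h|h] := eqVneq k1 k; [exists k2 => //; rewrite -h eq_sym|exists k1].
have : \sum_(c <- s) (W c * onem_nsq c ^+ n) * rho c ^+ n < \sum_(c <- s) W c * onem_nsq c ^+ n.
  rewrite (bigD1_seq c)//= [ltRHS](bigD1_seq c)//=; apply: ltr_leD.
    rewrite -[ltRHS]mulr1 ltr_pM2l ?Wp// exprn_ilt1//; first by case/andP: (rho1 _ cs).
    rewrite ltr_pdivrMr ?mul1r; last exact: lt_le_trans (oz c cs).
    by apply: ltr_cabs_onem; rewrite ?q0 ?tq ?tne.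
  rewrite big_seq_cond [leRHS]big_seq_cond; apply: ler_sum => d /andP[ds _].
  rewrite -[leRHS]mulr1 ler_wpM2l ?(ltW (Wp _ ds))//.
  by have /andP[h1 h2] := rho1 _ ds; rewrite exprn_ile1.
by rewrite ltNge le1.
Qed.
End Contradiction.

(** Different indices may share a node, while the comparison of poles needs distinct ones: the sums
    over indices are regrouped over the distinct nodes of positive weight. *)
Lemma no_representation (R : realType) (m : nat) (m0 : (0 < m)%N) (M : nat)
    (a : 'I_M -> 'rV[R[i]]_m.+1) (theta : 'I_M.+1 -> R) (psi : 'rV[R[i]]_m.+1 -> R[i]) :
  (forall k, cball (a k)) -> in_simplex theta ->
  (exists i j : 'I_M.+1, [/\ i != j, 0 < theta i, 0 < theta j & node a i != node a j]) ->
  normalized_invertible_multiplier psi -> represents a theta psi -> False.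
Proof.
move=> a1 [t01 _] [i1 [i2 [_ ti1 ti2 b12]]] hpsi hrep.
pose s : seq 'rV[R[i]]_m.+1 := undup [seq node a i | i <- enum 'I_M.+1 & 0 < theta i].
pose W (c : 'rV[R[i]]_m.+1) : R := \sum_(i | node a i == c) theta i.
have t0 i : 0 <= theta i by case/andP: (t01 i).
have us : uniq s := undup_uniq _.
have ins i : 0 < theta i -> node a i \in s.
  by move=> ti; rewrite mem_undup map_f// mem_filter ti mem_enum.
have sP (c : 'rV[R[i]]_m.+1) : c \in s -> exists2 i, 0 < theta i & c = node a i.
  rewrite mem_undup => /mapP[i im cE]; exists i => //.
  by move: im; rewrite mem_filter => /andP[].
have bb := node_ball a1.
have sball (c : 'rV[R[i]]_m.+1) : c \in s -> nsq c < 1 by move=> /sP[i _ ->].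
have W0 (c : 'rV[R[i]]_m.+1) : c \in s -> 0 < W c.
  move=> /sP[i ti ->]; rewrite /W (bigD1 i)//= ltr_pwDl// sumr_ge0//.
have reg (F : 'rV[R[i]]_m.+1 -> R[i]) : \sum_i (theta i)%:C * F (node a i) = \sum_(c <- s) (W c)%:C * F c.
  have -> : \sum_(c <- s) (W c)%:C * F c = \sum_(c <- s) \sum_(i | node a i == c) (theta i)%:C * F (node a i).
    by apply: eq_bigr => c _; rewrite /W rmorph_sum mulr_suml; apply: eq_bigr => i /eqP ->.
  rewrite (exchange_big_dep predT)//=; apply: eq_bigr => i _.
  have [ti|ti] := ltP 0 (theta i).
    rewrite -big_filter (eq_filter (a2 := pred1 (node a i))); last by move=> c; rewrite /= eq_sym.
    by rewrite filter_pred1_uniq ?ins// big_seq1.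
  have -> : theta i = 0 by apply/eqP; rewrite eq_le ti t0.
  by rewrite mul0r big1.
have psi0 := psi_neq0 hpsi.
have PE z : kernel_sum s W psi z = psi_sum a theta psi z.
  rewrite /psi_sum (eq_bigr (fun i => (theta i)%:C * ((conjc (psi (node a i)))^-1 * ker (node a i) z))).
    by rewrite (reg (fun c => (conjc (psi c))^-1 * ker c z)) /kernel_sum; apply: eq_bigr => c _; rewrite mulrA.
  by move=> i _; rewrite mulrA.
apply: (@kernel_sum_contradiction R m m0 s W psi us sball W0 psi0 _ _ (node a i1) (node a i2) (ins _ ti1) (ins _ ti2) b12).
  by move=> z z1; rewrite PE (psi_formula a1 hpsi hrep).
move=> z z1; rewrite PE.
have := modulus_gap_eq0 a1 hpsi hrep z1; rewrite /modulus_gap => /eqP; rewrite subr_eq0 => /eqP ->.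
rewrite (reg (fun c => khat c z * conjc (khat c z))); apply: eq_big_seq => c cs.
rewrite -mulrA -(khat_sqr (sball c cs)) khatE conjcM conjcX conjc_real; ring.
Qed.

Theorem lemma42 (R : realType) (n : nat) (hn : (1 < n)%N) :
  ~ invertible_multiplier_property R n /\
  forall (M : nat) (a : 'I_M -> 'rV[R[i]]_n) (theta : 'I_M.+1 -> R),
    (1 <= M)%N -> (forall m, cball (a m)) -> in_simplex theta ->
    (exists i j : 'I_M.+1,
       [/\ i != j, 0 < theta i, 0 < theta j & node a i != node a j]) ->
    ~ exists psi : 'rV[R[i]]_n -> R[i],
        normalized_invertible_multiplier psi /\ represents a theta psi.
Proof.
case: n hn => [//|m hm]; have m0 : (0 < m)%N by [].
have second (M : nat) (a : 'I_M -> 'rV[R[i]]_m.+1) (theta : 'I_M.+1 -> R) :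
    (1 <= M)%N -> (forall m, cball (a m)) -> in_simplex theta ->
    (exists i j : 'I_M.+1,
       [/\ i != j, 0 < theta i, 0 < theta j & node a i != node a j]) ->
    ~ exists psi : 'rV[R[i]]_m.+1 -> R[i],
        normalized_invertible_multiplier psi /\ represents a theta psi.
  by move=> _ a1 th ij [psi [h1 h2]]; exact: (no_representation m0 a1 th ij h1 h2).
split=> // imp.
(* An instance that refutes the property: the nodes 0 and [e_0 / 2], each with weight 1/2. *)
pose a (_ : 'I_1) : 'rV[R[i]]_m.+1 := (2^-1)%:C *: head_vec R m.
pose theta (_ : 'I_2) : R := 2^-1.
have h0 : 0 < 2^-1 :> R by rewrite invr_gt0.
have h1 : 2^-1 < 1 :> R by rewrite invf_lt1// ltr1n.
have a1 k : cball (a k) by rewrite /cball /= nsq_head_vec csq_real expr_lt1// ltW.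
have th : in_simplex theta.
  split=> [k|]; first by rewrite /theta !ltW.
  by rewrite !big_ord_recl big_ord0 addr0 /theta; field.
apply: (second 1%N a theta) => //; last exact: imp.
exists ord0, (lift ord0 ord0); split => //.
rewrite /node unlift_none liftK /=; apply/eqP => h.
have := a1 ord0; have : nsq (a ord0) = nsq (0 : 'rV[R[i]]_m.+1) by rewrite -h.
rewrite nsq_head_vec nsq0 csq_real => /eqP; rewrite expf_eq0 /= invr_eq0 pnatr_eq0//.
Qed.
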